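(* Let $n\ge2$. The sharp value of the constant $\Lambda$ in the inequality $$\int_{\mathbb{R}^n_+}x_n|\nabla u|^2\,dx\ \ge\ \Lambda\int_{\mathbb{R}^n_+}\frac{|u|^2}{(x_{n-1}^2+x_n^2)^{1/2}}\,dx\qquad\text{for all }u\in C_0^\infty(\overline{\mathbb{R}^n_+}),$$ and in the inequality $$\int_{\mathbb{R}^n_+}|\nabla v|^2\,dx\ \ge\ \frac14\int_{\mathbb{R}^n_+}\frac{|v|^2}{x_n^2}\,dx+\Lambda\int_{\mathbb{R}^n_+}\frac{|v|^2\,dx}{x_n(x_{n-1}^2+x_n^2)^{1/2}}\qquad\text{for all }v\in C_0^\infty(\mathbb{R}^n_+),$$ is equal to $$\lambda:=\inf\frac{\displaystyle\int_0^{\pi}\Bigl[|y'(\varphi)|^2+\frac14|y(\varphi)|^2\Bigr]\sin\varphi\,d\varphi}{\displaystyle\int_0^{\pi}|y(\varphi)|^2\,d\varphi},$$ where the infimum is taken over all smooth functions $y$ on $[0,\pi]$. By numerical approximation, $\lambda=0.1564\ldots$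
   Context: $\mathbb{R}^n_+=\{x=(x_1,\dots,x_n)\in\mathbb{R}^n:\ x_n>0\}$. $C_0^\infty(\mathbb{R}^n_+)$ and $C_0^\infty(\overline{\mathbb{R}^n_+})$ are the spaces of infinitely differentiable functions with compact support in $\mathbb{R}^n_+$ and in the closed half-space $\overline{\mathbb{R}^n_+}$, respectively (so functions in the latter need not vanish on $\partial\mathbb{R}^n_+$). ''Sharp value'' means the largest $\Lambda$ for which the inequality holds for all admissible functions. *)

(* Defs.v *)
From HB Require Import structures.
From mathcomp Require Import all_boot all_order all_algebra.
From mathcomp Require Import all_classical all_reals all_analysis.

Set Implicit Arguments.
Unset Strict Implicit.
Unset Printing Implicit Defensive.
Import Order.TTheory GRing.Theory Num.Theory.
Import numFieldNormedType.Exports.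
Local Open Scope classical_set_scope.
Local Open Scope ring_scope.

(* Lebesgue measure on R^n, carried by n-tuples (which have the product Borel
   sigma-algebra in the library): R^0 is a point of mass 1, and the measure on
   R^(n+1) is the product of those on R and R^n, transported along consing. *)
Section lebesgue_measure_tuple.
Context (R : realType).
Local Notation mR := (measurableTypeR R).

Definition tcons n (p : mR * n.-tuple mR) : n.+1.-tuple mR :=
  [the n.+1.-tuple mR of p.1 :: p.2].

Definition tuncons n (t : n.+1.-tuple mR) : mR * n.-tuple mR :=
  (tnth t ord0, [tuple of behead t]).

Lemma tconsK n : cancel (@tcons n) (@tuncons n).
Proof. by case=> x t; congr pair; apply: val_inj. Qed.

Lemma tunconsK n : cancel (@tuncons n) (@tcons n).
Proof. by move=> t; rewrite [RHS]tuple_eta. Qed.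

Lemma measurable_tcons n : measurable_fun [set: mR * n.-tuple mR] (@tcons n).
Proof. exact: measurable_cons. Qed.

Lemma measurable_tuncons n : measurable_fun [set: n.+1.-tuple mR] (@tuncons n).
Proof.
apply/measurable_fun_pairP; split.
- exact: measurable_tnth.
- exact: measurable_behead.
Qed.

Section step.
Context (n : nat) (m : {sigma_finite_measure set (n.-tuple mR) -> \bar R}).

Definition lebesgue_tupleS : set (n.+1.-tuple mR) -> \bar R :=
  pushforward (lebesgue_measure \x m)%E (@tcons n).

Let lebesgue_tupleS0 : lebesgue_tupleS set0 = 0%E.
Proof. by rewrite /lebesgue_tupleS /pushforward preimage_set0 measure0. Qed.

Let lebesgue_tupleS_ge0 A : (0 <= lebesgue_tupleS A)%E.
Proof. by apply: measure_ge0; exact: measurable_tcons. Qed.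

Let lebesgue_tupleS_sigma_additive : semi_sigma_additive lebesgue_tupleS.
Proof. by apply: measure_semi_sigma_additive; exact: measurable_tcons. Qed.

HB.instance Definition _ := isMeasure.Build _ _ _ lebesgue_tupleS
  lebesgue_tupleS0 lebesgue_tupleS_ge0 lebesgue_tupleS_sigma_additive.

Let lebesgue_tupleS_sigma_finite : sigma_finite setT lebesgue_tupleS.
Proof.
have /sigma_finiteP[F [FT ndF Foo]] := sigma_finiteT (@lebesgue_measure R).
have /sigma_finiteP[G [GT ndG Goo]] := sigma_finiteT m.
exists (fun k => @tuncons n @^-1` (F k `*` G k)).
  apply/esym; rewrite -subTset => t _.
  have : [set: mR] (tuncons t).1 by [].
  rewrite FT => -[i _ Fi].
  have : [set: n.-tuple mR] (tuncons t).2 by [].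
  rewrite GT => -[j _ Gj].
  exists (maxn i j) => //; split.
  - have /subsetPset FF := ndF _ _ (leq_maxl i j); exact: FF.
  - have /subsetPset GG := ndG _ _ (leq_maxr i j); exact: GG.
move=> k; have [mF Fk] := Foo k; have [mG Gk] := Goo k; split.
  rewrite -[X in measurable X]setTI; apply: measurable_tuncons => //.
  exact: measurableX.
rewrite /lebesgue_tupleS /pushforward -comp_preimage.
rewrite (_ : _ \o _ = id) ?preimage_id; last first.
  by apply/funext => p /=; rewrite tconsK.
by rewrite product_measure1E// lte_mul_pinfty// ge0_fin_numE.
Qed.

HB.instance Definition _ := Measure_isSigmaFinite.Build _ _ _ lebesgue_tupleS
  lebesgue_tupleS_sigma_finite.

End step.

Fixpoint lebesgue_tuple n : {sigma_finite_measure set (n.-tuple mR) -> \bar R} :=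
  match n with
  | 0 => dirac ([tuple] : 0.-tuple mR)
  | n'.+1 => lebesgue_tupleS (lebesgue_tuple n')
  end.

End lebesgue_measure_tuple.

Section functions_on_Rn.
Context (R : realType) (n : nat).
Implicit Types (D : set 'rV[R]_n) (u : 'rV[R]_n -> R).

Definition rv_of_tuple (t : n.-tuple R) : 'rV[R]_n := \row_i tnth t i.

Definition integral_rv D (f : 'rV[R]_n -> R) : \bar R :=
  (\int[@lebesgue_tuple R n]_(t in [set t | D (rv_of_tuple t)])
     (f (rv_of_tuple t))%:E)%E.

Definition partial (i : 'I_n) u : 'rV[R]_n -> R :=
  fun x => 'D_(delta_mx 0 i) u x.

Definition normsq_grad u (x : 'rV[R]_n) : R := \sum_i `|partial i u x| ^+ 2.

(* Every iterated partial derivative is (Frechet) differentiable, which gives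
   both the existence and the continuity of all partial derivatives. *)
Definition smooth u : Prop :=
  forall (s : seq 'I_n) (x : 'rV[R]_n), differentiable (foldr partial u s) x.

(* The space C_0^oo(D), for D open or the closure of an open half-space.  Its
   elements are functions on D; they are represented by smooth extensions to
   R^n, and their values outside D are irrelevant.  The support is that of the
   restriction to D, and it must be a compact subset of D: for a closed
   half-space this imposes no vanishing on the boundary. *)
Definition C0infty D u : Prop :=
  let supp := closure (D `&` [set x | u x != 0]) in
  [/\ smooth u, compact supp & supp `<=` D].

End functions_on_Rn.

(* With N := n.+2 >= 2, the coordinates x_(N-1) and x_N of a point of R^N are
   those of indices n and n.+1, as row vectors are indexed from 0. *)
Section half_space.
Context (R : realType) (n : nat).

Definition xpenult (x : 'rV[R]_n.+2) : R := x 0 (inord n).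
Definition xlast (x : 'rV[R]_n.+2) : R := x 0 ord_max.

Definition half_space : set 'rV[R]_n.+2 := [set x | 0 < xlast x].

End half_space.
Arguments half_space : clear implicits.

Section rayleigh.
Context (R : realType).

(* A smooth function on [0, pi] is represented by a smooth extension to R. *)
Definition smooth1 (y : R -> R) : Prop :=
  forall (k : nat) (t : R), derivable (derive1n k y) t 1.

Definition rayleigh_num (y : R -> R) : R :=
  \int[lebesgue_measure]_(t in `[0, pi])
    ((`|derive1 y t| ^+ 2 + 4^-1 * `|y t| ^+ 2) * sin t).

Definition rayleigh_den (y : R -> R) : R :=
  \int[lebesgue_measure]_(t in `[0, pi]) (`|y t| ^+ 2).

(* The quotient only makes sense for y not identically zero on [0, pi], i.e.
   for a nonzero denominator. *)
Definition lambda : R :=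
  inf [set q | exists y, [/\ smooth1 y, rayleigh_den y != 0
                           & q = rayleigh_num y / rayleigh_den y]].

End rayleigh.
Arguments lambda : clear implicits.

Definition sharp_value (R : realType) (holds : R -> Prop) (L : R) : Prop :=
  holds L /\ forall L', holds L' -> L' <= L.

(* Main.v *)
Require Import Defs.
From HB Require Import structures.
From mathcomp Require Import all_boot all_order all_algebra.
From mathcomp Require Import all_classical all_reals all_analysis.
From mathcomp Require Import measurable_realfun ring lra.

Set Implicit Arguments.
Unset Strict Implicit.
Unset Printing Implicit Defensive.
Import Order.TTheory GRing.Theory Num.Theory.
Import numFieldNormedType.Exports.
Local Open Scope classical_set_scope.
Local Open Scope ring_scope.


(** Write the last two coordinates as [s = - r cos phi], [t = r sin phi]. In the weighted inequality
    the weight contributes [r sin phi] and the area element a further [r], which cancels the [1 / r]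
    on the other side. Once the derivatives in the remaining variables are dropped, it is enough
    that, slice by slice, the integral of [sin phi (r^2 u_r^2 + u_phi^2)] dominates [lambda] times
    that of [u^2], both against [dr dphi]. On each ray the one-dimensional Hardy inequality
    ([hardy]) turns [r^2 u_r^2] into [u^2 / 4]. On each half-circle what is left is the inequality
    defining [lambda] ([angular_inequality]). This is [lower_bound].

    The unweighted inequality is the same statement after the substitution [v = x_n^(1/2) u]. Then
    [|grad v|^2 = x_n |grad u|^2 + v^2 / (4 x_n^2) + u u_t], and the last term is an exact
    derivative which integrates to zero when [u] vanishes at the boundary and far away
    ([transfer_identity]).

    For sharpness, one family of test functions supported inside the open half-space serves both
    inequalities ([near_optimal]). Take a near-minimizer [y] of the angular quotient. Multiply it by
    a logarithmic cutoff in [sin phi], which costs little because the weight [sin phi] vanishes at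
    the end points ([angular_cutoff]). Multiply the result by [r^(-1/2)], the borderline function of
    Hardy's inequality, truncated by a bump in [d ln r + k], and by fixed bumps in the other
    variables. Small [d] makes the radial part nearly optimal. Large [k] concentrates the function
    near [r = 0], where the derivatives in the other variables carry a negligible weight. All the
    integrals factor into one-dimensional ones ([integral_tensor_polar]), which gives [test_bound].

    The numerical lower bound on [lambda] comes from a positive supersolution of the angular
    Euler-Lagrange equation, an explicit polynomial in [sin phi] ([sub_bound]). The upper bound
    comes from the trial function [1 - sin phi / 10] together with a rational lower bound on [pi]
    ([pi_gt]). *)

(** * Smooth functions on open subsets of a normed space *)

Section smooth_calculus.
Context {R : realType} {T : normedModType R} {I : Type} (e : I -> T).
Implicit Types (U V : set T) (u v : T -> R).

(** The family [e] of directions is a parameter, so that one calculus serves both the real line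
    ([e1]) and row vectors ([erv]). *)
Definition pd i u : T -> R := fun x => 'D_(e i) u x.

Fixpoint Ck k U u : Prop :=
  if k is k'.+1 then
    (forall x, U x -> differentiable u x) /\ forall i, Ck k' U (pd i u)
  else forall x, U x -> differentiable u x.

Definition Coo U u := forall k, Ck k U u.

Lemma Ck_diff k U u x : Ck k U u -> U x -> differentiable u x.
Proof. by case: k => [|k] /=; [exact|case=> + _; exact]. Qed.

Lemma Coo_diff U u x : Coo U u -> U x -> differentiable u x.
Proof. by move=> /(_ 0); exact: Ck_diff. Qed.

Lemma Ck_prev k U u : Ck k.+1 U u -> Ck k U u.
Proof.
elim: k u => [|k IH] u; first by case.
by move=> [du H]; split => // i; apply: IH; exact: H.
Qed.

Lemma Coo_pd U u i : Coo U u -> Coo U (pd i u).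
Proof. by move=> Cu k; have [_] := Cu k.+1; exact. Qed.

Lemma CkS k U V u : U `<=` V -> Ck k V u -> Ck k U u.
Proof.
move=> UV; elim: k u => [|k IH] u /=; first by move=> H x /UV; exact: H.
by move=> [du H]; split => [x /UV|i]; [exact: du|apply: IH; exact: H].
Qed.

Lemma CooS U V u : U `<=` V -> Coo V u -> Coo U u.
Proof. by move=> UV Cu k; exact: CkS (Cu k). Qed.

Lemma near_pd U u v i : open U -> {in U, u =1 v} -> {in U, pd i u =1 pd i v}.
Proof.
move=> oU uv x; rewrite inE => Ux; apply: near_eq_derive.
by near=> y; apply: uv; rewrite inE; near: y; exact: open_nbhs_nbhs.
Unshelve. all: by end_near. Qed.

(** Differentiability depends only on the germ: the first-order expansion of [u] is also one of [v],
    and uniqueness of the differential identifies its linear part. *)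
Lemma near_differentiable u v x :
  (\forall y \near x, u y = v y) -> differentiable u x -> differentiable v x.
Proof.
move=> uv du; have [dc] := (diff_locallyP x u).1 du; move=> /eqaddoP H.
have shx : \forall h \near (0 : T), u (h + x) = v (h + x).
  have c0 : (fun h => h + x) h @[h --> (0 : T)] --> x.
    by rewrite -[X in _ --> X]add0r; apply: cvgD; [exact: cvg_id|exact: cvg_cst].
  exact: (c0 _ uv).
have vE : v \o shift x = cst (v x) + 'd u x +o_ 0 id.
  apply/eqaddoP => eps eps0; near=> h.
  rewrite /= !fctE/= -(nbhs_singleton uv).
  have <- : u (h + x) = v (h + x) by near: h.
  by near: h; exact: H.
have dE := diff_unique dc vE.
by apply/diff_locallyP; rewrite dE.
Unshelve. all: by end_near. Qed.

Lemma Ck_eq k U u v : open U -> {in U, u =1 v} -> Ck k U u -> Ck k U v.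
Proof.
move=> oU; elim: k u v => [|k IH] u v uv /=.
  move=> du x Ux; apply: (near_differentiable _ (du x Ux)).
  by near=> y; apply: uv; rewrite inE; near: y; exact: open_nbhs_nbhs.
move=> [du H]; split.
  move=> x Ux; apply: (near_differentiable _ (du x Ux)).
  by near=> y; apply: uv; rewrite inE; near: y; exact: open_nbhs_nbhs.
by move=> i; apply: IH (H i); exact: near_pd.
Unshelve. all: by end_near. Qed.

Lemma Coo_eq U u v : open U -> {in U, u =1 v} -> Coo U u -> Coo U v.
Proof. by move=> oU uv Cu k; exact: Ck_eq (Cu k). Qed.

Lemma Coo_cst U (c : R) : Coo U (fun=> c).
Proof.
move=> k; elim: k c => [|k IH] c /=; first by move=> x _; exact: differentiable_cst.
split=> [x _|i]; first exact: differentiable_cst.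
rewrite (_ : pd i _ = fun=> 0); first exact: IH.
by apply/funext => x; rewrite /pd derive_cst.
Qed.

Lemma CkD k U u v : open U -> Ck k U u -> Ck k U v -> Ck k U (fun x => u x + v x).
Proof.
move=> oU; elim: k u v => [|k IH] u v /=.
  by move=> du dv x Ux; apply: differentiableD; [exact: du|exact: dv].
move=> [du Hu] [dv Hv]; split=> [x Ux|i].
  by apply: differentiableD; [exact: du|exact: dv].
apply: (@Ck_eq _ _ (fun x => pd i u x + pd i v x)) => //; last exact: IH.
move=> x; rewrite inE => Ux; rewrite /pd deriveD//; apply: diff_derivable.
- exact: du.
- exact: dv.
Qed.

Lemma CkM k U u v : open U -> Ck k U u -> Ck k U v -> Ck k U (fun x => u x * v x).
Proof.
move=> oU; elim: k u v => [|k IH] u v.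
  by move=> du dv x Ux; apply: differentiableM; [exact: du|exact: dv].
move=> Cu Cv; have [du Hu] := Cu; have [dv Hv] := Cv; split=> [x Ux|i].
  by apply: differentiableM; [exact: du|exact: dv].
apply: (@Ck_eq _ _ (fun x => u x * pd i v x + pd i u x * v x)) => //; last first.
  by apply: CkD => //; apply: IH; first [exact: Hu|exact: Hv|exact: Ck_prev].
move=> x; rewrite inE => Ux; rewrite /pd deriveM//.
- by congr (_ + _); rewrite mulrC.
- by apply: diff_derivable; exact: du.
- by apply: diff_derivable; exact: dv.
Qed.

Lemma CooD U u v : open U -> Coo U u -> Coo U v -> Coo U (fun x => u x + v x).
Proof. by move=> oU Cu Cv k; exact: CkD. Qed.

Lemma CooM U u v : open U -> Coo U u -> Coo U v -> Coo U (fun x => u x * v x).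
Proof. by move=> oU Cu Cv k; exact: CkM. Qed.

Lemma CooZ U u (c : R) : open U -> Coo U u -> Coo U (fun x => c * u x).
Proof. by move=> oU Cu; apply: CooM => //; exact: Coo_cst. Qed.

Lemma CooB U u v : open U -> Coo U u -> Coo U v -> Coo U (fun x => u x - v x).
Proof.
move=> oU Cu Cv; apply: (@Coo_eq _ (fun x => u x + -1 * v x)) => //.
  by move=> x _; rewrite mulN1r.
by apply: CooD => //; exact: CooZ.
Qed.

Lemma Ck_sum k U (J : Type) (r : seq J) (f : J -> T -> R) : open U ->
  (forall j, Ck k U (f j)) -> Ck k U (fun x => \sum_(j <- r) f j x).
Proof.
move=> oU Cf; elim: r => [|j r IH].
  by rewrite (_ : (fun=> _) = fun=> 0); [exact: Coo_cst|apply/funext => x; rewrite big_nil].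
rewrite (_ : (fun=> _) = fun x => f j x + \sum_(j <- r) f j x); first exact: CkD.
by apply/funext => x; rewrite big_cons.
Qed.

Lemma Coo_prod U (J : Type) (r : seq J) (f : J -> T -> R) : open U ->
  (forall j, Coo U (f j)) -> Coo U (fun x => \prod_(j <- r) f j x).
Proof.
move=> oU Cf; elim: r => [|j r IH].
  by rewrite (_ : (fun=> _) = fun=> 1); [exact: Coo_cst|apply/funext => x; rewrite big_nil].
rewrite (_ : (fun=> _) = fun x => f j x * \prod_(j <- r) f j x); first exact: CooM.
by apply/funext => x; rewrite big_cons.
Qed.

(** In [foldr] the last index of the list is the first derivative taken, hence the induction peels
    lists from the right. *)
Lemma Coo_smoothP U u :
  Coo U u <-> forall s x, U x -> differentiable (foldr pd u s) x.
Proof.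
split=> [Cu s|].
  elim/last_ind: s u Cu => [|s i IH] u Cu x Ux; first exact: Coo_diff Cu Ux.
  by rewrite foldr_rcons; apply: IH => //; exact: Coo_pd.
move=> H k; elim: k u H => [|k IH] u H; first exact: (H [::]).
split; first exact: (H [::]).
move=> i; apply: IH => s x Ux.
by have := H (rcons s i) x Ux; rewrite foldr_rcons.
Qed.

End smooth_calculus.

(** * Chain rule and composition of smooth maps *)

Section composition.
Context {R : realType} {T T' : normedModType R} {I : Type} {I' : finType}.
Context (e : I -> T) (e' : I' -> T') (c : I' -> {linear T' -> R^o}).
Hypothesis c_continuous : forall j, continuous (c j).
Hypothesis c_coord : forall v, v = \sum_j c j v *: e' j.

Lemma differentiable_coords (g : T -> T') x :
  (forall j, differentiable (c j \o g) x) -> differentiable g x.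
Proof.
move=> dg; rewrite (_ : g = fun y => \sum_j c j (g y) *: e' j); last first.
  by apply/funext => y; rewrite -c_coord.
elim: (index_enum I') => [|j r IH].
  rewrite (_ : (fun=> _) = fun=> 0); first exact: differentiable_cst.
  by apply/funext => y; rewrite big_nil.
rewrite (_ : (fun=> _) =
    (fun y => c j (g y) *: e' j) + fun y => \sum_(j <- r) c j (g y) *: e' j).
  by apply: differentiableD => //; apply: differentiableZl; exact: dg.
by apply/funext => y; rewrite big_cons.
Qed.

Lemma pd_comp (f : T' -> R) (g : T -> T') i x :
  differentiable g x -> differentiable f (g x) ->
  pd e i (f \o g) x = \sum_j pd e i (c j \o g) x * pd e' j f (g x).
Proof.
move=> dg df; rewrite /pd deriveE; last exact: differentiable_comp.
rewrite diff_comp//= [X in 'd f _ X]c_coord linear_sum; apply: eq_bigr => j _.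
have dc : differentiable (c j) (g x).
  exact: (@linear_differentiable _ T' R^o (c j) _ (c_continuous (j:=j))).
rewrite linearZ/= deriveE; last exact: differentiable_comp.
rewrite (diff_comp dg dc) /= (@diff_lin _ T' R^o (c j) _ (c_continuous (j:=j))).
by rewrite deriveE.
Qed.

(** Induction on the order: by the chain rule a derivative of [f \o g] is a sum of products of a
    derivative of a coordinate of [g] with a derivative of [f] composed with [g], to which the
    induction hypothesis applies. *)
Lemma Coo_comp U V (f : T' -> R) (g : T -> T') :
  open U -> (forall x, U x -> V (g x)) -> Coo e' V f ->
  (forall j, Coo e U (c j \o g)) -> Coo e U (f \o g).
Proof.
move=> oU gV Cf Cg k.
have dg x : U x -> differentiable g x.
  by move=> Ux; apply: differentiable_coords => j; exact: Coo_diff (Cg j) Ux.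
 elim: k f Cf => [|k IH] f Cf.
  move=> x Ux; apply: differentiable_comp; first exact: dg.
  exact: Coo_diff Cf (gV _ Ux).
split.
  move=> x Ux; apply: differentiable_comp; first exact: dg.
  exact: Coo_diff Cf (gV _ Ux).
move=> i; apply: (@Ck_eq _ _ _ _ _ _ (fun x => \sum_j pd e i (c j \o g) x * pd e' j f (g x))) => //.
  move=> x; rewrite inE => Ux; rewrite pd_comp//; first exact: dg.
  exact: Coo_diff Cf (gV _ Ux).
apply: Ck_sum => // j; apply: CkM => //; first by apply: Coo_pd; exact: Cg.
by apply: IH; exact: Coo_pd.
Qed.

End composition.

(** * Elementary functions of one variable *)

Section one_variable.
Context {R : realType}.

Lemma is_derive_mul (f g : R -> R) (x df dg : R) :
  is_derive x 1 f df -> is_derive x 1 g dg ->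
  is_derive x 1 (fun y => f y * g y) (f x * dg + df * g x).
Proof.
move=> Hf Hg; have := @is_deriveM _ _ f g x 1 df dg Hf Hg.
by rewrite [df * _]mulrC.
Qed.

Lemma is_derive_add (f g : R -> R) (x df dg : R) :
  is_derive x 1 f df -> is_derive x 1 g dg ->
  is_derive x 1 (fun y => f y + g y) (df + dg).
Proof. by move=> Hf Hg; have := @is_deriveD _ _ _ f g x 1 df dg Hf Hg. Qed.

Lemma is_derive_cstr (k x : R) : is_derive x 1 (fun=> k) 0.
Proof. exact: is_derive_cst. Qed.

Lemma is_derive_idr (x : R) : is_derive x 1 (fun y => y) 1.
Proof. exact: is_derive_id. Qed.

Lemma is_derive_eqr (f : R -> R) (x d d' : R) :
  is_derive x 1 f d -> d = d' -> is_derive x 1 f d'.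
Proof. by move=> ? <-. Qed.

Definition e1 : unit -> R := fun=> 1.

Definition Coo1 (U : set R) (f : R -> R) := Coo e1 U f.

Lemma smooth1P (f : R -> R) : smooth1 f <-> Coo1 setT f.
Proof.
have E s : foldr (pd e1) f s = derive1n (size s) f.
  elim: s => [//|i s IH].
  by rewrite [size _]/= derive1nS -IH; apply/funext => x; rewrite derive1E.
rewrite /Coo1 Coo_smoothP; split=> [sf s x _|H k t].
  by rewrite E; apply/derivable1_diffP; exact: sf.
by apply/derivable1_diffP; have := H (nseq k tt) t I; rewrite E size_nseq.
Qed.

(** The bootstrapping step behind the smoothness of the elementary functions: their derivatives are
    expressions in functions whose regularity is already known, possibly at a lower order. *)
Lemma Ck1S k (U : set R) (f f' : R -> R) : open U ->
  (forall x, U x -> is_derive x 1 f (f' x)) -> Ck e1 k U f' -> Ck e1 k.+1 U f.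
Proof.
move=> oU df Cf'; split=> [x Ux|i].
  by apply/derivable1_diffP; have [] := df x Ux.
apply: Ck_eq Cf' => // x; rewrite inE => Ux.
by have := df x Ux; rewrite /pd => ?; rewrite derive_val.
Qed.

Lemma Coo1_id (U : set R) : open U -> Coo1 U id.
Proof.
move=> oU k; apply: Ck_prev; apply: (@Ck1S _ _ _ (fun=> 1)) => //.
exact: Coo_cst.
Qed.

Lemma Coo1_derive (U : set R) f : Coo1 U f -> Coo1 U (derive1 f).
Proof.
move=> /(Coo_pd tt); rewrite (_ : pd e1 tt f = derive1 f)//.
by apply/funext => x; rewrite derive1E.
Qed.

Lemma Coo1_is_derive (U : set R) f x : Coo1 U f -> U x ->
  is_derive x 1 f (derive1 f x).
Proof.
move=> Cf Ux; have /derivable1_diffP df := Coo_diff Cf Ux.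
by rewrite derive1E; apply: DeriveDef.
Qed.

Lemma Coo1_continuous (U : set R) f x : Coo1 U f -> U x -> {for x, continuous f}.
Proof. by move=> Cf /(Coo_diff Cf) /differentiable_continuous. Qed.

Lemma Coo_comp1 {T : normedModType R} {I : Type} (e : I -> T)
    (U : set T) (V : set R) (f : R -> R) (g : T -> R) :
  open U -> (forall x, U x -> V (g x)) -> Coo1 V f -> Coo e U g ->
  Coo e U (f \o g).
Proof.
move=> oU gV Cf Cg.
apply: (@Coo_comp _ T R I unit e e1 (fun=> idfun : {linear R -> R^o}) _ _ U V) => //.
  by move=> _ x; exact: cvg_id.
by move=> v; rewrite (big_pred1 tt) => [|[]//]; rewrite /e1 [_%:A]mulr1.
Qed.

Lemma Coo1_expR : Coo1 setT expR.
Proof.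
move=> k; elim: k => [|k IH].
  by move=> x _; apply/derivable1_diffP; exact: ex_derive.
by apply: (Ck1S openT _ IH) => x _; exact: is_derive_expR.
Qed.

Lemma open_neq0 : open [set x : R | x != 0].
Proof. exact: open_neq. Qed.

Lemma Coo1_inv : Coo1 [set x | x != 0] (fun x => x^-1).
Proof.
have D (x : R) : x != 0 -> is_derive x 1 (fun x : R => x^-1) (-1 * (x^-1 * x^-1)).
  move=> x0; apply: is_derive_eq; first exact: (@is_deriveV _ id).
  by rewrite [_%:A]mulr1 -exprVn expr2 mulN1r.
move=> k; elim: k => [|k IH].
  move=> x x0; apply/derivable1_diffP.
  by have [] := D x x0.
apply: (Ck1S open_neq0 D); apply: CkM; [exact: open_neq0|exact: Coo_cst|].
by apply: CkM => //; exact: open_neq0.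
Qed.

Lemma open_gt0 : open [set x : R | 0 < x].
Proof. exact: open_gt. Qed.

Lemma Coo1_ln : Coo1 [set x | 0 < x] (@ln R).
Proof.
move=> k; apply: Ck_prev; apply: (Ck1S open_gt0 (@is_derive1_ln R)).
apply: CkS (Coo1_inv k) => x /= x0; exact: lt0r_neq0.
Qed.

Lemma Coo1_atan : Coo1 setT (@atan R).
Proof.
move=> k; apply: Ck_prev; apply: (Ck1S openT (fun x _ => is_derive1_atan x)).
have -> : (fun x : R => (1 + x ^+ 2)^-1) = (fun x => x^-1) \o (fun x => 1 + x * x).
  by apply/funext => x /=; rewrite expr2.
have oT : open [set: R] := openT.
have := @Coo_comp1 _ _ e1 setT [set x | x != 0] _ (fun x => 1 + x * x) oT _ Coo1_inv.
apply.
  move=> x _ /=; apply: lt0r_neq0; rewrite -expr2.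
  by rewrite ltr_pwDl// sqr_ge0.
apply: CooD => //; first exact: Coo_cst.
by apply: CooM => //; exact: Coo1_id.
Qed.

Lemma Coo1_sin_cos : Coo1 setT (@sin R) /\ Coo1 setT (@cos R).
Proof.
suff H k : Ck e1 k setT (@sin R) /\ Ck e1 k setT (@cos R).
  by split=> k; have [] := H k.
elim: k => [|k [Cs Cc]].
  by split=> x _; apply/derivable1_diffP; exact: ex_derive.
have oT : open [set: R] := openT.
split; first by apply: (Ck1S oT _ Cc) => x _; exact: is_derive_sin.
apply: (Ck1S oT (f' := fun x => -1 * sin x)).
  by move=> x _; apply: is_derive_eq; rewrite mulN1r.
by apply: CkM => //; exact: Coo_cst.
Qed.

End one_variable.

(** * Flat functions at the origin *)

Section flat.
Context {R : realType}.
Implicit Types (x z : R) (k : nat).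

(* [flat k x] is [x ^- k * exp (- 1/x)] on the positive half-line; the powers
   make this family stable under derivation. *)
Definition flat k x : R := if 0 < x then x ^- k * expR (- x^-1) else 0.

Lemma flat_ge0 k x : 0 <= flat k x.
Proof.
by rewrite /flat; case: ifPn => // x0; rewrite mulr_ge0 ?expR_ge0// invr_ge0 exprn_ge0// ltW.
Qed.

Lemma flat_gt0 k x : 0 < x -> 0 < flat k x.
Proof. by move=> x0; rewrite /flat x0 mulr_gt0 ?expR_gt0// invr_gt0 exprn_gt0. Qed.

Lemma flat_le0 k x : x <= 0 -> flat k x = 0.
Proof. by rewrite /flat leNgt => /negbTE ->. Qed.

(** One term of the exponential series gives [expR z >= z ^+ k.+1 / k.+1!] at [z = 1 / x]. The
    linear bound forces every [flat k] to tend to 0 at the origin. *)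
Lemma flat_bound k x : 0 <= flat k x <= k.+1`!%:R * `|x|.
Proof.
rewrite flat_ge0/= /flat; case: ifPn => [x0|_]; last by rewrite mulr_ge0.
rewrite gtr0_norm// expRN.
have z0 : 0 < x^-1 by rewrite invr_gt0.
have := expR_ge1Dxn k (ltW z0).
have fac : 0 < k.+1`!%:R :> R by rewrite ltr0n fact_gt0.
set z := x^-1 in z0 *; move=> H.
have {H}H : z ^+ k.+1 <= k.+1`!%:R * expR z.
  rewrite -ler_pdivrMl// mulrC; apply: le_trans H; by rewrite lerDr.
rewrite -exprVn -/z ler_pdivrMr ?expR_gt0// -[x]invrK -/z mulrAC.
by rewrite ler_pdivlMr// -exprSr.
Qed.

Lemma flat_recl k x : flat k x = x * flat k.+1 x.
Proof.
rewrite /flat; case: ifPn => [x0|_]; last by rewrite mulr0.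
by rewrite mulrA exprS invfM mulrA divff ?lt0r_neq0// mul1r.
Qed.

Lemma is_derive_exprn k x :
  is_derive x 1 (fun y : R => y ^+ k) (k%:R * x ^+ k.-1).
Proof.
by apply: DeriveDef; [exact: exprn_derivable|rewrite exp_derive [LHS]mulr1].
Qed.

(** At 0 the difference quotient of [flat k] is [flat k.+1], which tends to 0 by [flat_bound]; so
    the formula of the positive side holds on the whole line. *)
Lemma is_derive_flat k x :
  is_derive x 1 (flat k) (- k%:R * flat k.+1 x + flat k.+2 x).
Proof.
have [x0|x0|<-] := ltgtP 0 x.
- have E : \forall y \near x, (y ^+ k)^-1 * expR (- y^-1) = flat k y.
    near=> y; rewrite /flat ifT//; near: y.
    exact: lt_nbhsr.
  apply: (near_eq_is_derive E); rewrite /flat x0.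
  have H1 : is_derive x 1 (fun y : R => (y ^+ k)^-1) (- k%:R * x ^- k.+1).
    apply: is_derive_eq; first apply: (@is_deriveV _ (fun y => y ^+ k)).
      by rewrite expf_neq0// lt0r_neq0.
      exact: is_derive_exprn.
    rewrite /GRing.scale/= mulNr mulNr.
    case: k {E} => [|k]; first by rewrite !mul0r mulr0.
    congr (- _).
    have xk : x ^+ k != 0 by rewrite expf_neq0// lt0r_neq0.
    rewrite !exprS; field; rewrite xk lt0r_neq0//.
  have H2 : is_derive x 1 (fun y : R => expR (- y^-1)) (expR (- x^-1) * x ^- 2).
    apply: (@is_derive1_comp _ expR (fun y => - y^-1)).
    apply: is_derive_eq.
      apply: is_deriveN; apply: (@is_deriveV _ id); exact: lt0r_neq0.
    by rewrite [_%:A]mulr1 opprK.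
  apply: (is_derive_eqr (is_derive_mul H1 H2)).
  have xk : x ^+ k != 0 by rewrite expf_neq0// lt0r_neq0.
  by rewrite !exprS; field; rewrite xk lt0r_neq0.
- rewrite !flat_le0 ?ltW// mulr0 addr0.
  have E : \forall y \near x, cst 0 y = flat k y.
    near=> y; rewrite flat_le0// ltW//; near: y; exact: lt_nbhsl.
  exact: (near_eq_is_derive E).
rewrite !flat_le0// mulr0 addr0.
have H : (fun h : R => h^-1 *: (flat k (h *: 1 + 0) - flat k 0)) h @[h --> 0^'] --> (0 : R).
  apply/cvgr0Pnorm_le => eps eps0; near=> h.
  have h0 : h != 0 by near: h; exact: nbhs_dnbhs_neq.
  rewrite [h%:A]mulr1 addr0 (flat_le0 _ (lexx 0)) subr0 flat_recl.
  rewrite [_ *: _]mulrA mulVf// mul1r.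
  have /andP[f0 fb] := flat_bound k.+1 h.
  rewrite ger0_norm//; apply: (le_trans fb).
  rewrite -ler_pdivlMl ?ltr0n ?fact_gt0//; near: h.
  by apply: dnbhs0_le; rewrite mulr_gt0// invr_gt0 ltr0n fact_gt0.
by apply: DeriveDef; [apply/cvg_ex; exists 0|exact/cvg_lim].
Unshelve. all: by end_near. Qed.

Lemma Coo1_flat k : Coo1 setT (flat k).
Proof.
move=> j; elim: j k => [|j IH] k.
  by move=> x _; apply/derivable1_diffP; have [] := is_derive_flat k x.
have oT : open [set: R] := openT.
apply: (Ck1S oT (fun x _ => is_derive_flat k x)).
apply: CkD => //; apply: CkM => //; exact: Coo_cst.
Qed.

End flat.

(** * Smooth step and bump functions *)

Section smooth_step.
Context {R : realType}.
Implicit Types x : R.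

Definition step x : R := flat 0 x * (flat 0 x + flat 0 (1 - x))^-1.

Lemma step_den_gt0 x : 0 < flat 0 x + flat 0 (1 - x).
Proof.
have [x0|x0] := ltP 0 x; first by rewrite ltr_pwDl ?flat_gt0 ?flat_ge0.
by rewrite ltr_wpDl ?flat_ge0// flat_gt0// subr_gt0 (le_lt_trans x0).
Qed.

Lemma step_le0 x : x <= 0 -> step x = 0.
Proof. by move=> x0; rewrite /step flat_le0// mul0r. Qed.

Lemma step_ge1 x : 1 <= x -> step x = 1.
Proof.
move=> x1; have := step_den_gt0 x.
rewrite /step (@flat_le0 _ _ (1 - x)) ?subr_le0// addr0 => /lt0r_neq0 ?.
by rewrite divff.
Qed.

Lemma step_ge0 x : 0 <= step x.
Proof. by rewrite /step mulr_ge0 ?flat_ge0// invr_ge0 ltW// step_den_gt0. Qed.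

Lemma step_le1 x : step x <= 1.
Proof. by rewrite /step ler_pdivrMr ?step_den_gt0// mul1r lerDl flat_ge0. Qed.

Lemma Coo1_step : Coo1 setT step.
Proof.
have oT : open [set: R] := openT.
have Cden : Coo1 setT (fun x : R => flat 0 x + flat 0 (1 - x)).
  apply: CooD => //; first exact: Coo1_flat.
  apply: (@Coo_comp1 _ _ _ _ setT setT (flat 0) (fun x => 1 - x)) => //.
    exact: Coo1_flat.
  by apply: CooB => //; [exact: Coo_cst|exact: Coo1_id].
apply: CooM => //; first exact: Coo1_flat.
apply: (Coo_comp1 oT _ Coo1_inv Cden) => x _ /=.
by rewrite lt0r_neq0// step_den_gt0.
Qed.

(** By the quotient rule the sign is that of [flat 0 x * f' (1 - x) + flat 0 (1 - x) * f' x], where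
    [f'] is the nonnegative derivative of [flat 0]. The sign is what allows the energy of the
    angular cutoff to be bounded linearly in its derivative. *)
Lemma step_derive_ge0 x : 0 <= derive1 step x.
Proof.
set f' := fun x : R => - 0%:R * flat 1 x + flat 2 x.
have f'0 y : 0 <= f' y by rewrite /f' oppr0 mul0r add0r flat_ge0.
have d1 : is_derive x 1 (flat 0) (f' x) := is_derive_flat 0 x.
have d2 : is_derive x 1 (fun y => flat 0 (1 - y)) (- f' (1 - x)).
  apply: is_derive_eq; first apply: (@is_derive1_comp _ (flat 0) (fun y => 1 - y)).
    exact: is_derive_flat.
  by rewrite add0r !mulrN1.
have d3 := @is_deriveV _ (fun y => flat 0 y + flat 0 (1 - y)) x _ _
  (lt0r_neq0 (step_den_gt0 x)) (is_derive_add d1 d2).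
have d4 : is_derive x 1 step _ := is_derive_mul d1 d3.
rewrite derive1E derive_val /GRing.scale/=.
have := step_den_gt0 x; set d := _ + _ => d0.
have -> : flat 0 x * (- d ^- 2 * (f' x - f' (1 - x))) + f' x * d^-1 =
    d ^- 2 * (flat 0 x * f' (1 - x) + flat 0 (1 - x) * f' x).
  have dn := lt0r_neq0 d0.
  have -> : flat 0 (1 - x) = d - flat 0 x by rewrite /d addrAC subrr add0r.
  by field.
apply: mulr_ge0; first by rewrite invr_ge0 exprn_ge0// ltW.
by apply: addr_ge0; apply: mulr_ge0 => //; exact: flat_ge0.
Qed.

(** The derivative attains a maximum on [[0, 1]] and vanishes elsewhere, where [step] is locally
    constant. *)
Lemma step_derive_bound : exists2 C : R, 0 < C & forall x, derive1 step x <= C.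
Proof.
have cd : {within `[0, 1], continuous (derive1 step)}.
  apply: continuous_subspaceT => x.
  by apply: (Coo1_continuous (Coo1_derive Coo1_step)).
have [c _ Hc] := EVT_max ler01 cd.
exists (1 + derive1 step c); first by rewrite ltr_pwDl// step_derive_ge0.
move=> x; have [x0|x0] := ltP x 0.
  rewrite derive1E (near_eq_derive (g := cst (0 : R))).
    by rewrite derive_cst addr_ge0// step_derive_ge0.
  by near=> y; rewrite step_le0// ltW//; near: y; exact: lt_nbhsl.
have [x1|x1] := ltP 1 x.
  rewrite derive1E (near_eq_derive (g := cst (1 : R))).
    by rewrite derive_cst addr_ge0// step_derive_ge0.
  by near=> y; rewrite step_ge1// ltW//; near: y; exact: lt_nbhsr.
apply: (le_trans (Hc x _)); first by rewrite in_itv/= x0 x1.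
by rewrite lerDr.
Unshelve. all: by end_near. Qed.

Definition bump x : R := step x * step (3 - x).

Lemma Coo1_bump : Coo1 setT bump.
Proof.
have oT : open [set: R] := openT.
apply: CooM => //; first exact: Coo1_step.
apply: (@Coo_comp1 _ _ _ _ setT setT step (fun x => 3 - x)) => //.
  exact: Coo1_step.
by apply: CooB => //; [exact: Coo_cst|exact: Coo1_id].
Qed.

Lemma bump_neq0 x : bump x != 0 -> 0 < x < 3.
Proof.
apply: contraNT; rewrite negb_and -!leNgt => /orP[x0|x3].
  by rewrite /bump step_le0// mul0r.
by rewrite /bump (@step_le0 (3 - x)) ?subr_le0// mulr0.
Qed.

Lemma bump_eq1 x : 1 <= x <= 2 -> bump x = 1.
Proof. by move=> /andP[x1 x2]; rewrite /bump !step_ge1 ?mulr1//; lra. Qed.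

End smooth_step.

(** * Calculus on row vectors *)

Section row_vectors.
Context {R : realType}.

Definition coordrv n (j : 'I_n) (x : 'rV[R]_n) : R^o := x 0 j.

Lemma coordrv_is_linear n (j : 'I_n) : linear (coordrv j).
Proof. by move=> a x y; rewrite /coordrv !mxE. Qed.

HB.instance Definition _ n (j : 'I_n) :=
  GRing.isLinear.Build R 'rV[R]_n R^o *:%R (coordrv j) (coordrv_is_linear j).

Lemma coordrv_continuous n (j : 'I_n) : continuous (coordrv j).
Proof. exact: coord_continuous. Qed.

Lemma coordrvE n (x : 'rV[R]_n) : x = \sum_j coordrv j x *: delta_mx 0 j.
Proof. exact: row_sum_delta. Qed.

Definition erv n : 'I_n -> 'rV[R]_n := fun i => delta_mx 0 i.

Lemma smoothP n (u : 'rV[R]_n -> R) : smooth u <-> Coo (@erv n) setT u.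
Proof.
rewrite Coo_smoothP; split=> H s x; first by move=> _; exact: H.
by have := H s x I.
Qed.

Lemma Coo_coord n (U : set 'rV[R]_n) j : open U -> Coo (@erv n) U (coordrv j).
Proof.
move=> oU [|k].
  by move=> x _; exact: differentiable_coord.
split=> [x _|i]; first exact: differentiable_coord.
rewrite (_ : pd _ i _ = fun=> coordrv j (erv i)); first exact: Coo_cst.
apply/funext => x; rewrite /pd deriveE; last first.
  exact: differentiable_coord.
by rewrite (@diff_lin _ _ R^o (coordrv j) _ (@coordrv_continuous n j)).
Qed.

Lemma is_derive_curve n (u : 'rV[R]_n -> R) (g : R -> 'rV[R]_n)
    (g' : 'I_n -> R) (x : R) :
  (forall j, is_derive x 1 (fun y => g y 0 j) (g' j)) ->
  differentiable u (g x) ->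
  is_derive x 1 (u \o g) (\sum_j g' j * partial j u (g x)).
Proof.
move=> dg du.
have dgx : differentiable g x.
  apply: (differentiable_coords (c := @coordrv n) (@coordrvE n)) => j.
  by apply/derivable1_diffP; have [] := dg j.
apply: DeriveDef; first by apply/derivable1_diffP; exact: differentiable_comp.
have := @pd_comp _ _ _ _ _ e1 (@erv n) (@coordrv n) (@coordrv_continuous n) (@coordrvE n) u g tt x dgx du.
rewrite /pd => ->; apply: eq_bigr => j _; congr (_ * _).
by have := dg j => ?; rewrite derive_val.
Qed.

Lemma Coo_curve n (U : set 'rV[R]_n) (u : 'rV[R]_n -> R) (V : set R) (g : R -> 'rV[R]_n) :
  open V -> (forall x, V x -> U (g x)) -> Coo (@erv n) U u ->
  (forall j, Coo1 V (fun y => g y 0 j)) -> Coo1 V (u \o g).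
Proof.
move=> oV gU Cu Cg.
exact: (Coo_comp (@coordrv_continuous n) (@coordrvE n) oV gU Cu Cg).
Qed.

Lemma partial_eq0 n (U : set 'rV[R]_n) (u : 'rV[R]_n -> R) x i :
  open U -> {in U, u =1 fun=> 0} -> U x -> partial i u x = 0.
Proof.
move=> oU u0 Ux; have := near_pd (@erv n) i oU u0.
move=> /(_ x); rewrite inE => /(_ Ux); rewrite /pd /partial => ->.
exact: derive_cst.
Qed.

Lemma le_norm_coord n (x : 'rV[R]_n) j : `|x 0 j| <= `|x|.
Proof.
rewrite [leRHS]/Num.norm /= mx_normrE.
by apply/bigmax_geP; right => /=; exists (ord0, j).
Qed.

End row_vectors.

(** * Measurability of continuous functions of a tuple *)

Section measurability.
Context {R : realType} {n : nat}.
Local Notation mR := (measurableTypeR R).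

Lemma rv_of_tuple_inE (t : n.-tuple R) i : rv_of_tuple t 0 i = tnth t i.
Proof. by rewrite mxE. Qed.

Definition grid (k : nat) (c : {ffun 'I_n -> int}) : 'rV[R]_n :=
  \row_i ((c i)%:~R / k.+1%:R).

Definition cell (k : nat) (x : 'rV[R]_n) : {ffun 'I_n -> int} :=
  [ffun i => Num.floor (k.+1%:R * x 0 i)].

Lemma grid_cell_near k x : `|x - grid k (cell k x)| <= k.+1%:R^-1.
Proof.
rewrite [leLHS]/Num.norm /= mx_normrE; apply: bigmax_le; first by rewrite invr_ge0.
move=> [a i] _ /=; rewrite (ord1 a) !mxE ffunE.
have k0 : (0 : R) < k.+1%:R by rewrite ltr0n.
have /andP[f1 f2] := floor_itv (k.+1%:R * x 0 i).
set m := (Num.floor _)%:~R in f1 *.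
have -> : x 0 i - m / k.+1%:R = (k.+1%:R * x 0 i - m) / k.+1%:R.
  by field; rewrite lt0r_neq0.
rewrite normrM [X in _ * X]ger0_norm ?invr_ge0// ler_piMl ?invr_ge0//.
rewrite ger0_norm ?subr_ge0// lerBlDl ltW//.
by move: f2; rewrite intrD.
Qed.

Lemma measurable_cell k (c : {ffun 'I_n -> int}) :
  measurable [set t : n.-tuple mR | cell k (rv_of_tuple t) = c].
Proof.
have -> : [set t : n.-tuple mR | cell k (rv_of_tuple t) = c] =
    \bigcap_(i in [set: 'I_n]) ((fun t : n.-tuple mR => tnth t i) @^-1`
      `[(c i)%:~R / k.+1%:R, (c i + 1)%:~R / k.+1%:R[%classic).
  have k0 : (0 : R) < k.+1%:R by rewrite ltr0n.
  apply/seteqP; split=> t /=.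
    move=> <- i _ /=; rewrite ffunE rv_of_tuple_inE in_itv/=.
    have /andP[f1 f2] := floor_itv (k.+1%:R * tnth t i).
    by rewrite ler_pdivrMr// ltr_pdivlMr// ![tnth _ _ * _]mulrC f1 f2.
  move=> H; apply/ffunP => i; rewrite ffunE rv_of_tuple_inE.
  have := H i I; rewrite /= in_itv/= ler_pdivrMr// ltr_pdivlMr// ![tnth _ _ * _]mulrC.
  exact: floor_def.
apply: fin_bigcap_measurable => [|i _]; first exact: finite_finset.
by rewrite -[X in measurable X]setTI; exact: measurable_tnth.
Qed.

(* Pointwise limits of the functions constant on the cells of the grid of
   mesh [1/(k+1)] give all continuous functions. *)
Lemma measurable_rv (D : set (n.-tuple mR)) (f : 'rV[R]_n -> R) :
  (forall t, D t -> {for rv_of_tuple t, continuous f}) -> measurable D ->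
  measurable_fun D (fun t => f (rv_of_tuple t)).
Proof.
move=> cf mD.
apply: (measurable_fun_cvg (h := fun k t => f (grid k (cell k (rv_of_tuple t))))).
  move=> k; apply: measurable_funTS => _ B _; rewrite setTI.
  have -> : (fun t : n.-tuple mR => f (grid k (cell k (rv_of_tuple t)))) @^-1` B =
      \bigcup_(c in [set: {ffun 'I_n -> int}]) (if f (grid k c) \in B then
        [set t : n.-tuple mR | cell k (rv_of_tuple t) = c] else set0).
    apply/seteqP; split=> t /=.
      by move=> Bt; exists (cell k (rv_of_tuple t)) => //; rewrite mem_set.
    by move=> [c _]; case: ifPn => // /set_mem Bc /= cE; rewrite cE.
  apply: countable_bigcupT_measurable => [|c]; first exact: countableP.
  by case: ifPn => // _; exact: measurable_cell.
move=> t Dt; set x := rv_of_tuple t.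
have : (fun k => grid k (cell k x)) @ \oo --> x.
  apply/cvgrPdist_le => e e0; near=> k.
  apply: (le_trans (grid_cell_near k x)).
  apply: ltW; near: k; exact: (near_infty_natSinv_lt (PosNum e0)).
by move=> H; apply: continuous_cvg => //; exact: cf.
Unshelve. all: by end_near. Qed.

End measurability.

(** * Tonelli's theorem on tuples *)

Section tuple_integral.
Context {R : realType}.
Local Notation mR := (measurableTypeR R).
Local Open Scope ereal_scope.

Lemma integral_tuple0 (F : 0.-tuple mR -> \bar R) :
  (forall t, 0 <= F t) -> measurable_fun setT F ->
  \int[lebesgue_tuple R 0]_t F t = F [tuple].
Proof. by move=> F0 mF; rewrite /= integral_dirac// diracT mul1e. Qed.

Lemma measurable_funT_tcons n (F : n.+1.-tuple mR -> \bar R) :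
  measurable_fun setT F -> measurable_fun setT (F \o @tcons R n).
Proof. by move=> mF; apply: measurableT_comp => //; exact: measurable_tcons. Qed.

Lemma integral_tupleS n (F : n.+1.-tuple mR -> \bar R) :
  (forall t, 0 <= F t) -> measurable_fun setT F ->
  \int[lebesgue_tuple R n.+1]_t F t =
  \int[lebesgue_measure]_x \int[lebesgue_tuple R n]_t F (tcons (x, t)).
Proof.
move=> F0 mF.
rewrite [LHS](@ge0_integral_pushforward _ _ _ _ _ _ (@measurable_tcons R n))//.
rewrite preimage_setT fubini_tonelli1//; last by move=> x /=.
exact: measurable_funT_tcons.
Qed.

Lemma measurable_integral_tuple n (F : n.+1.-tuple mR -> \bar R) :
  (forall t, 0 <= F t) -> measurable_fun setT F ->
  measurable_fun setT (fun x => \int[lebesgue_tuple R n]_t F (tcons (x, t))).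
Proof.
move=> F0 mF.
apply: (@measurable_fun_fubini_tonelli_F _ _ _ _ _ _ (F \o @tcons R n)).
  exact: measurable_funT_tcons.
by move=> z /=.
Qed.

Lemma tcat2_subproof n (x : n.-tuple R) (s t : R) :
  size (x ++ [:: s; t]) == n.+2.
Proof. by rewrite size_cat size_tuple addn2. Qed.

Definition tcat2 n (x : n.-tuple mR) (s t : R) : n.+2.-tuple mR :=
  Tuple (tcat2_subproof x s t).

Lemma tcat2_tcons n y (x : n.-tuple mR) (s t : R) :
  tcat2 (tcons (y, x)) s t = tcons (y, tcat2 x s t).
Proof. exact: val_inj. Qed.

Lemma measurable_tcons_r n y : measurable_fun setT (fun t : n.-tuple mR => tcons (y, t)).
Proof.
by apply: measurableT_comp; [exact: measurable_tcons|exact: measurable_pair1].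
Qed.

Lemma measurable_funT_tcons_r n y (F : n.+1.-tuple mR -> \bar R) :
  measurable_fun setT F -> measurable_fun setT (fun t => F (tcons (y, t))).
Proof. by move=> mF; exact: (measurableT_comp mF (measurable_tcons_r y)). Qed.

Lemma integral_tuple2 (F : 2.-tuple mR -> \bar R) :
  (forall t, 0 <= F t) -> measurable_fun setT F ->
  \int[lebesgue_tuple R 2]_t F t =
  \int[lebesgue_measure]_s \int[lebesgue_measure]_t F (tcat2 [tuple] s t).
Proof.
move=> F0 mF; rewrite integral_tupleS//; apply: eq_integral => s _.
have mF1 := measurable_funT_tcons_r s mF.
rewrite integral_tupleS//; apply: eq_integral => t _.
rewrite integral_tuple0//; first by congr F; exact: val_inj.
exact: (measurable_funT_tcons_r t mF1).
Qed.

(* Tonelli, one variable at a time: only the last two variables matter. *)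
Lemma le_integral_tuple n (F G : n.+2.-tuple mR -> \bar R) :
  (forall t, 0 <= F t) -> measurable_fun setT F ->
  (forall t, 0 <= G t) -> measurable_fun setT G ->
  (forall x : n.-tuple mR,
    \int[lebesgue_measure]_s \int[lebesgue_measure]_t F (tcat2 x s t) <=
    \int[lebesgue_measure]_s \int[lebesgue_measure]_t G (tcat2 x s t)) ->
  \int[lebesgue_tuple R n.+2]_t F t <= \int[lebesgue_tuple R n.+2]_t G t.
Proof.
elim: n F G => [|n IH] F G F0 mF G0 mG FG.
  by rewrite !integral_tuple2//; exact: FG.
rewrite [leLHS]integral_tupleS// [leRHS]integral_tupleS//.
apply: ge0_le_integral => //.
- by move=> y _; exact: integral_ge0.
- exact: measurable_integral_tuple.
- exact: measurable_integral_tuple.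
move=> y _; apply: IH => //.
- exact: (measurable_funT_tcons_r y mF).
- exact: (measurable_funT_tcons_r y mG).
move=> x; have := FG (tcons (y, x)).
by under eq_integral do under eq_integral do rewrite tcat2_tcons;
   under [leRHS]eq_integral do under eq_integral do rewrite tcat2_tcons.
Qed.

Lemma eq_integral_tuple n (F G : n.+2.-tuple mR -> \bar R) :
  (forall t, 0 <= F t) -> measurable_fun setT F ->
  (forall t, 0 <= G t) -> measurable_fun setT G ->
  (forall x : n.-tuple mR,
    \int[lebesgue_measure]_s \int[lebesgue_measure]_t F (tcat2 x s t) =
    \int[lebesgue_measure]_s \int[lebesgue_measure]_t G (tcat2 x s t)) ->
  \int[lebesgue_tuple R n.+2]_t F t = \int[lebesgue_tuple R n.+2]_t G t.
Proof.
move=> F0 mF G0 mG FG; apply/eqP; rewrite eq_le.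
by apply/andP; split; apply: le_integral_tuple => // x; rewrite FG.
Qed.

Lemma measurable_nth n i : (i < n)%N ->
  measurable_fun setT (fun t : n.-tuple mR => nth (0 : R)%R t i).
Proof.
move=> ni; rewrite (_ : (fun=> _) = fun t => tnth t (Ordinal ni)).
  exact: measurable_tnth.
by apply/funext => t; rewrite (tnth_nth 0%R).
Qed.

Lemma measurable_tensor n (g : nat -> R -> R) (H : mR * mR -> \bar R) :
  (forall i, measurable_fun setT (g i)) -> measurable_fun setT H ->
  measurable_fun setT (fun t : n.+2.-tuple mR =>
    (\prod_(i < n) g i (nth 0%R t i))%:E * H (nth 0%R t n, nth 0%R t n.+1)).
Proof.
move=> mg mH; apply: emeasurable_funM.
  apply/measurable_EFinP; apply: measurable_prod => i _.
  apply: measurableT_comp; first exact: mg.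
  by apply: measurable_nth; rewrite ltnS ltnW// ltnS ltnW.
apply: measurableT_comp => //.
by apply/measurable_fun_pairP; split; apply: measurable_nth.
Qed.

(** Integrating out the first coordinate pulls out its factor; the induction shifts the family [g]
    by one. *)
Lemma integral_tensor n (g : nat -> R -> R) (G : nat -> R) (H : mR * mR -> \bar R) :
  (forall i, measurable_fun setT (g i)) -> (forall i x, 0 <= g i x)%R ->
  (forall i, \int[lebesgue_measure]_x (g i x)%:E = (G i)%:E) ->
  measurable_fun setT H -> (forall z, 0 <= H z) ->
  \int[lebesgue_tuple R n.+2]_t
    ((\prod_(i < n) g i (nth 0%R t i))%:E * H (nth 0%R t n, nth 0%R t n.+1)) =
  (\prod_(i < n) G i)%:E *
    \int[lebesgue_measure]_s \int[lebesgue_measure]_t H (s, t).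
Proof.
move=> mg g0 gG mH H0.
elim: n g G mg g0 gG => [|n IH] g G mg g0 gG.
  rewrite big_ord0 mul1e integral_tuple2//.
  - apply: eq_integral => s _; apply: eq_integral => t _.
    by rewrite big_ord0 mul1e.
  - by move=> t; rewrite big_ord0 mul1e.
  - exact: measurable_tensor.
rewrite integral_tupleS//; last 2 first.
- by move=> t; rewrite mule_ge0// lee_fin prodr_ge0.
- exact: measurable_tensor.
have Gge0 i : (0 <= G i)%R.
  by rewrite -lee_fin -gG; apply: integral_ge0 => x _; rewrite lee_fin.
have mT := @measurable_tensor n (fun i => g i.+1) H (fun i => mg i.+1) mH.
have II0 : 0 <= \int[lebesgue_measure]_s \int[lebesgue_measure]_t H (s, t).
  by apply: integral_ge0 => s _; exact: integral_ge0.
transitivity (\int[lebesgue_measure]_x ((g 0 x)%:E * ((\prod_(i < n) G i.+1)%:E *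
    \int[lebesgue_measure]_s \int[lebesgue_measure]_t H (s, t)))).
  apply: eq_integral => x _; rewrite -(IH (fun i => g i.+1) (fun i => G i.+1))//.
  rewrite -ge0_integralZl//; last 2 first.
  - by move=> t _; rewrite mule_ge0// lee_fin prodr_ge0.
  - by rewrite lee_fin.
  by apply: eq_integral => t _; rewrite big_ord_recl/= EFinM -muleA.
rewrite ge0_integralZr//; last 3 first.
- by apply/measurable_EFinP; exact: mg.
- by move=> x _; rewrite lee_fin.
- by rewrite mule_ge0// lee_fin prodr_ge0.
by rewrite gG muleA -EFinM big_ord_recl.
Qed.

End tuple_integral.

(** * Change of variable on possibly unbounded intervals *)

Section substitution.
Context {R : realType}.
Notation mu := (@lebesgue_measure R).

(** The substitution rule on the segments [[a n, b n]] passes to the limit by monotone convergence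
    on both sides. No limit of [F] at the ends of [A] is needed, only the two exhaustions. *)
Lemma ge0_substitution (A B : set R) (F f G : R -> R) (a b : nat -> R) :
  open A -> (forall n, a n <= b n) ->
  (forall n m, (n <= m)%N -> a m <= a n /\ b n <= b m) ->
  A = \bigcup_n `[a n, b n]%classic ->
  B = \bigcup_n `[F (a n), F (b n)]%classic ->
  (forall x y, A x -> A y -> x < y -> F x < F y) ->
  (forall x, A x -> is_derive x 1 F (f x)) ->
  (forall x, A x -> {for x, continuous f}) -> (forall x, A x -> 0 <= f x) ->
  (forall y, B y -> {for y, continuous G}) -> (forall y, B y -> 0 <= G y) ->
  (\int[mu]_(y in B) (G y)%:E = \int[mu]_(x in A) (G (F x) * f x)%:E)%E.
Proof.
move=> oA ab nd AE BE homoF dF cf f0 cG G0.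
have abA n : `[a n, b n]%classic `<=` A by rewrite AE => x xI; exists n.
have aA n : A (a n) by apply: (abA n); rewrite /= in_itv/= lexx ab.
have bA n : A (b n) by apply: (abA n); rewrite /= in_itv/= lexx ab.
have leF x y : A x -> A y -> x <= y -> F x <= F y.
  by move=> Ax Ay; rewrite le_eqVlt => /predU1P[->//|xy]; exact/ltW/homoF.
have FabB n : `[F (a n), F (b n)]%classic `<=` B by rewrite BE => x xI; exists n.
have cF x : A x -> {for x, continuous F}.
  move=> Ax; have /derivable1_diffP : derivable F x 1 by have [] := dF x Ax.
  exact: differentiable_continuous.
have FB x : A x -> B (F x).
  move=> Ax; have := Ax; rewrite {1}AE => -[n _]; rewrite /= in_itv/= => /andP[ax xb].
  by apply: (FabB n); rewrite /= in_itv/= !leF.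
have dFE x : A x -> derive1 F x = f x.
  by move=> Ax; rewrite derive1E; have ? := dF x Ax; rewrite derive_val.
have near_f x : A x -> \forall y \near x, f y = derive1 F y.
  move=> Ax; have : \forall y \near x, A y by exact: open_nbhs_nbhs.
  by apply: filterS => y Ay; rewrite dFE.
have cdF x : A x -> derive1 F y @[y --> x] --> f x.
  move=> Ax; have := cf x Ax; rewrite /prop_for /continuous_at => h.
  by apply: cvg_trans h; apply: near_eq_cvg; exact: near_f.
have step n : (\int[mu]_(y in `[F (a n), F (b n)]) (G y)%:E =
    \int[mu]_(x in `[a n, b n]) (G (F x) * f x)%:E)%E.
  rewrite integration_by_substitution_increasing//.
  - apply: eq_integral => x; rewrite inE => /abA Ax.
    by rewrite /= -[X in _ = (_ * X)%:E]dFE.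
  - move=> x y xab yab; apply: homoF; exact: (abA n).
  - move=> x xab; have Ax : A x by apply: (abA n); apply: subset_itv_oo_cc.
    by rewrite /continuous_at dFE//; exact: cdF.
  - by apply/cvg_ex; exists (f (a n)); apply: cvg_at_right_filter; exact: cdF.
  - by apply/cvg_ex; exists (f (b n)); apply: cvg_at_left_filter; exact: cdF.
  - split.
    + move=> x xab; have Ax : A x by apply: (abA n); apply: subset_itv_oo_cc.
      by have [] := dF x Ax.
    + by apply: cvg_at_right_filter; exact: cF.
    + by apply: cvg_at_left_filter; exact: cF.
  - by apply: continuous_in_subspaceT => y /set_mem /FabB; exact: cG.
have l1 : (\int[mu]_(y in `[F (a n), F (b n)]) (G y)%:E @[n --> \oo] -->
    \int[mu]_(y in B) (G y)%:E)%E.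
  rewrite BE; apply: (@ge0_nondecreasing_set_cvg_integral _ (measurableTypeR R) R
    (fun n => `[F (a n), F (b n)]%classic) (fun y => (G y)%:E) mu) => //.
  - move=> n m nm; apply/subsetPset; apply: subset_itvScc.
      by rewrite bnd_simp; apply: leF => //; have [] := nd _ _ nm.
    by rewrite bnd_simp; apply: leF => //; have [] := nd _ _ nm.
  - move=> n; apply/measurable_EFinP; apply: subspace_continuous_measurable_fun => //.
    by apply: continuous_in_subspaceT => y /set_mem /FabB; exact: cG.
  - by move=> n y /FabB ?; rewrite lee_fin G0.
have l2 : (\int[mu]_(x in `[a n, b n]) (G (F x) * f x)%:E @[n --> \oo] -->
    \int[mu]_(x in A) (G (F x) * f x)%:E)%E.
  rewrite AE; apply: (@ge0_nondecreasing_set_cvg_integral _ (measurableTypeR R) R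
    (fun n => `[a n, b n]%classic) (fun x => (G (F x) * f x)%:E) mu) => //.
  - move=> n m nm; apply/subsetPset; apply: subset_itvScc; rewrite bnd_simp.
      by have [] := nd _ _ nm.
    by have [] := nd _ _ nm.
  - move=> n; apply/measurable_EFinP; apply: subspace_continuous_measurable_fun => //.
    apply: continuous_in_subspaceT => x /set_mem /abA Ax.
    apply: cvgM; last exact: cf.
    by apply: (@continuous_comp _ _ _ F G x); [exact: cF|exact/cG/FB].
  - by move=> n y /abA ?; rewrite lee_fin mulr_ge0 ?f0// G0//; exact: FB.
have E := funext step; rewrite E in l1.
exact: (cvg_unique _ l1 l2).
Qed.

Lemma ge0_scale_setT (k : R) (G : R -> R) : 0 < k -> continuous G ->
  (forall y, 0 <= G y) ->
  (\int[mu]_y (G y)%:E = \int[mu]_x (G (x * k) * k)%:E)%E.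
Proof.
move=> k0 cG G0.
apply: (@ge0_substitution setT setT (fun x => x * k) (fun=> k) G
  (fun n => - n%:R) (fun n => n%:R)) => //.
- exact: openT.
- by move=> n; rewrite ge0_cp.
- by move=> n m nm; rewrite lerN2 ler_nat.
- apply/esym; rewrite -subTset => x _; exists (Num.truncn `|x|).+1 => //.
  rewrite /= in_itv/= -ler_norml; apply/ltW; exact: truncnS_gt.
- apply/esym; rewrite -subTset => x _; exists (Num.truncn (`|x| / k)).+1 => //.
  rewrite /= in_itv/= mulNr -ler_norml -ler_pdivrMr//; apply/ltW; exact: truncnS_gt.
- by move=> x y _ _; rewrite ltr_pM2r.
- move=> x _; apply: (is_derive_eqr (is_derive_mul (is_derive_id x 1) (is_derive_cst k x 1))).
  by rewrite mulr0 add0r mul1r.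
- by move=> x _; exact: cst_continuous.
- by move=> x _; exact: ltW.
- by move=> x _; exact: cG.
Qed.

Lemma ge0_scale_pos (k : R) (G : R -> R) : 0 < k ->
  (forall y, 0 < y -> {for y, continuous G}) -> (forall y, 0 < y -> 0 <= G y) ->
  (\int[mu]_(y in `]0%R, +oo[) (G y)%:E =
   \int[mu]_(x in `]0%R, +oo[) (G (x * k) * k)%:E)%E.
Proof.
move=> k0 cG G0.
have I x : (`]0, +oo[%classic : set R) x <-> 0 < x by rewrite /= in_itv/= andbT.
have cover (h : R) : 0 < h -> `]0, +oo[%classic =
    \bigcup_n `[n.+1%:R^-1 * h, n.+1%:R * h]%classic.
  move=> h0; apply/seteqP; split=> x /=.
    rewrite in_itv/= andbT => x0.
    exists (Num.truncn (x / h + h / x)) => //; rewrite /= in_itv/=.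
    set n := Num.truncn _.
    have nP : x / h + h / x < n.+1%:R by exact: truncnS_gt.
    have n0 : (0 : R) < n.+1%:R by rewrite ltr0n.
    apply/andP; split.
      rewrite ler_pdivrMl// -ler_pdivrMr//; apply: ltW; apply: le_lt_trans nP.
      by rewrite lerDr divr_ge0// ltW.
    rewrite -ler_pdivrMr//; apply: ltW; apply: le_lt_trans nP.
    by rewrite lerDl divr_ge0// ltW.
  move=> [n _]; rewrite /= !in_itv/= andbT => /andP[+ _].
  by apply: lt_le_trans; rewrite mulr_gt0// invr_gt0 ltr0n.
apply: (@ge0_substitution `]0, +oo[%classic `]0, +oo[%classic (fun x => x * k) (fun=> k) G
  (fun n => n.+1%:R^-1 * 1) (fun n => n.+1%:R * 1)) => //.
- move=> n; rewrite !mulr1; apply: (@le_trans _ _ 1); last by rewrite ler1n.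
  by rewrite invf_le1 ?ltr0n// ler1n.
- move=> n m nm; rewrite !mulr1 ler_nat ltnS nm; split=> //.
  by rewrite lef_pV2 ?posrE ?ltr0n// ler_nat.
- exact: cover.
- by rewrite (cover k k0); apply: eq_bigcupr => n _; rewrite !mulr1.
- by move=> x y _ _; rewrite ltr_pM2r.
- move=> x _; apply: (is_derive_eqr (is_derive_mul (is_derive_id x 1) (is_derive_cst k x 1))).
  by rewrite mulr0 add0r mul1r.
- by move=> x _; exact: cst_continuous.
- by move=> x _; exact: ltW.
- by move=> x /I; exact: cG.
- by move=> x /I; exact: G0.
Qed.

(** [tan (x - pi / 2)] is [- cot x], whose derivative is [1 / sin^2]. The interval is exhausted by
    the preimages of [[- n, n]]. *)
Lemma ge0_substitution_cot (G : R -> R) : continuous G -> (forall y, 0 <= G y) ->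
  (\int[mu]_y (G y)%:E =
   \int[mu]_(x in `]0%R, pi[) (G (tan (x - pi / 2)) * (sin x) ^- 2)%:E)%E.
Proof.
move=> cG G0.
have sin0 x : (`]0, pi[%classic : set R) x -> 0 < sin x.
  by rewrite /= in_itv/= => /sin_gt0_pi.
have cosE x : cos (x - pi / 2) = sin x :> R by rewrite cosBpihalf.
apply: (@ge0_substitution `]0, pi[%classic setT (fun x => tan (x - pi / 2))
  (fun x => (sin x) ^- 2) G
  (fun n => pi / 2 + atan (- n%:R)) (fun n => pi / 2 + atan n%:R)) => //.
- by move=> n; rewrite lerD2l le_atan// ge0_cp.
- by move=> n m nm; rewrite !lerD2l !le_atan ?lerN2 ?ler_nat.
- apply/seteqP; split=> x /=.
    rewrite in_itv/= => /andP[x0 xpi].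
    have xI : x - pi / 2 \in `](- (pi / 2)), (pi / 2)[.
      by rewrite in_itv/= ltrBrDl subrr x0 ltrBlDr -splitr.
    exists (Num.truncn `|tan (x - pi / 2)|).+1 => //=; rewrite in_itv/=.
    have /ltW := truncnS_gt `|tan (x - pi / 2)|.
    rewrite ler_norml => /andP[h1 h2].
    have := le_atan h1; have := le_atan h2; rewrite tanK// => h3 h4.
    by rewrite -lerBrDl h4 -lerBlDl h3.
  move=> [n _]; rewrite /= !in_itv/= => /andP[h1 h2].
  rewrite (lt_le_trans _ h1) ?(le_lt_trans h2)//.
    by rewrite [ltRHS]splitr ltrD2l atan_ltpi2.
  by rewrite -ltrBlDl sub0r atan_gtNpi2.
- apply/esym; rewrite -subTset => y _.
  exists (Num.truncn `|y|).+1 => //=; rewrite in_itv/=.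
  rewrite ![pi / 2 + _]addrC !addrK !atanK -ler_norml; apply/ltW; exact: truncnS_gt.
- move=> x y xI yI xy.
  have P z : (`]0, pi[%classic : set R) z -> z - pi / 2 \in `](- (pi / 2)), (pi / 2)[.
    by rewrite /= !in_itv/= => /andP[z0 zpi]; rewrite ltrBrDl subrr z0 ltrBlDr -splitr.
  by rewrite ltr_tan ?ltrD2r//; exact: P.
- move=> x /sin0 sx; apply: is_derive_eqr.
    apply: (@is_derive1_comp _ tan (fun x => x - pi / 2)).
    by apply: is_derive_tan; rewrite cosE lt0r_neq0.
  by rewrite /= subr0 cosE mulr1.
- move=> x /sin0 sx; apply: cvgV; first by rewrite expf_neq0// lt0r_neq0.
  apply: (@continuous_comp _ _ _ sin (fun y => y ^+ 2)).
    exact: continuous_sin.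
  exact: exprn_continuous.
- by move=> x _; rewrite invr_ge0 sqr_ge0.
- by move=> x _; exact: cG.
Qed.

End substitution.

(** * Polar coordinates in the upper half-plane *)

Section polar_coordinates.
Context {R : realType}.
Notation mu := (@lebesgue_measure R).
Local Notation mR := (measurableTypeR R).

Lemma integral_posE (h : R -> \bar R) : (forall t, t <= 0 -> h t = 0%E) ->
  (\int[mu]_t h t = \int[mu]_(t in `]0%R, +oo[) h t)%E.
Proof.
move=> h0; rewrite [RHS]integral_mkcond; apply: eq_integral => t _.
rewrite patchE; case: ifPn => // /negP tN; apply: h0.
by rewrite leNgt; apply/negP => t0; apply: tN; rewrite inE/= in_itv/= t0.
Qed.

Lemma tonelli_swap (F : R -> R -> R) :
  measurable_fun setT (fun z : mR * mR => F z.1 z.2) ->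
  (forall x y, 0 <= F x y) ->
  (\int[mu]_x \int[mu]_y (F x y)%:E = \int[mu]_y \int[mu]_x (F x y)%:E)%E.
Proof.
move=> mF F0.
apply: (@fubini_tonelli _ _ mR mR R lebesgue_measure lebesgue_measure
  (fun z => (F z.1 z.2)%:E)).
- exact/measurable_EFinP.
- by move=> z; rewrite lee_fin.
Qed.

Lemma continuous_at_pair (T : topologicalType) (f g : T -> R) (x : T) :
  {for x, continuous f} -> {for x, continuous g} ->
  {for x, continuous (fun y => (f y, g y))}.
Proof.
by move=> cf cg; exact: (@cvg_pair _ _ _ (nbhs x) (nbhs (f x)) (nbhs (g x))).
Qed.

(* Angles are measured from the negative half-axis, which makes
   [x / y = tan (phi - pi / 2)] an increasing function of [phi]. *)
Lemma polar (F : R -> R -> R) :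
  measurable_fun setT (fun z : mR * mR => F z.1 z.2) ->
  (forall x y, 0 <= F x y) -> (forall x y, y <= 0 -> F x y = 0) ->
  (forall x y, 0 < y -> {for (x, y), continuous (fun z : R * R => F z.1 z.2)}) ->
  (\int[mu]_x \int[mu]_y (F x y)%:E =
   \int[mu]_(r in `]0%R, +oo[) \int[mu]_(phi in `]0%R, pi[)
     (r * F (- (r * cos phi)) (r * sin phi))%:E)%E.
Proof.
move=> mF F0 Fz cF.
(* The change of variables is done through three one-variable substitutions separated by uses of
   Tonelli. The first replaces [s] by [c * t] at fixed height [t]. *)
pose H c t := F (c * t) t * t.
have H0 c t : 0 <= H c t.
  have [t0|t0] := leP t 0; first by rewrite /H Fz// mul0r.
  by rewrite /H mulr_ge0// ltW.
have mH : measurable_fun setT (fun z : mR * mR => H z.1 z.2).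
  apply: measurable_funM; last exact: measurable_snd.
  apply: (measurableT_comp mF (g := fun z : mR * mR => (z.1 * z.2, z.2))).
  apply/measurable_fun_pairP; split; last exact: measurable_snd.
  by apply: measurable_funM; [exact: measurable_fst|exact: measurable_snd].
(* Second substitution, at fixed slope [c]: [t = r * sigma c]. When [c = tan (phi - pi / 2)],
   [sigma c] is [sin phi]. *)
pose sigma (c : R) : R := cos (atan c).
have sigma0 c : 0 < sigma c.
  by apply: cos_gt0_pihalf; rewrite atan_gtNpi2 atan_ltpi2.
have csigma : continuous sigma.
  by move=> c; apply: continuous_comp; [exact: continuous_atan|exact: continuous_cos].
pose K c r := H c (r * sigma c) * sigma c.
have K0 c r : 0 <= K c r by rewrite /K mulr_ge0// ltW.
have mK : measurable_fun setT (fun z : mR * mR => K z.1 z.2).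
  have ms : measurable_fun setT (fun z : mR * mR => sigma z.1).
    apply: measurableT_comp; last exact: measurable_fst.
    exact: continuous_measurable_fun.
  apply: measurable_funM => //.
  apply: (measurableT_comp mH (g := fun z : mR * mR => (z.1, z.2 * sigma z.1))).
  apply/measurable_fun_pairP; split; first exact: measurable_fst.
  by apply: measurable_funM => //; exact: measurable_snd.
have cK (r : R) : 0 < r -> continuous (fun c : R => K c r).
  move=> r0 c.
  have cr : {for c, continuous (fun c : R => r * sigma c)}.
    by apply: cvgM; [exact: cvg_cst|exact: csigma].
  have cc : {for c, continuous (fun c : R => c * (r * sigma c))}.
    by apply: cvgM; [exact: cvg_id|].
  have rs : 0 < r * sigma c by rewrite mulr_gt0.
  have cF1 : {for c, continuous (fun c : R => F (c * (r * sigma c)) (r * sigma c))}.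
    exact: (continuous_comp (continuous_at_pair cc cr) (cF _ _ rs)).
  exact: (cvgM (cvgM cF1 cr) (csigma c)).
rewrite (tonelli_swap mF F0).
transitivity (\int[mu]_t \int[mu]_c (H c t)%:E)%E.
  apply: eq_integral => t _; have [t0|t0] := leP t 0.
    by rewrite !integral0_eq// => x _; rewrite /H Fz// mul0r.
  apply: (@ge0_scale_setT _ t (fun s => F s t)) => // s.
  apply: (@continuous_comp _ _ _ (fun s => (s, t)) (fun z => F z.1 z.2)).
    by apply: continuous_at_pair; [exact: cvg_id|exact: cvg_cst].
  by have := cF s t t0.
rewrite -(tonelli_swap mH H0).
transitivity (\int[mu]_c \int[mu]_r (K c r)%:E)%E.
  apply: eq_integral => c _.
  rewrite integral_posE; last by move=> t t0; rewrite /H Fz// mul0r.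
  rewrite [RHS]integral_posE; last first.
    by move=> r r0; rewrite /K /H Fz ?mul0r// pmulr_lle0.
  apply: (@ge0_scale_pos _ (sigma c) (H c)) => // t t0.
  apply: cvgM; last exact: cvg_id.
  apply: (@continuous_comp _ _ _ (fun t => (c * t, t)) (fun z => F z.1 z.2)).
    apply: (@continuous_at_pair _ (fun t => c * t)); last exact: cvg_id.
    by apply: cvgM; [exact: cvg_cst|exact: cvg_id].
  by have := cF (c * t) t t0.
rewrite (tonelli_swap mK K0).
rewrite integral_posE; last first.
  move=> r r0; rewrite integral0_eq// => c _.
  by rewrite /K /H Fz ?mul0r// pmulr_lle0.
apply: eq_integral => r; rewrite inE/= in_itv/= andbT => r0.
(* Third substitution, at fixed [r]: the slope becomes [tan (phi - pi / 2)]. Its Jacobian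
   [1 / sin^2] cancels the two factors [sigma] and leaves the polar factor [r]. *)
rewrite (@ge0_substitution_cot _ (fun c => K c r))//; last first.
  exact: cK.
apply: eq_integral => x; rewrite inE/= in_itv/= => /andP[x0 xpi]; congr EFin.
have xI : x - pi / 2 \in `](- (pi / 2)), (pi / 2)[.
  by rewrite in_itv/= ltrBrDl subrr x0 ltrBlDr -splitr.
have sx : sin x != 0 by rewrite lt0r_neq0// sin_gt0_pi// x0.
rewrite /K /H /sigma tanK// cosBpihalf /tan cosBpihalf sinBpihalf.
have -> : - cos x / sin x * (r * sin x) = - (r * cos x) by field.
by field.
Qed.

End polar_coordinates.

(** * Polynomials given by their lists of coefficients *)

Section horner_lists.
Context {R : realType}.
Implicit Types (l : seq R) (x : R).

(** Horner evaluation. The first two derivatives follow the same recursion by the product rule, so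
    that on a concrete list they unfold to expressions which [ring] handles. *)
Fixpoint hev l x : R := if l is a :: l' then a + x * hev l' x else 0.
Fixpoint dhev l x : R := if l is a :: l' then hev l' x + x * dhev l' x else 0.
Fixpoint ddhev l x : R :=
  if l is a :: l' then 2 * dhev l' x + x * ddhev l' x else 0.

Lemma is_derive_hev l x : is_derive x 1 (hev l) (dhev l x).
Proof.
elim: l => [|a l IH] /=; first exact: is_derive_cst.
apply: (is_derive_eqr (is_derive_add (is_derive_cst a x 1)
  (is_derive_mul (is_derive_id x 1) IH))).
by rewrite add0r mul1r addrC.
Qed.

Lemma is_derive_dhev l x : is_derive x 1 (dhev l) (ddhev l x).
Proof.
elim: l => [|a l IH] /=; first exact: is_derive_cst.
apply: (is_derive_eqr (is_derive_add (is_derive_hev l x)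
  (is_derive_mul (is_derive_id x 1) IH))).
by rewrite /=; ring.
Qed.

Lemma Coo1_hev l : Coo1 setT (hev l).
Proof.
have oT : open [set: R] := openT.
elim: l => [|a l IH]; first exact: Coo_cst.
by apply: CooD => //; [exact: Coo_cst|apply: CooM => //; exact: Coo1_id].
Qed.

Lemma Coo1_dhev l : Coo1 setT (dhev l).
Proof.
have -> : dhev l = derive1 (hev l); last exact/Coo1_derive/Coo1_hev.
by apply/funext => x; have ? := is_derive_hev l x; rewrite derive1E derive_val.
Qed.

End horner_lists.

(** * A polynomial supersolution for the angular problem *)

Section supersolution.
Context {R : realType}.
Implicit Types x : R.

(* [sub_p (sin phi)] is [10 ^ 6] times an approximation of the positive
   minimizer, obtained by collocation at Chebyshev nodes. *)
Definition sub_coefs : seq R :=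
  [:: (1000 * 1000); - (156 * 1000 + 413); (68 * 1000 + 616); - (40 * 1000 + 293); (27 * 1000 + 167); - (19 * 1000 + 731); (14 * 1000 + 648); - (10 * 1000 + 323); (6 * 1000 + 234);
      - (2 * 1000 + 850); 840; -117].
Definition sub_p : R -> R := hev sub_coefs.
Definition sub_dp : R -> R := dhev sub_coefs.
Definition sub_ddp : R -> R := ddhev sub_coefs.

(** Consecutive terms are paired as [x ^+ (2 k) * (a - b * x)] with [0 <= b <= a]: each pair is
    nonnegative on [[-1, 1]], and the lowest one is positive. *)
Lemma sub_p_gt0 x : -1 <= x <= 1 -> 0 < sub_p x.
Proof.
move=> /andP[x0 x1].
have -> : sub_p x = ((1000 * 1000) - (156 * 1000 + 413) * x) + x ^+ 2 * ((68 * 1000 + 616) - (40 * 1000 + 293) * x)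
   + x ^+ 4 * ((27 * 1000 + 167) - (19 * 1000 + 731) * x) + x ^+ 6 * ((14 * 1000 + 648) - (10 * 1000 + 323) * x)
   + x ^+ 8 * ((6 * 1000 + 234) - (2 * 1000 + 850) * x) + x ^+ 10 * (840 - 117 * x).
  by unfold sub_p, sub_coefs, hev; ring.
have E k (a b : R) : 0 <= b -> b <= a -> 0 <= x ^+ k.*2 * (a - b * x).
  move=> b0 ba; rewrite mulr_ge0 ?exprn_even_ge0 ?odd_double// subr_ge0.
  by apply: le_trans ba; rewrite ler_piMr.
apply: ltr_wpDr; first by apply: (E 5%N); lra.
apply: ltr_wpDr; first by apply: (E 4%N); lra.
apply: ltr_wpDr; first by apply: (E 3%N); lra.
apply: ltr_wpDr; first by apply: (E 2%N); lra.
apply: ltr_wpDr; first by apply: (E 1%N); lra.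
lra.
Qed.

(* The right-hand side is a Bernstein expansion with positive coefficients. *)
Lemma sub_residual_ge0 x : 0 <= x <= 1 ->
  0 <= (x / 4 - 391 / 2500) * sub_p x - (1 - 2 * x ^+ 2) * sub_dp x
       - x * (1 - x ^+ 2) * sub_ddp x.
Proof.
move=> /andP[x0 x1].
have -> : (x / 4 - 391 / 2500) * sub_p x - (1 - 2 * x ^+ 2) * sub_dp x
       - x * (1 - x ^+ 2) * sub_ddp x = 2500^-1 * ((625 * x - 391) * sub_p x
       - 2500 * (1 - 2 * x ^+ 2) * sub_dp x - 2500 * x * (1 - x ^+ 2) * sub_ddp x).
  by field.
apply: mulr_ge0; first by rewrite invr_ge0 ler0n.
have -> : (625 * x - 391) * sub_p x - 2500 * (1 - 2 * x ^+ 2) * sub_dp x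
       - 2500 * x * (1 - x ^+ 2) * sub_ddp x =
  (32 * 1000 + 500) * (x ^+ 0 * (1 - x) ^+ 12) + (387 * 1000 + 483) * (x ^+ 1 * (1 - x) ^+ 11) +
  ((2 * 1000 + 57) * 1000 + 832) * (x ^+ 2 * (1 - x) ^+ 10) + ((7 * 1000 + 616) * 1000 + 318) * (x ^+ 3 * (1 - x) ^+ 9) +
  ((12 * 1000 + 383) * 1000 + 695) * (x ^+ 4 * (1 - x) ^+ 8) + ((34 * 1000 + 416) * 1000 + 758) * (x ^+ 5 * (1 - x) ^+ 7) +
  ((17 * 1000 + 470) * 1000 + 241) * (x ^+ 6 * (1 - x) ^+ 6) + ((34 * 1000 + 988) * 1000 + 191) * (x ^+ 7 * (1 - x) ^+ 5) +
  ((12 * 1000 + 924) * 1000 + 89) * (x ^+ 8 * (1 - x) ^+ 4) + ((7 * 1000 + 634) * 1000 + 689) * (x ^+ 9 * (1 - x) ^+ 3) +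
  ((1 * 1000 + 980) * 1000 + 669) * (x ^+ 10 * (1 - x) ^+ 2) + (516 * 1000 + 264) * (x ^+ 11 * (1 - x) ^+ 1) +
  (27 * 1000 + 552) * (x ^+ 12 * (1 - x) ^+ 0).
  by unfold sub_p, sub_dp, sub_ddp, sub_coefs, ddhev, dhev, hev; ring.
have y0 : 0 <= 1 - x by rewrite subr_ge0.
have T (a : R) i j : 0 <= a -> 0 <= a * (x ^+ i * (1 - x) ^+ j).
  by move=> a0; apply: mulr_ge0 => //; apply: mulr_ge0; exact: exprn_ge0.
repeat (apply: addr_ge0; last by apply: T; lra).
by apply: T; lra.
Qed.

End supersolution.

(** * Integrals of continuous functions on a segment *)

Section segment_integrals.
Context {R : realType}.
Notation mu := (@lebesgue_measure R).
Implicit Types (f g F : R -> R) (a b : R).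

(** Two-sided continuity is asked even at the end points; it combines pointwise and implies
    continuity within the segment. *)
Definition cont_on a b f := forall x, a <= x <= b -> {for x, continuous f}.

Lemma cont_on_within a b f : cont_on a b f -> {within `[a, b], continuous f}.
Proof.
by move=> cf; apply: continuous_in_subspaceT => x; rewrite inE/= in_itv/=; exact: cf.
Qed.

Lemma cont_onT a b f : continuous f -> cont_on a b f.
Proof. by move=> cf x _; exact: cf. Qed.

Lemma cont_on_integrable a b f : cont_on a b f ->
  mu.-integrable `[a, b] (EFin \o f).
Proof.
move=> /cont_on_within cf; apply: continuous_compact_integrable => //.
exact: segment_compact.
Qed.

Lemma cont_on_measurable a b f : cont_on a b f ->
  measurable_fun `[a, b] f.
Proof.
by move=> /cont_on_within cf; apply: subspace_continuous_measurable_fun.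
Qed.

Lemma cont_onM a b f g : cont_on a b f -> cont_on a b g ->
  cont_on a b (fun x => f x * g x).
Proof. by move=> cf cg x xab; apply: cvgM; [exact: cf|exact: cg]. Qed.

Lemma cont_onD a b f g : cont_on a b f -> cont_on a b g ->
  cont_on a b (fun x => f x + g x).
Proof. by move=> cf cg x xab; apply: cvgD; [exact: cf|exact: cg]. Qed.

Lemma cont_onB a b f g : cont_on a b f -> cont_on a b g ->
  cont_on a b (fun x => f x - g x).
Proof. by move=> cf cg x xab; apply: cvgB; [exact: cf|exact: cg]. Qed.

Lemma cont_on_cst a b (c : R) : cont_on a b (fun=> c).
Proof. by move=> x _; exact: cvg_cst. Qed.

Lemma integral_cont_on a b f : cont_on a b f ->
  (\int[mu]_(x in `[a, b]) (f x)%:E = (\int[mu]_(x in `[a, b]) f x)%R%:E)%E.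
Proof.
move=> cf; rewrite fineK//; apply: integrable_fin_num => //.
exact: cont_on_integrable.
Qed.

Lemma integral_oo_cc a b f : cont_on a b f ->
  (\int[mu]_(x in `]a, b[) (f x)%:E = \int[mu]_(x in `[a, b]) (f x)%:E)%E.
Proof.
move=> cf; apply/esym; apply: integral_itv_bndoo.
apply/measurable_EFinP.
by apply: measurable_funS (cont_on_measurable cf) => //; exact: subset_itv_oo_cc.
Qed.

Lemma FTC_segment a b F f : a < b -> cont_on a b f ->
  (forall x, a <= x <= b -> is_derive x 1 F (f x)) ->
  \int[mu]_(x in `[a, b]) f x = F b - F a.
Proof.
move=> ab cf dF.
have cF x : a <= x <= b -> {for x, continuous F}.
  move=> xab; have /derivable1_diffP : derivable F x 1 by have [] := dF x xab.
  exact: differentiable_continuous.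
rewrite /Rintegral (@continuous_FTC2 _ f F)//.
- exact: cont_on_within.
- split.
  + move=> x; rewrite in_itv/= => /andP[ax xb].
    by have [] := dF x; rewrite ?(ltW ax) ?(ltW xb).
  + by apply: cvg_at_right_filter; apply: cF; rewrite lexx ltW.
  + by apply: cvg_at_left_filter; apply: cF; rewrite lexx ltW.
- move=> x; rewrite in_itv/= => /andP[ax xb].
  have := dF x; rewrite (ltW ax) (ltW xb) => /(_ isT) ?.
  by rewrite derive1E derive_val.
Qed.

Lemma le_Rintegral_cont a b f g : cont_on a b f -> cont_on a b g ->
  (forall x, a <= x <= b -> f x <= g x) ->
  \int[mu]_(x in `[a, b]) f x <= \int[mu]_(x in `[a, b]) g x.
Proof.
move=> cf cg fg; apply: le_Rintegral => //.
- exact: cont_on_integrable.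
- exact: cont_on_integrable.
Qed.

Lemma RintegralD_cont a b f g : cont_on a b f -> cont_on a b g ->
  \int[mu]_(x in `[a, b]) (f x + g x) =
  \int[mu]_(x in `[a, b]) f x + \int[mu]_(x in `[a, b]) g x.
Proof. by move=> cf cg; apply: RintegralD => //; exact: cont_on_integrable. Qed.

Lemma RintegralZ_cont a b (k : R) f : cont_on a b f ->
  \int[mu]_(x in `[a, b]) (k * f x) = k * \int[mu]_(x in `[a, b]) f x.
Proof. by move=> cf; apply: RintegralZl => //; exact: cont_on_integrable. Qed.

End segment_integrals.

(** * The angular Rayleigh quotient and its lower bound *)

Section rayleigh_quotient.
Context {R : realType}.
Notation mu := (@lebesgue_measure R).
Implicit Types y : R -> R.

Lemma Coo1_cont y : Coo1 setT y -> continuous y.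
Proof. by move=> Cy x; exact: (Coo1_continuous Cy). Qed.

Lemma cont_sqr (y : R -> R) : continuous y -> continuous (fun x => `|y x| ^+ 2).
Proof.
move=> cy x; have -> : (fun x => `|y x| ^+ 2) = (fun x => y x * y x).
  by apply/funext => z; rewrite real_normK ?num_real// expr2.
by apply: cvgM; exact: cy.
Qed.

Definition num_density y : R -> R :=
  fun t => (`|derive1 y t| ^+ 2 + 4^-1 * `|y t| ^+ 2) * sin t.

Lemma cont_num_density y : Coo1 setT y -> continuous (num_density y).
Proof.
move=> Cy x; apply: cvgM; last exact: continuous_sin.
apply: cvgD.
  by apply: cont_sqr; apply: Coo1_cont; exact: Coo1_derive.
by apply: cvgM; [exact: cvg_cst|apply: cont_sqr; exact: Coo1_cont].
Qed.

Lemma rayleigh_den_ge0 y : 0 <= rayleigh_den y.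
Proof. by apply: Rintegral_ge0 => x _; rewrite exprn_ge0. Qed.

Lemma rayleigh_num_ge0 y : 0 <= rayleigh_num y.
Proof.
apply: Rintegral_ge0 => x; rewrite /= in_itv/= => /sin_ge0_pi sx.
by rewrite mulr_ge0// addr_ge0// ?mulr_ge0// ?invr_ge0// exprn_ge0.
Qed.

Definition rayleigh_set : set R := [set q | exists y, [/\ smooth1 y,
  rayleigh_den y != 0 & q = rayleigh_num y / rayleigh_den y]].

Lemma rayleigh_set_lbound : has_lbound rayleigh_set.
Proof.
exists 0 => _ [y [_ _ ->]].
by rewrite divr_ge0 ?rayleigh_num_ge0 ?rayleigh_den_ge0.
Qed.

Lemma lambda_le y : Coo1 setT y -> lambda R * rayleigh_den y <= rayleigh_num y.
Proof.
move=> Cy; have [->|d0] := eqVneq (rayleigh_den y) 0.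
  by rewrite mulr0 rayleigh_num_ge0.
have dgt0 : 0 < rayleigh_den y by rewrite lt_neqAle eq_sym d0 rayleigh_den_ge0.
rewrite -ler_pdivlMr//; apply: (ge_inf rayleigh_set_lbound).
by exists y; split => //; apply/smooth1P.
Qed.

(** Ground-state argument. With [P t = sub_p (sin t)], [sub_residual_ge0] says that
    [- (sin P')' + (sin / 4 - m) P >= 0] for [m = 391 / 2500]. Adding the exact derivative of
    [y^2 sin P' / P], the numerator density minus [m y^2] becomes [sin (y' - y P' / P)^2] plus
    [y^2 / P] times that residual. *)
Lemma sub_bound y : Coo1 setT y -> 1564 / 10000 * rayleigh_den y <= rayleigh_num y.
Proof.
move=> Cy; have -> : 1564 / 10000 = 391 / 2500 :> R by lra.
have res x : 0 <= x <= 1 -> _ := @sub_residual_ge0 R x.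
(* From here on only the residual inequality is known about the constant, which is kept abstract in
   the field identities. *)
move: (391 / 2500) res => m res.
have sI (t : R) : -1 <= sin t <= 1 by rewrite sin_geN1 sin_le1.
have P0 (t : R) : sub_p (sin t) != 0 by rewrite lt0r_neq0// sub_p_gt0.
pose P (t : R) := sub_p (sin t); pose D (t : R) := sub_dp (sin t).
pose DD (t : R) := sub_ddp (sin t).
have dP (t : R) : is_derive t 1 P (D t * cos t).
  exact: (is_derive1_comp (is_derive_hev _ _) (is_derive_sin t)).
have dD (t : R) : is_derive t 1 D (DD t * cos t).
  exact: (is_derive1_comp (is_derive_dhev _ _) (is_derive_sin t)).
(* This is [y^2 sin P' / P], which vanishes at [0] and [pi] because of the factor [sin]. *)
pose G t := y t * y t * (sin t * (cos t * (D t * (P t)^-1))).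
pose G' t := 2 * y t * derive1 y t * (sin t * cos t * D t / P t) +
  y t ^+ 2 * (((1 - 2 * sin t ^+ 2) * D t + sin t * (1 - sin t ^+ 2) * DD t) / P t
     - sin t * (1 - sin t ^+ 2) * D t ^+ 2 / P t ^+ 2).
have c2 t : cos t * cos t = 1 - sin t ^+ 2 :> R.
  by rewrite -expr2; apply/eqP; rewrite eq_sym subr_eq; apply/eqP/esym/cos2Dsin2.
have dG (t : R) : is_derive t 1 G (G' t).
  have dy := Coo1_is_derive Cy (I : setT t).
  have d1 := is_derive_mul dy dy.
  have d2 : is_derive t 1 (fun t => (P t)^-1) _ := @is_deriveV _ P t _ _ (P0 t) (dP t).
  have d3 := is_derive_mul (dD t) d2.
  have d4 := is_derive_mul (is_derive_cos t) d3.
  have d5 := is_derive_mul (is_derive_sin t) d4.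
  apply: (is_derive_eqr (is_derive_mul d1 d5)).
  rewrite /GRing.scale/= /G'; have := P0 t; rewrite -/(P t) => Pn.
  have -> : 1 - 2 * sin t ^+ 2 = cos t * cos t - sin t ^+ 2 by rewrite c2; ring.
  rewrite -c2; field; exact: Pn.
have Cs : Coo1 setT (@sin R) := Coo1_sin_cos.1.
have Cc : Coo1 setT (@cos R) := Coo1_sin_cos.2.
have cG' : continuous G'.
  have -> : G' = derive1 G.
    by apply/funext => t; have ? := dG t; rewrite derive1E derive_val.
  have oT : open [set: R] := openT.
  have CP : Coo1 setT P by exact: (Coo_comp1 oT _ (Coo1_hev _) Cs).
  have CD : Coo1 setT D by exact: (Coo_comp1 oT _ (Coo1_dhev _) Cs).
  have CiP : Coo1 setT (fun t => (P t)^-1).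
    by apply: (Coo_comp1 oT _ Coo1_inv CP) => t _; exact: P0.
  apply: Coo1_cont; apply: Coo1_derive.
  by do ?[apply: CooM => //].
have GG' : \int[mu]_(t in `[0, pi]) G' t = 0.
  rewrite (FTC_segment (pi_gt0 R) (cont_onT cG') (fun t _ => dG t)).
  by rewrite /G sinpi sin0 !mul0r !mulr0 subrr.
have cn := cont_num_density Cy.
have cd : continuous (fun t => `|y t| ^+ 2) by apply: cont_sqr; exact: Coo1_cont.
rewrite /rayleigh_den -RintegralZ_cont; last exact: cont_onT.
rewrite -[leLHS]addr0 -[X in _ + X <= _]GG' -RintegralD_cont; last 2 first.
- by apply: cont_onM; [exact: cont_on_cst|exact: cont_onT].
- exact: cont_onT.
apply: le_Rintegral_cont; [|exact: cont_onT|].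
  by apply: cont_onD; [apply: cont_onM; [exact: cont_on_cst|]|]; exact: cont_onT.
move=> t /[dup] /sin_ge0_pi s0 _; rewrite -subr_ge0.
have Pt : 0 < P t by apply: sub_p_gt0.
have {}res : 0 <= (sin t / 4 - m) * P t - (1 - 2 * sin t ^+ 2) * D t
       - sin t * (1 - sin t ^+ 2) * DD t.
  by apply: res; rewrite s0 sin_le1.
rewrite !real_normK ?num_real// /G'.
set y' := derive1 y t; set Y := y t.
have -> : (y' ^+ 2 + 4^-1 * Y ^+ 2) * sin t - (m * Y ^+ 2 +
    (2 * Y * y' * (sin t * cos t * D t / P t) +
     Y ^+ 2 * (((1 - 2 * sin t ^+ 2) * D t + sin t * (1 - sin t ^+ 2) * DD t) / P t -
               sin t * (1 - sin t ^+ 2) * D t ^+ 2 / P t ^+ 2))) =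
  sin t * (y' - Y * cos t * D t / P t) ^+ 2 +
  Y ^+ 2 * (((sin t / 4 - m) * P t - (1 - 2 * sin t ^+ 2) * D t
       - sin t * (1 - sin t ^+ 2) * DD t) / P t).
  by rewrite -!c2; field; exact: lt0r_neq0.
rewrite addr_ge0// mulr_ge0 ?sqr_ge0//.
by rewrite divr_ge0// ltW.
Qed.

End rayleigh_quotient.

(** * A rational lower bound on pi *)

Section pi_bound.
Context {R : realType}.
Implicit Types x : R.

Lemma ge0_of_derive_ge0 (f f' : R -> R) :
  (forall x, is_derive x 1 f (f' x)) -> f 0 = 0 ->
  (forall x, 0 <= x -> 0 <= f' x) -> forall x, 0 <= x -> 0 <= f x.
Proof.
move=> df f00 f'0 x; rewrite le_eqVlt => /predU1P[<-|x0]; first by rewrite f00.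
have cf : {within `[0, x], continuous f}.
  apply: continuous_subspaceT => y.
  have /derivable1_diffP : derivable f y 1 by have [] := df y.
  exact: differentiable_continuous.
have [c] := MVT x0 (fun y _ => df y) cf.
rewrite in_itv/= => /andP[c0 _]; rewrite f00 !subr0 => ->.
by rewrite mulr_ge0// ?f'0// ltW.
Qed.

(** [cos <= 1] is integrated five times from 0; each integration gives the next Taylor bound,
    alternately for [sin] and [cos]. *)
Lemma sin_le_taylor5 x : 0 <= x -> sin x <= x - x ^+ 3 / 6 + x ^+ 5 / 120.
Proof.
have step (l : seq R) (k : R) (g g' : R -> R) (f' : R -> R) :
    (forall x, is_derive x 1 g (g' x)) -> hev l 0 + k * g 0 = 0 ->
    (forall x, dhev l x + k * g' x = f' x) -> (forall x, 0 <= x -> 0 <= f' x) ->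
    forall x, 0 <= x -> 0 <= hev l x + k * g x.
  move=> dg g0 E; apply: ge0_of_derive_ge0 => // y.
  apply: (is_derive_eqr (is_derive_add (is_derive_hev l y)
    (is_derive_mul (is_derive_cstr k y) (dg y)))).
  by rewrite mul0r addr0 E.
have ds := @is_derive_sin R; have dc := @is_derive_cos R.
have C1 (y : R) : 0 <= y -> 0 <= hev [:: 1] y + (-1) * cos y.
  by move=> _; rewrite /= mulr0 addr0 mulN1r subr_ge0 cos_le1.
have S1 (y : R) : 0 <= y -> 0 <= hev [:: 0; 1] y + (-1) * sin y.
  by apply: (@step _ _ _ _ _ ds _ _ C1) => [|z]; rewrite /= ?sin0; ring.
have C2 (y : R) : 0 <= y -> 0 <= hev [:: -1; 0; 2^-1] y + 1 * cos y.
  by apply: (@step _ _ _ _ _ dc _ _ S1) => [|z]; rewrite /= ?cos0; field.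
have S3 (y : R) : 0 <= y -> 0 <= hev [:: 0; -1; 0; 6^-1] y + 1 * sin y.
  by apply: (@step _ _ _ _ _ ds _ _ C2) => [|z]; rewrite /= ?sin0; field.
have C4 (y : R) : 0 <= y -> 0 <= hev [:: 1; 0; - 2^-1; 0; 24^-1] y + (-1) * cos y.
  by apply: (@step _ _ _ _ _ dc _ _ S3) => [|z]; rewrite /= ?cos0; field.
have S5 (y : R) : 0 <= y -> 0 <= hev [:: 0; 1; 0; - 6^-1; 0; 120^-1] y + (-1) * sin y.
  by apply: (@step _ _ _ _ _ ds _ _ C4) => [|z]; rewrite /= ?sin0; field.
move=> /S5; rewrite mulN1r subr_ge0 => /le_trans; apply.
by rewrite le_eqVlt; apply/orP; left; apply/eqP => /=; field.
Qed.

(** For [s = sin (pi / 6)] the triple-angle formula gives [3 s - 4 s^3 = 1], that is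
    [(s + 1) (2 s - 1)^2 = 0], and [s] is positive. *)
Lemma sin_pi6 : sin (pi / 6) = 2^-1 :> R.
Proof.
set x : R := pi / 6; set s := sin x.
have c2 : cos x ^+ 2 = 1 - s ^+ 2 by rewrite -(cos2Dsin2 x) addrK.
have : sin (x + (x + x)) = 1.
  by rewrite -sin_pihalf; congr sin; rewrite /x; field.
rewrite sinD cosD sinD -/s => E.
have {}E : (s + 1) * (2 * s - 1) ^+ 2 = 0.
  have -> : (s + 1) * (2 * s - 1) ^+ 2 =
      1 - (s * (cos x * cos x - s * s) + cos x * (s * cos x + cos x * s)) +
      3 * s * (cos x ^+ 2 - (1 - s ^+ 2)) by ring.
  by rewrite E c2 !subrr mulr0 addr0.
have s0 : 0 < s.
  have p0 := pi_gt0 R; apply: sin_gt0_pi; apply/andP; split; rewrite /x; lra.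
move/eqP: E; rewrite mulf_eq0 sqrf_eq0 => /orP[/eqP|/eqP]; lra.
Qed.

(** If [pi / 6 <= 111 / 212], the Taylor bound would make [sin (pi / 6)] smaller than [1 / 2]. The
    quotient of [test_y] is below [0.1565] only when [pi] exceeds about [3.1413], so a bound as
    coarse as [3.14] would not do. *)
Lemma pi_gt : 333 / 106 < pi :> R.
Proof.
have p0 := pi_gt0 R.
set x : R := pi / 6.
suff : 111 / 212 < x by rewrite /x; lra.
have x0 : 0 <= x by rewrite /x; lra.
have := sin_le_taylor5 x0; rewrite sin_pi6 => H; rewrite ltNge; apply/negP => xa.
set a : R := 111 / 212 in xa *.
have a0 : 0 <= a by rewrite /a; lra.
(* The cube is replaced by its tangent line at [a], which leaves a contradiction linear in [x]. *)
have x3 : a ^+ 3 - 3 * a ^+ 2 * (a - x) <= x ^+ 3.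
  rewrite -subr_ge0.
  have -> : x ^+ 3 - (a ^+ 3 - 3 * a ^+ 2 * (a - x)) =
    (a - x) ^+ 2 * (x + 2 * a) by ring.
  by rewrite mulr_ge0 ?sqr_ge0// addr_ge0// mulr_ge0.
have x5 : x ^+ 5 <= a ^+ 5 by rewrite lerXn2r// nnegrE.
move: x3 x5 H xa; move: (x ^+ 3) (x ^+ 5) => X3 X5.
rewrite /a; lra.
Qed.

End pi_bound.

(** * Numerical bounds on lambda *)

Section lambda_bounds.
Context {R : realType}.
Notation mu := (@lebesgue_measure R).

(** A trial function whose two integrals are elementary; its quotient is about [0.15648]. *)
Definition test_y : R -> R := fun t => 1 - 10^-1 * sin t.

Lemma Coo1_test_y : Coo1 setT test_y.
Proof.
have oT : open [set: R] := openT.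
apply: CooB => //; first exact: Coo_cst.
by apply: CooZ => //; exact: Coo1_sin_cos.1.
Qed.

Lemma is_derive_test_y (t : R) : is_derive t 1 test_y (- 10^-1 * cos t).
Proof.
have d1 : is_derive t 1 (fun t => - 10^-1 * sin t) (- 10^-1 * cos t).
  apply: (is_derive_eqr (is_derive_mul (is_derive_cstr (- 10^-1) t) (is_derive_sin t))).
  by rewrite mul0r addr0.
have := is_derive_add (is_derive_cstr (1 : R) t) d1; rewrite add0r.
have -> // : (fun y : R => 1 + - 10^-1 * sin y) = test_y.
by apply/funext => z; rewrite /test_y mulNr.
Qed.

Lemma den_test_y : rayleigh_den test_y = pi - 2 / 5 + pi / 200.
Proof.
pose F (t : R) := (1 + 200^-1) * t + (5^-1 + (- 200^-1) * sin t) * cos t.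
have c2 (t : R) : sin t * sin t = 1 - cos t * cos t.
  by rewrite -!expr2 -(cos2Dsin2 t); ring.
have cf : cont_on 0 pi (fun t => `|test_y t| ^+ 2).
  by apply: cont_onT; apply: cont_sqr; apply: Coo1_cont; exact: Coo1_test_y.
have dF (t : R) : is_derive t 1 F (`|test_y t| ^+ 2).
  apply: (is_derive_eqr (is_derive_add
    (is_derive_mul (is_derive_cstr (1 + 200^-1) t) (is_derive_idr t))
    (is_derive_mul (is_derive_add (is_derive_cstr 5^-1 t)
       (is_derive_mul (is_derive_cstr (- 200^-1) t) (is_derive_sin t)))
     (is_derive_cos t)))).
  rewrite real_normK ?num_real// /test_y /=.
  have := c2 t; move: (sin t) (cos t) => s c sc.
  apply/eqP; rewrite -subr_eq0.
  set d := (X in X == 0).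
  have -> : d = - 200^-1 * (s * s - (1 - c * c)) by rewrite /d; field.
  by rewrite sc subrr mulr0.
rewrite [LHS](FTC_segment (pi_gt0 R) cf (fun t _ => dF t)).
by rewrite /F cospi cos0 sinpi sin0; field.
Qed.

Lemma num_test_y : rayleigh_num test_y = 51 / 100 - pi / 40.
Proof.
pose F (t : R) := (- 40^-1) * t + ((- (1/4 + 400^-1)) + 40^-1 * sin t
    + (- (400^-1)) * (cos t * cos t)) * cos t.
have c2 (t : R) : sin t * sin t = 1 - cos t * cos t.
  by rewrite -!expr2 -(cos2Dsin2 t); ring.
have cf := cont_onT (a := 0) (b := pi) (cont_num_density Coo1_test_y).
have dF (t : R) : is_derive t 1 F (num_density test_y t).
  apply: (is_derive_eqr (is_derive_add
    (is_derive_mul (is_derive_cstr (- 40^-1) t) (is_derive_idr t))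
    (is_derive_mul (is_derive_add (is_derive_add (is_derive_cstr (- (1/4 + 400^-1)) t)
       (is_derive_mul (is_derive_cstr 40^-1 t) (is_derive_sin t)))
       (is_derive_mul (is_derive_cstr (- 400^-1) t)
         (is_derive_mul (is_derive_cos t) (is_derive_cos t))))
     (is_derive_cos t)))).
  have ? := is_derive_test_y t.
  rewrite /num_density !real_normK ?num_real// derive1E derive_val /test_y /=.
  have := c2 t; move: (sin t) (cos t) => s c sc.
  apply/eqP; rewrite -subr_eq0.
  set d := (X in X == 0).
  have -> : d = (40^-1 - 400^-1 * s) * (s * s - (1 - c * c)) by rewrite /d; field.
  by rewrite sc subrr mulr0.
rewrite [LHS](FTC_segment (pi_gt0 R) cf (fun t _ => dF t)).
by rewrite /F cospi cos0 sinpi sin0; field.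
Qed.

Lemma lambda_bounds : 1564 / 10000 <= lambda R < 1565 / 10000.
Proof.
have p1 := @pi_gt R.
have d0 : rayleigh_den test_y != 0.
  by rewrite lt0r_neq0// den_test_y; lra.
have Q : rayleigh_set (rayleigh_num test_y / rayleigh_den test_y).
  by exists test_y; split=> //; apply/smooth1P; exact: Coo1_test_y.
apply/andP; split.
  apply: lb_le_inf; first by exists (rayleigh_num test_y / rayleigh_den test_y).
  move=> _ [y [/smooth1P Cy dy ->]].
  have dgt0 : 0 < rayleigh_den y by rewrite lt_neqAle eq_sym dy rayleigh_den_ge0.
  by rewrite ler_pdivlMr//; exact: sub_bound.
apply: (le_lt_trans (ge_inf rayleigh_set_lbound Q)).
rewrite num_test_y den_test_y.
by rewrite ltr_pdivrMr; lra.
Qed.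

Lemma lambda_approx (e : R) : 0 < e -> exists y, [/\ Coo1 setT y,
  0 < rayleigh_den y & rayleigh_num y < (lambda R + e) * rayleigh_den y].
Proof.
move=> e0.
have [|_ [y [/smooth1P Cy dy ->]] H] := @inf_adherent R rayleigh_set e e0.
  split; last exact: rayleigh_set_lbound.
  exists (rayleigh_num test_y / rayleigh_den test_y), test_y; split => //.
    by apply/smooth1P; exact: Coo1_test_y.
  have p1 := @pi_gt R.
  by rewrite lt0r_neq0// den_test_y; lra.
have dgt0 : 0 < rayleigh_den y by rewrite lt_neqAle eq_sym dy rayleigh_den_ge0.
by exists y; split => //; rewrite -ltr_pdivrMr.
Qed.

End lambda_bounds.

(** * Slicing integrals over the half-space *)

Section half_space_slices.
Context {R : realType} {n : nat}.
Notation mu := (@lebesgue_measure R).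
Local Notation mR := (measurableTypeR R).
Local Notation rV := 'rV[R]_n.+2.
Implicit Types (f u : rV -> R) (x : n.-tuple mR) (s t : R).

Definition pnt x s t : rV := rv_of_tuple (tcat2 x s t).

Lemma pntE x s t i : pnt x s t 0 i = nth 0 (x ++ [:: s; t]) i.
Proof. by rewrite /pnt mxE (tnth_nth 0). Qed.

Lemma pnt_lt x s t (i : 'I_n.+2) : (i < n)%N -> pnt x s t 0 i = nth 0 x i.
Proof. by move=> ni; rewrite pntE nth_cat size_tuple ni. Qed.

Lemma xpenult_pnt x s t : xpenult (pnt x s t) = s.
Proof.
rewrite /xpenult pntE inordK// nth_cat size_tuple ltnn subnn//.
Qed.

Lemma xlast_pnt x s t : xlast (pnt x s t) = t.
Proof.
by rewrite /xlast pntE nth_cat size_tuple/= ltnNge leqnSn/= subSnn.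
Qed.

Lemma pnt_derive x (a b : R -> R) (a' b' : R) (z : R) :
  is_derive z 1 a a' -> is_derive z 1 b b' -> forall j,
  is_derive z 1 (fun y => pnt x (a y) (b y) 0 j)
    (if j == inord n then a' else if j == ord_max then b' else 0).
Proof.
move=> da db j; case: eqP => [->|/eqP jn].
  by rewrite (_ : (fun=> _) = a)//; apply/funext => y; rewrite -[LHS]/(xpenult _) xpenult_pnt.
case: eqP => [->|/eqP jm].
  by rewrite (_ : (fun=> _) = b)//; apply/funext => y; rewrite -[LHS]/(xlast _) xlast_pnt.
have jlt : (j < n)%N.
  have := ltn_ord j; rewrite ltnS leq_eqVlt => /predU1P[jE|].
    by move: jm; rewrite -val_eqE/= jE eqxx.
  rewrite ltnS leq_eqVlt => /predU1P[jE|//].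
  by move: jn; rewrite -val_eqE/= inordK// jE eqxx.
rewrite (_ : (fun=> _) = fun=> nth 0 x j); first exact: is_derive_cstr.
by apply/funext => y; rewrite pnt_lt.
Qed.

Lemma sum_last2 (F : 'I_n.+2 -> R) :
  \sum_i F i = \sum_(i < n) F (inord i) + F (inord n) + F ord_max.
Proof.
rewrite !big_ord_recr/=; congr (_ + _ + _).
- apply: eq_bigr => i _; congr F; apply/val_inj; rewrite /= inordK//.
  by rewrite ltnS ltnW// ltnS ltnW.
- by congr F; apply/val_inj; rewrite /= inordK.
Qed.

Lemma inord_n_neq_max : (inord n == ord_max :> 'I_n.+2) = false.
Proof. by apply/eqP => /(congr1 val); rewrite /= inordK// => /eqP; rewrite ltn_eqF. Qed.

Definition ds u : rV -> R := partial (inord n) u.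
Definition dt u : rV -> R := partial ord_max u.

Lemma is_derive_pnt u x (a b : R -> R) (a' b' z : R) :
  is_derive z 1 a a' -> is_derive z 1 b b' ->
  differentiable u (pnt x (a z) (b z)) ->
  is_derive z 1 (fun y => u (pnt x (a y) (b y)))
    (a' * ds u (pnt x (a z) (b z)) + b' * dt u (pnt x (a z) (b z))).
Proof.
move=> da db du; apply: (is_derive_eqr (is_derive_curve (pnt_derive x da db) du)).
rewrite sum_last2 big1 ?add0r.
  by rewrite eqxx eq_sym inord_n_neq_max eqxx.
move=> i _; have ilt : (i < n.+2)%N by rewrite ltnS ltnW// ltnS ltnW.
rewrite -!val_eqE/= !inordK// !ltn_eqF ?mul0r//.
by rewrite ltnS ltnW.
Qed.

Lemma Coo_pnt u x (U : set rV) (V : set R) (a b : R -> R) : open V ->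
  (forall z, V z -> U (pnt x (a z) (b z))) -> Coo (@erv R n.+2) U u ->
  Coo1 V a -> Coo1 V b -> Coo1 V (fun y => u (pnt x (a y) (b y))).
Proof.
move=> oV UV Cu Ca Cb.
apply: (Coo_curve oV UV Cu) => j.
have [->|jn] := eqVneq j (inord n).
  by rewrite (_ : (fun=> _) = a)//; apply/funext => y; rewrite -[LHS]/(xpenult _) xpenult_pnt.
have [->|jm] := eqVneq j ord_max.
  by rewrite (_ : (fun=> _) = b)//; apply/funext => y; rewrite -[LHS]/(xlast _) xlast_pnt.
rewrite (_ : (fun=> _) = fun=> nth 0 x j); first exact: Coo_cst.
have jlt : (j < n)%N.
  have := ltn_ord j; rewrite ltnS leq_eqVlt => /predU1P[jE|].
    by move: jm; rewrite -val_eqE/= jE eqxx.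
  rewrite ltnS leq_eqVlt => /predU1P[jE|//].
  by move: jn; rewrite -val_eqE/= inordK// jE eqxx.
by apply/funext => y; rewrite pnt_lt.
Qed.

Lemma continuous_pnt x : continuous (fun z : R * R => pnt x z.1 z.2).
Proof.
move=> z; apply/cvgrPdist_lt => e e0.
have : \forall y \near z, `|z - y| < e by apply/nbhs_ballP; exists e => // y; rewrite -ball_normE.
apply: filterS => y; apply: le_lt_trans.
rewrite [leLHS]/Num.norm /= mx_normrE; apply: bigmax_le => // -[i j] _ /=.
rewrite !mxE !(tnth_nth 0)/= !nth_cat size_tuple; case: ifP => _.
  by rewrite subrr normr0.
rewrite [leRHS]/Num.norm/= le_max.
by case: (j - n)%N => [|[|k]]/=; rewrite ?lexx ?orbT// ?nth_nil subrr normr0 normr_ge0.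
Qed.

Lemma measurable_tcat2 x : measurable_fun setT (fun z : mR * mR => tcat2 x z.1 z.2).
Proof.
apply/measurable_fun_tnthP => i.
have [ilt|ige] := ltnP i n.
  rewrite (_ : _ \o _ = cst (nth 0 x i)); first exact: measurable_cst.
  by apply/funext => z /=; rewrite (tnth_nth 0)/= nth_cat size_tuple ilt.
rewrite (_ : _ \o _ = fun z : mR * mR => nth 0 [:: z.1; z.2] (i - n)).
  case: (i - n)%N => [|[|k]] /=; [exact: measurable_fst|exact: measurable_snd|].
  by rewrite nth_nil; exact: measurable_cst.
by apply/funext => z /=; rewrite (tnth_nth 0)/= nth_cat size_tuple ltnNge ige.
Qed.

(** Extension by zero across the boundary. It turns integrals over the half-space into integrals
    over all tuples, and later makes globally defined test functions out of functions smooth on the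
    half-space only. *)
Definition pf f : rV -> R := fun y => if 0 < xlast y then f y else 0.

Lemma pf_pos f y : 0 < xlast y -> pf f y = f y.
Proof. by rewrite /pf => ->. Qed.

Lemma integral_rv_pf f : integral_rv (half_space R n) f =
  (\int[lebesgue_tuple R n.+2]_t (pf f (rv_of_tuple t))%:E)%E.
Proof.
rewrite /integral_rv integral_mkcond; apply: eq_integral => t _.
rewrite patchE /pf; case: ifPn => [|/negP tN].
  by rewrite inE/= => ->.
case: ifPn => // t0; exfalso; apply: tN; by rewrite inE.
Qed.

Definition cont_half f := forall y, 0 < xlast y -> {for y, continuous f}.
Definition ge0_half f := forall y, 0 < xlast y -> 0 <= f y.

Lemma pf_ge0 f : ge0_half f -> forall y, 0 <= pf f y.
Proof. by move=> f0 y; rewrite /pf; case: ifPn => // /f0. Qed.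

Lemma measurable_half : measurable [set t : n.+2.-tuple mR | half_space R n (rv_of_tuple t)].
Proof.
rewrite (_ : [set t | _] = (fun t : n.+2.-tuple mR => tnth t ord_max) @^-1` `]0, +oo[%classic).
  by rewrite -[X in measurable X]setTI; exact: measurable_tnth.
by apply/seteqP; split=> t /=; rewrite /half_space/= /xlast mxE in_itv/= andbT.
Qed.

Lemma measurable_pf f : cont_half f ->
  measurable_fun setT (fun t : n.+2.-tuple mR => pf f (rv_of_tuple t)).
Proof.
move=> cf.
have -> : (fun t : n.+2.-tuple mR => pf f (rv_of_tuple t)) =
    (fun t : n.+2.-tuple mR => f (rv_of_tuple t)) \_
      [set t : n.+2.-tuple mR | half_space R n (rv_of_tuple t)].
  apply/funext => t; rewrite patchE /pf; case: ifPn => [t0|/negP tN].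
    by rewrite mem_set.
  by rewrite memNset.
apply/(measurable_restrictT _ measurable_half).
by apply: (measurable_rv _ measurable_half) => t; exact: cf.
Qed.

Lemma open_half : open (half_space R n).
Proof.
rewrite (_ : half_space R n = (coordrv ord_max : rV -> R) @^-1` [set z : R | 0 < z])//.
apply: open_comp; last exact: open_gt.
by move=> x _; exact: coordrv_continuous.
Qed.

Lemma pf_continuous f : cont_half f -> forall y, 0 < xlast y -> {for y, continuous (pf f)}.
Proof.
move=> cf y y0; rewrite /prop_for /continuous_at pf_pos//.
have ny : nbhs y (half_space R n).
  by apply: open_nbhs_nbhs; split; [exact: open_half|].
have nf : \forall z \near y, f z = pf f z.
  by apply: filterS ny => z z0; rewrite pf_pos.
have e : pf f x @[x --> y] `=>` f x @[x --> y] := near_eq_cvg nf.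
have h : f x @[x --> y] --> f y := cf y y0.
exact: (cvg_trans (e _) h).
Qed.

Lemma slice_polar f x : cont_half f -> ge0_half f ->
  (\int[mu]_s \int[mu]_t (pf f (pnt x s t))%:E =
   \int[mu]_(r in `]0%R, +oo[) \int[mu]_(phi in `]0%R, pi[)
     (r * f (pnt x (- (r * cos phi)) (r * sin phi)))%:E)%E.
Proof.
move=> cf f0.
rewrite (@polar _ (fun s t => pf f (pnt x s t))).
- apply: eq_integral => r; rewrite inE/= in_itv/= andbT => r0.
  apply: eq_integral => p; rewrite inE/= in_itv/= => p0.
  by rewrite pf_pos// xlast_pnt mulr_gt0// sin_gt0_pi.
- exact: (measurableT_comp (measurable_pf cf) (measurable_tcat2 x)).
- by move=> s t; exact: pf_ge0.
- by move=> s t t0; rewrite /pf xlast_pnt ltNge t0.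
- move=> s t t0.
  apply: (@continuous_comp _ _ _ (fun z : R * R => pnt x z.1 z.2) (pf f)).
    exact: continuous_pnt.
  by apply: pf_continuous => //; rewrite xlast_pnt.
Qed.

Lemma le_half f g : cont_half f -> ge0_half f -> cont_half g -> ge0_half g ->
  (forall x, (\int[mu]_s \int[mu]_t (pf f (pnt x s t))%:E <=
   \int[mu]_s \int[mu]_t (pf g (pnt x s t))%:E)%E) ->
  (integral_rv (half_space R n) f <= integral_rv (half_space R n) g)%E.
Proof.
move=> cf f0 cg g0 fg; rewrite !integral_rv_pf; apply: le_integral_tuple => //.
- by move=> t; rewrite lee_fin pf_ge0.
- by apply/measurable_EFinP; exact: measurable_pf.
- by move=> t; rewrite lee_fin pf_ge0.
- by apply/measurable_EFinP; exact: measurable_pf.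
Qed.

Lemma eq_half f g : cont_half f -> ge0_half f -> cont_half g -> ge0_half g ->
  (forall x, (\int[mu]_s \int[mu]_t (pf f (pnt x s t))%:E =
   \int[mu]_s \int[mu]_t (pf g (pnt x s t))%:E)%E) ->
  integral_rv (half_space R n) f = integral_rv (half_space R n) g.
Proof.
move=> cf f0 cg g0 fg; apply/eqP; rewrite eq_le.
by apply/andP; split; apply: le_half => // x; rewrite fg.
Qed.

Lemma integral_rvZ (k : R) f : 0 <= k -> cont_half f -> ge0_half f ->
  (k%:E * integral_rv (half_space R n) f = integral_rv (half_space R n) (fun y => k * f y)%R)%E.
Proof.
move=> k0 cf f0; rewrite !integral_rv_pf -ge0_integralZl//.
- by apply: eq_integral => t _; rewrite -EFinM /pf; case: ifPn; rewrite ?mulr0.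
- by apply/measurable_EFinP; exact: measurable_pf.
- by move=> t _; rewrite lee_fin pf_ge0.
Qed.

Lemma integral_rvD f g : cont_half f -> ge0_half f -> cont_half g -> ge0_half g ->
  (integral_rv (half_space R n) f + integral_rv (half_space R n) g =
   integral_rv (half_space R n) (fun y => f y + g y)%R)%E.
Proof.
move=> cf f0 cg g0; rewrite !integral_rv_pf -ge0_integralD//.
- by apply: eq_integral => t _; rewrite -EFinD /pf; case: ifPn; rewrite ?addr0.
- by move=> t _; rewrite lee_fin pf_ge0.
- by apply/measurable_EFinP; exact: measurable_pf.
- by move=> t _; rewrite lee_fin pf_ge0.
- by apply/measurable_EFinP; exact: measurable_pf.
Qed.

End half_space_slices.

(** * The radial and angular one-dimensional inequalities *)

Section hardy_inequality.
Context {R : realType}.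
Notation mu := (@lebesgue_measure R).
Local Notation mR := (measurableTypeR R).

Lemma continuous_sq (T : topologicalType) (f : T -> R) (x : T) :
  {for x, continuous f} -> {for x, continuous (fun y => f y ^+ 2)}.
Proof.
move=> cf; apply: (@continuous_comp _ _ _ f (fun y => y ^+ 2)) => //.
exact: exprn_continuous.
Qed.

Lemma integral_sub0 (A B : set mR) (h : R -> \bar R) : B `<=` A ->
  (forall x, A x -> ~ B x -> h x = 0%E) ->
  (\int[mu]_(x in A) h x = \int[mu]_(x in B) h x)%E.
Proof.
move=> BA h0; rewrite integral_mkcond [RHS]integral_mkcond.
apply: eq_integral => x _; rewrite !patchE.
case: ifPn => xA; case: ifPn => xB //.
  by apply: h0; [exact/set_mem|move/mem_set; exact/negP].
by move: xA; rewrite mem_set//; apply: BA; exact: set_mem.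
Qed.

(** Multiplying by the indicators of [A] and [B] makes the integrand nonnegative everywhere, which
    reduces to [tonelli_swap]. *)
Lemma tonelli_swap_in (A B : set mR) (F : R -> R -> R) :
  measurable A -> measurable B ->
  measurable_fun setT (fun z : mR * mR => F z.1 z.2) ->
  (forall x y, A x -> B y -> 0 <= F x y) ->
  (\int[mu]_(x in A) \int[mu]_(y in B) (F x y)%:E =
   \int[mu]_(y in B) \int[mu]_(x in A) (F x y)%:E)%E.
Proof.
move=> mA mB mF F0.
pose G x y := \1_A x * \1_B y * F x y : R.
have mG : measurable_fun setT (fun z : mR * mR => G z.1 z.2).
  apply: measurable_funM => //; apply: measurable_funM.
    by apply: measurableT_comp => //; exact: measurable_fst.
  by apply: measurableT_comp => //; exact: measurable_snd.
have G0 x y : 0 <= G x y.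
  rewrite /G !indicE; case: (boolP (x \in A)) => xA; last by rewrite !mul0r.
  case: (boolP (y \in B)) => yB; last by rewrite mulr0 mul0r.
  by rewrite !mul1r; apply: F0; exact: set_mem.
have L := tonelli_swap mG G0.
transitivity (\int[mu]_x \int[mu]_y (G x y)%:E)%E.
  rewrite integral_mkcond; apply: eq_integral => x _; rewrite patchE /G !indicE.
  case: ifPn => xA; last by rewrite integral0_eq// => y _; rewrite !mul0r.
  rewrite integral_mkcond; apply: eq_integral => y _; rewrite patchE !indicE.
  by case: ifPn => yB; rewrite ?mul1r ?mulr0 ?mul0r.
rewrite L; apply/esym.
rewrite integral_mkcond; apply: eq_integral => y _; rewrite patchE /G.
case: ifPn => yB; last first.
  by rewrite integral0_eq// => x _; rewrite !indicE (negbTE yB) mulr0 mul0r.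
rewrite integral_mkcond; apply: eq_integral => x _; rewrite patchE !indicE yB.
by case: ifPn => xA; rewrite ?mul1r ?mul0r.
Qed.

(* Completing the square: [r g' + g / 2] squared differs from
   [r ^ 2 g' ^ 2 - g ^ 2 / 4] by the exact derivative of [r g ^ 2 / 2]. *)
Lemma hardy (k M : R) (g g' : R -> R) : 0 <= k -> 0 < M ->
  (forall x : R, is_derive x 1 g (g' x)) -> continuous g' ->
  (forall x, M <= x -> g x = 0) ->
  (\int[mu]_(r in `]0%R, +oo[) (k * (4^-1 * g r ^+ 2))%:E <=
   \int[mu]_(r in `]0%R, +oo[) (k * (r ^+ 2 * g' r ^+ 2))%:E)%E.
Proof.
move=> k0 M0 dg cg' gM.
have cg : continuous g.
  move=> x; have /derivable1_diffP : derivable g x 1 by have [] := dg x.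
  exact: differentiable_continuous.
have c1 : continuous (fun r => k * (4^-1 * g r ^+ 2)).
  move=> r; apply: cvgM; first exact: cvg_cst.
  apply: cvgM; first exact: cvg_cst.
  by apply: continuous_sq; exact: cg.
have c2 : continuous (fun r : R => k * (r ^+ 2 * g' r ^+ 2)).
  move=> r; apply: cvgM; first exact: cvg_cst.
  apply: cvgM; first exact: exprn_continuous.
  by apply: continuous_sq; exact: cg'.
pose G r := - (k / 2) * (r * (g r * g r)).
pose G' r := - (k / 2) * (g r * g r + r * (2 * g r * g' r)).
have dG (r : R) : is_derive r 1 G (G' r).
  apply: (is_derive_eqr (is_derive_mul (is_derive_cstr (- (k / 2)) r)
    (is_derive_mul (is_derive_idr r) (is_derive_mul (dg r) (dg r))))).
  by rewrite /G'; ring.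
have cG' : continuous G'.
  move=> r; apply: cvgM; first exact: cvg_cst.
  apply: cvgD; first by apply: cvgM; exact: cg.
  apply: cvgM; first exact: cvg_id.
  apply: cvgM; last exact: cg'.
  by apply: cvgM; [exact: cvg_cst|exact: cg].
have I0 : \int[mu]_(r in `[0, M]) G' r = 0.
  rewrite (FTC_segment M0 (cont_onT cG') (fun r _ => dG r)).
  by rewrite /G gM// !mulr0 mul0r mulr0 subrr.
have S : `]0, M[%classic `<=` (`]0, +oo[%classic : set mR).
  by move=> x /=; rewrite !in_itv/= => /andP[->].
rewrite (integral_sub0 S); last first.
  move=> x /=; rewrite !in_itv/= andbT => x0 /negP; rewrite x0/= -leNgt => Mx.
  by rewrite gM// expr0n/= !mulr0.
apply: (@le_trans _ _ (\int[mu]_(r in `]0%R, M[) (k * (r ^+ 2 * g' r ^+ 2))%:E)%E); last first.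
  apply: ge0_subset_integral => //.
  - by apply: measurable_funTS; apply/measurable_EFinP; exact: continuous_measurable_fun.
  - by move=> x _; rewrite lee_fin mulr_ge0// mulr_ge0// sqr_ge0.
rewrite !integral_oo_cc; [|exact: cont_onT|exact: cont_onT].
rewrite !integral_cont_on; [|exact: cont_onT|exact: cont_onT].
rewrite lee_fin -[leLHS]addr0 -[X in _ + X <= _]I0 -RintegralD_cont; [|exact: cont_onT|exact: cont_onT].
apply: le_Rintegral_cont; [|exact: cont_onT|].
  by apply: cont_onD; exact: cont_onT.
move=> r _; rewrite -subr_ge0 /G'.
have -> : k * (r ^+ 2 * g' r ^+ 2) - (k * (4^-1 * g r ^+ 2) +
    - (k / 2) * (g r * g r + r * (2 * g r * g' r))) =
    k * (r * g' r + g r / 2) ^+ 2 by field.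
by rewrite mulr_ge0// sqr_ge0.
Qed.

Lemma angular_inequality (y : R -> R) : Coo1 setT y ->
  (\int[mu]_(p in `]0%R, pi[) (lambda R * y p ^+ 2)%:E <=
   \int[mu]_(p in `]0%R, pi[) ((derive1 y p ^+ 2 + 4^-1 * y p ^+ 2) * sin p)%:E)%E.
Proof.
move=> Cy.
have c1 : continuous (fun p => lambda R * y p ^+ 2).
  move=> p; apply: cvgM; first exact: cvg_cst.
  by apply: continuous_sq; exact: Coo1_cont.
have E : (fun p => (derive1 y p ^+ 2 + 4^-1 * y p ^+ 2) * sin p) = num_density y.
  by apply/funext => p; rewrite /num_density !real_normK ?num_real.
have c2 : continuous (fun p => (derive1 y p ^+ 2 + 4^-1 * y p ^+ 2) * sin p).
  by rewrite E; exact: cont_num_density.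
rewrite !integral_oo_cc; [|exact: cont_onT|exact: cont_onT].
rewrite !integral_cont_on; [|exact: cont_onT|exact: cont_onT].
have c3 : continuous (fun p => y p ^+ 2).
  by move=> p; apply: continuous_sq; exact: Coo1_cont.
rewrite lee_fin RintegralZ_cont ?E; last exact: cont_onT.
have := lambda_le Cy; rewrite /rayleigh_den /rayleigh_num.
by under eq_Rintegral do rewrite real_normK ?num_real//.
Qed.

End hardy_inequality.

(** * Iterated integrals over a product set *)

Section iterated_integrals.
Context {R : realType}.
Notation mu := (@lebesgue_measure R).
Local Notation mR := (measurableTypeR R).
Variables (A B : set mR).
Hypotheses (mA : measurable A) (mB : measurable B).

Definition iint (F : R -> R -> R) : \bar R :=
  (\int[mu]_(x in A) \int[mu]_(y in B) (F x y)%:E)%E.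

Definition meas2 (F : R -> R -> R) :=
  measurable_fun setT (fun z : mR * mR => F z.1 z.2).

Definition ge0_on (F : R -> R -> R) := forall x y, A x -> B y -> 0 <= F x y.

Lemma meas2_inner F x : meas2 F -> measurable_fun B (fun y => (F x y)%:E).
Proof.
move=> mF; apply: measurable_funTS; apply/measurable_EFinP.
exact: (measurableT_comp mF (measurable_pair1 x)).
Qed.

Lemma meas2_outer F : meas2 F -> ge0_on F ->
  measurable_fun A (fun x => (\int[mu]_(y in B) (F x y)%:E)%E).
Proof.
move=> mF F0.
pose G (z : mR * mR) := (\1_A z.1 * \1_B z.2 * F z.1 z.2)%:E.
have mG : measurable_fun setT G.
  apply/measurable_EFinP; apply: measurable_funM => //; apply: measurable_funM.
    by apply: measurableT_comp => //; exact: measurable_fst.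
  by apply: measurableT_comp => //; exact: measurable_snd.
have G0 z : (0 <= G z)%E.
  rewrite lee_fin !indicE; case: (boolP (z.1 \in A)) => xA; last by rewrite !mul0r.
  case: (boolP (z.2 \in B)) => yB; last by rewrite mulr0 mul0r.
  by rewrite !mul1r; apply: F0; exact: set_mem.
have H := @measurable_fun_fubini_tonelli_F _ _ mR mR R lebesgue_measure G mG G0.
have E : {in A, fubini_F mu G =1 (fun x => (\int[mu]_(y in B) (F x y)%:E)%E)}.
  move=> x xA; rewrite /fubini_F [RHS]integral_mkcond; apply: eq_integral => y _.
  by rewrite patchE /G/= !indicE xA mul1r; case: ifPn => yB; rewrite ?mul1r ?mul0r.
by apply: (eq_measurable_fun _ E); exact: measurable_funTS.
Qed.

Lemma le_iint F G : meas2 F -> ge0_on F -> meas2 G -> ge0_on G ->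
  (forall x, A x -> (\int[mu]_(y in B) (F x y)%:E <= \int[mu]_(y in B) (G x y)%:E)%E) ->
  (iint F <= iint G)%E.
Proof.
move=> mF F0 mG G0 FG; apply: ge0_le_integral => //.
- by move=> x Ax; apply: integral_ge0 => y By; rewrite lee_fin F0.
- exact: meas2_outer.
- exact: meas2_outer.
Qed.

Lemma le_iint_pointwise F G : meas2 F -> ge0_on F -> meas2 G -> ge0_on G ->
  (forall x y, A x -> B y -> F x y <= G x y) -> (iint F <= iint G)%E.
Proof.
move=> mF F0 mG G0 FG; apply: le_iint => // x Ax; apply: ge0_le_integral => //.
- by move=> y By; rewrite lee_fin F0.
- exact: meas2_inner.
- exact: meas2_inner.
- by move=> y By; rewrite lee_fin FG.
Qed.

Lemma iintD F G : meas2 F -> ge0_on F -> meas2 G -> ge0_on G ->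
  iint (fun x y => F x y + G x y) = (iint F + iint G)%E.
Proof.
move=> mF F0 mG G0; rewrite /iint -ge0_integralD//; last 4 first.
- by move=> x Ax; apply: integral_ge0 => y By; rewrite lee_fin F0.
- exact: meas2_outer.
- by move=> x Ax; apply: integral_ge0 => y By; rewrite lee_fin G0.
- exact: meas2_outer.
apply: eq_integral => x /set_mem Ax; rewrite -ge0_integralD//.
- by move=> y By; rewrite lee_fin F0.
- exact: meas2_inner.
- by move=> y By; rewrite lee_fin G0.
- exact: meas2_inner.
Qed.

Lemma eq_iint F G : (forall x y, A x -> B y -> F x y = G x y) -> iint F = iint G.
Proof.
move=> FG; apply: eq_integral => x /set_mem Ax; apply: eq_integral => y /set_mem By.
by rewrite FG.
Qed.

End iterated_integrals.

(** * Regularity of the integrands on the half-space *)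

Section lower_bound.
Context {R : realType} {n : nat}.
Notation mu := (@lebesgue_measure R).
Local Notation mR := (measurableTypeR R).
Local Notation rV := 'rV[R]_n.+2.
Local Notation erv := (@erv R n.+2).
Implicit Types (u : rV -> R) (x : n.-tuple mR).

Definition radius (y : rV) : R := Num.sqrt (xpenult y ^+ 2 + xlast y ^+ 2).

Lemma radius_gt0 y : 0 < xlast y -> 0 < radius y.
Proof. by move=> y0; rewrite sqrtr_gt0 ltr_wpDl ?sqr_ge0// exprn_gt0. Qed.

Lemma xlast_continuous : continuous (@xlast R n).
Proof. exact: coordrv_continuous. Qed.

Lemma xpenult_continuous : continuous (@xpenult R n).
Proof. exact: coordrv_continuous. Qed.

Lemma radius_continuous : continuous radius.
Proof.
move=> y; apply: (@continuous_comp _ _ _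
  (fun y => xpenult y ^+ 2 + xlast y ^+ 2) Num.sqrt).
  exact: (cvgD (continuous_sq (xpenult_continuous (x:=y)))
    (continuous_sq (xlast_continuous (x:=y)))).
exact: sqrt_continuous.
Qed.

Lemma Coo_continuous u (U : set rV) y : Coo erv U u -> U y -> {for y, continuous u}.
Proof. by move=> Cu /(Coo_diff Cu) /differentiable_continuous. Qed.

Lemma normsq_gradE u y : normsq_grad u y = \sum_i partial i u y * partial i u y.
Proof. by apply: eq_bigr => i _; rewrite real_normK ?num_real// expr2. Qed.

Lemma normsq_grad_split u y : normsq_grad u y =
  \sum_(i < n) partial (inord i) u y ^+ 2 + ds u y ^+ 2 + dt u y ^+ 2.
Proof.
by rewrite normsq_gradE sum_last2 !expr2.
Qed.

Lemma normsq_grad_ge0 u y : 0 <= normsq_grad u y.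
Proof. by apply: sumr_ge0 => i _; rewrite exprn_ge0. Qed.

Lemma normsq_grad_continuous u (U : set rV) y : open U -> Coo erv U u -> U y ->
  {for y, continuous (normsq_grad u)}.
Proof.
move=> oU Cu Uy; rewrite (_ : normsq_grad u = fun y => \sum_i partial i u y * partial i u y).
  apply: (Coo_continuous _ Uy) => k; apply: Ck_sum => // i.
  by apply: CkM => //; apply: Coo_pd.
by apply/funext => z; exact: normsq_gradE.
Qed.

Lemma measurable_polar_pnt u x : continuous u ->
  meas2 (fun r p => u (pnt x (- (r * cos p)) (r * sin p))).
Proof.
move=> cu.
have mu1 : measurable_fun setT (fun t : n.+2.-tuple mR => u (rv_of_tuple t)).
  by apply: (measurable_rv _ measurableT) => t _; exact: cu.
pose pol (z : mR * mR) : mR * mR := (- (z.1 * cos z.2), z.1 * sin z.2).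
have mpol : measurable_fun setT pol.
  apply/measurable_fun_pairP; split.
    apply: measurable_funN; apply: measurable_funM; first exact: measurable_fst.
    apply: measurableT_comp; last exact: measurable_snd.
    by apply: continuous_measurable_fun; exact: continuous_cos.
  apply: measurable_funM; first exact: measurable_fst.
  apply: measurableT_comp; last exact: measurable_snd.
  by apply: continuous_measurable_fun; exact: continuous_sin.
exact: (measurableT_comp mu1 (measurableT_comp (measurable_tcat2 x) mpol)).
Qed.

End lower_bound.

(** * Radial and angular derivatives *)

Section polar_derivatives.
Context {R : realType} {n : nat}.
Notation mu := (@lebesgue_measure R).
Local Notation mR := (measurableTypeR R).
Local Notation rV := 'rV[R]_n.+2.
Local Notation erv := (@erv R n.+2).
Implicit Types (u : rV -> R) (x : n.-tuple mR) (r p : R).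

Definition ppt x r p : rV := pnt x (- (r * cos p)) (r * sin p).

Definition dr u x r p := - cos p * ds u (ppt x r p) + sin p * dt u (ppt x r p).
Definition dphi u x r p :=
  r * sin p * ds u (ppt x r p) + r * cos p * dt u (ppt x r p).

Lemma xlast_ppt x r p : xlast (ppt x r p) = r * sin p.
Proof. by rewrite xlast_pnt. Qed.

Lemma sin2E p : sin p ^+ 2 = 1 - cos p ^+ 2.
Proof. by rewrite -(cos2Dsin2 p) addrAC subrr add0r. Qed.

Lemma radius_ppt x r p : 0 <= r -> radius (ppt x r p) = r.
Proof.
move=> r0; rewrite /radius xpenult_pnt xlast_pnt sqrrN !exprMn -mulrDr cos2Dsin2.
by rewrite mulr1 sqrtr_sqr ger0_norm.
Qed.

Lemma is_derive_dr u x r p : differentiable u (ppt x r p) ->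
  is_derive r 1 (fun r => u (ppt x r p)) (dr u x r p).
Proof.
move=> du; apply: (@is_derive_pnt _ _ u x (fun r => - (r * cos p))
  (fun r => r * sin p) (- cos p) (sin p) r _ _ du).
  have -> : (fun r : R => - (r * cos p)) = (fun r => - cos p * r).
    by apply/funext => z; rewrite mulNr mulrC.
  apply: (is_derive_eqr (is_derive_mul (is_derive_cstr (- cos p) r) (is_derive_idr r))).
  by rewrite mul0r addr0 mulr1.
apply: (is_derive_eqr (is_derive_mul (is_derive_idr r) (is_derive_cstr (sin p) r))).
by rewrite mulr0 add0r mul1r.
Qed.

Lemma is_derive_dphi u x r p : differentiable u (ppt x r p) ->
  is_derive p 1 (fun p => u (ppt x r p)) (dphi u x r p).
Proof.
move=> du; apply: (@is_derive_pnt _ _ u x (fun p => - (r * cos p))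
  (fun p => r * sin p) (r * sin p) (r * cos p) p _ _ du).
  have -> : (fun p : R => - (r * cos p)) = (fun p => - r * cos p).
    by apply/funext => z; rewrite mulNr.
  apply: (is_derive_eqr (is_derive_mul (is_derive_cstr (- r) p) (is_derive_cos p))).
  by rewrite mul0r addr0 mulrNN.
Qed.

(** For [r] nonzero, [(dr, dphi / r)] is the gradient in a rotated orthonormal frame. *)
Lemma polar_grad u x r p :
  r ^+ 2 * (ds u (ppt x r p) ^+ 2 + dt u (ppt x r p) ^+ 2) =
  r ^+ 2 * dr u x r p ^+ 2 + dphi u x r p ^+ 2.
Proof.
rewrite /dr /dphi; move: (ds _ _) (dt _ _) => a b.
transitivity (r ^+ 2 * (a ^+ 2 + b ^+ 2) * (cos p ^+ 2 + sin p ^+ 2)).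
  by rewrite cos2Dsin2 mulr1.
by ring.
Qed.

Lemma Coo1_ppt_r u x p : Coo erv setT u -> Coo1 setT (fun r => u (ppt x r p)).
Proof.
move=> Cu; have oT : open [set: R] := openT.
apply: (Coo_pnt (U := setT)) => //.
  have -> : (fun r : R => - (r * cos p)) = (fun r => - cos p * r).
    by apply/funext => z; rewrite mulNr mulrC.
  by apply: CooZ => //; exact: Coo1_id.
by apply: CooM => //; [exact: Coo1_id|exact: Coo_cst].
Qed.

Lemma Coo1_ppt_phi u x r : Coo erv setT u -> Coo1 setT (fun p => u (ppt x r p)).
Proof.
move=> Cu; have oT : open [set: R] := openT.
apply: (Coo_pnt (U := setT)) => //.
  have -> : (fun p : R => - (r * cos p)) = (fun p => - r * cos p).
    by apply/funext => z; rewrite mulNr.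
  by apply: CooZ => //; exact: Coo1_sin_cos.2.
by apply: CooZ => //; exact: Coo1_sin_cos.1.
Qed.

Lemma meas2_trig (f : R -> R) : continuous f -> meas2 (fun r p : R => f p).
Proof.
move=> cf; apply: (@measurableT_comp _ _ _ _ _ _ f); last exact: measurable_snd.
exact: continuous_measurable_fun.
Qed.

Lemma meas2_fst : meas2 (fun r p : R => r).
Proof. exact: measurable_fst. Qed.

Lemma meas2M (F G : R -> R -> R) : meas2 F -> meas2 G -> meas2 (fun r p => F r p * G r p).
Proof. exact: measurable_funM. Qed.

Lemma meas2D (F G : R -> R -> R) : meas2 F -> meas2 G -> meas2 (fun r p => F r p + G r p).
Proof. exact: measurable_funD. Qed.

Lemma meas2X (F : R -> R -> R) k : meas2 F -> meas2 (fun r p => F r p ^+ k).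
Proof. exact: measurable_funX. Qed.

Lemma meas2_cst (k : R) : meas2 (fun r p : R => k).
Proof. exact: measurable_cst. Qed.

Lemma partial_continuous u i : Coo erv setT u -> continuous (partial i u).
Proof. by move=> Cu y; apply: (Coo_continuous (Coo_pd i Cu)). Qed.

Lemma meas2_dr u x : Coo erv setT u -> meas2 (dr u x).
Proof.
move=> Cu; apply: meas2D; apply: meas2M.
- by apply: meas2_trig => p; apply: cvgN; exact: continuous_cos.
- by apply: measurable_polar_pnt; exact: partial_continuous.
- by apply: meas2_trig; exact: continuous_sin.
- by apply: measurable_polar_pnt; exact: partial_continuous.
Qed.

Lemma meas2_dphi u x : Coo erv setT u -> meas2 (dphi u x).
Proof.
move=> Cu; apply: meas2D; apply: meas2M.
- by apply: meas2M; [exact: meas2_fst|apply: meas2_trig; exact: continuous_sin].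
- by apply: measurable_polar_pnt; exact: partial_continuous.
- by apply: meas2M; [exact: meas2_fst|apply: meas2_trig; exact: continuous_cos].
- by apply: measurable_polar_pnt; exact: partial_continuous.
Qed.

End polar_derivatives.

(** * The weighted inequality with constant lambda *)

Section lower_bound.
Context {R : realType} {n : nat}.
Notation mu := (@lebesgue_measure R).
Local Notation mR := (measurableTypeR R).
Local Notation rV := 'rV[R]_n.+2.
Local Notation erv := (@erv R n.+2).
Local Notation A := (`]0, +oo[%classic : set mR).
Local Notation B := (`]0, pi[%classic : set mR).

Lemma lambda_gt0 : 0 < lambda R.
Proof. by have /andP[+ _] := @lambda_bounds R; apply: lt_le_trans; lra. Qed.

Variable u : rV -> R.
Hypothesis Cu : Coo erv setT u.
Variable M : R.
Hypothesis M0 : 0 <= M.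
Hypothesis uM : forall y, 0 < xlast y -> u y != 0 -> forall i, `|y 0 i| <= M.

Let inA r : A r <-> 0 < r. Proof. by rewrite /= in_itv/= andbT. Qed.
Let inB p : B p -> 0 < sin p. Proof. by rewrite /= in_itv/= => /sin_gt0_pi. Qed.

(** Where [u] is nonzero both planar coordinates are at most [M] in absolute value, so [r ^+ 2 <= 2
    * M ^+ 2 < (2 * (M + 1)) ^+ 2]. *)
Lemma ppt_far x r p : B p -> 2 * (M + 1) <= r -> u (ppt x r p) = 0.
Proof.
have M1 : 0 < M + 1 by rewrite ltr_wpDl.
move=> Bp rM; apply/eqP/negPn/negP => u0.
have r0 : 0 < r by apply: lt_le_trans rM; rewrite mulr_gt0.
have xl : 0 < xlast (ppt x r p) by rewrite xlast_ppt mulr_gt0// inB.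
have h1 := uM xl u0 (inord n); have h2 := uM xl u0 ord_max.
have e1 : ppt x r p 0 (inord n) = - (r * cos p) by exact: xpenult_pnt.
have e2 : ppt x r p 0 ord_max = r * sin p by exact: xlast_pnt.
rewrite e1 normrN in h1; rewrite e2 in h2.
have s1 : (r * cos p) ^+ 2 <= M ^+ 2.
  by rewrite -[_ ^+ 2]real_normK ?num_real// lerXn2r// nnegrE (le_trans _ h1).
have s2 : (r * sin p) ^+ 2 <= M ^+ 2.
  by rewrite -[_ ^+ 2]real_normK ?num_real// lerXn2r// nnegrE (le_trans _ h1).
have : r ^+ 2 <= 2 * M ^+ 2.
  have -> : r ^+ 2 = (r * cos p) ^+ 2 + (r * sin p) ^+ 2.
    by rewrite !exprMn -mulrDr cos2Dsin2 mulr1.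
  by rewrite mulr2n mulrDl mul1r lerD.
have : (2 * (M + 1)) ^+ 2 <= r ^+ 2 by rewrite lerXn2r// nnegrE ltW// mulr_gt0.
have -> : (2 * (M + 1)) ^+ 2 = 4 * M ^+ 2 + 8 * M + 4 by ring.
move=> h3 h4; have h5 := sqr_ge0 M; move: M0 h3 h4 h5.
by move: (r ^+ 2) (M ^+ 2) => a b; lra.
Qed.

(** For each [r] the angular inequality bounds [lambda u^2] by [sin (u_phi^2 + u^2 / 4)]. After
    exchanging the integrals, Hardy's inequality on each ray turns the [u^2 / 4] part into
    [r^2 u_r^2], the weight [sin phi] being a constant there. *)
Lemma slice_lower_bound x :
  (iint A B (fun r p => lambda R * u (ppt x r p) ^+ 2)%R <=
   iint A B (fun r p => sin p * (r ^+ 2 * dr u x r p ^+ 2) +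
     sin p * dphi u x r p ^+ 2)%R)%E.
Proof.
have cu : continuous u by move=> y; exact: (Coo_continuous Cu).
have mU : meas2 (fun r p => u (ppt x r p)) by exact: measurable_polar_pnt.
have ms : meas2 (fun r p : R => sin p) by apply: meas2_trig; exact: continuous_sin.
have mR2 := meas2X 2 (meas2_dr x Cu); have mP2 := meas2X 2 (meas2_dphi x Cu).
have mr2 := meas2X 2 (@meas2_fst R).
have m1 : meas2 (fun r p => lambda R * u (ppt x r p) ^+ 2).
  by apply: meas2M; [exact: meas2_cst|exact: meas2X].
have m2 : meas2 (fun r p => sin p * (4^-1 * u (ppt x r p) ^+ 2)).
  by apply: meas2M => //; apply: meas2M; [exact: meas2_cst|exact: meas2X].
have m3 : meas2 (fun r p => sin p * dphi u x r p ^+ 2) by exact: meas2M.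
have m4 : meas2 (fun r p => sin p * (r ^+ 2 * dr u x r p ^+ 2)).
  by apply: meas2M => //; exact: meas2M.
have g1 : ge0_on A B (fun r p => lambda R * u (ppt x r p) ^+ 2).
  by move=> r p _ _; rewrite mulr_ge0 ?sqr_ge0// ltW// lambda_gt0.
have g2 : ge0_on A B (fun r p => sin p * (4^-1 * u (ppt x r p) ^+ 2)).
  by move=> r p _ /inB/ltW s0; rewrite mulr_ge0// mulr_ge0 ?invr_ge0 ?sqr_ge0.
have g3 : ge0_on A B (fun r p => sin p * dphi u x r p ^+ 2).
  by move=> r p _ /inB/ltW s0; rewrite mulr_ge0// sqr_ge0.
have g4 : ge0_on A B (fun r p => sin p * (r ^+ 2 * dr u x r p ^+ 2)).
  by move=> r p _ /inB/ltW s0; rewrite mulr_ge0// mulr_ge0 ?sqr_ge0.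
have mA : measurable A by [].
have mB : measurable B by [].
apply: (@le_trans _ _ (iint A B (fun r p => sin p * (4^-1 * u (ppt x r p) ^+ 2) +
    sin p * dphi u x r p ^+ 2))).
  apply: le_iint => //; first exact: meas2D.
    by move=> r p Ar Bp; rewrite addr_ge0//; [exact: g2|exact: g3].
  move=> r _; have := angular_inequality (Coo1_ppt_phi x r Cu).
  congr (_ <= _)%E; apply: eq_integral => p _; congr EFin.
  have ? := is_derive_dphi (Coo_diff Cu I : differentiable u (ppt x r p)).
  by rewrite derive1E derive_val; ring.
rewrite !iintD//; apply: leeD => //.
rewrite /iint (tonelli_swap_in mA mB m2 g2) (tonelli_swap_in mA mB m4 g4).
apply: (le_iint (A := B) (B := A)) => //.
- exact: (measurableT_comp m2 (@measurable_swap _ _ _ _)).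
- by move=> p r Bp Ar; exact: g2.
- exact: (measurableT_comp m4 (@measurable_swap _ _ _ _)).
- by move=> p r Bp Ar; exact: g4.
move=> p Bp; have M1 : 0 < M + 1 by rewrite ltr_wpDl.
apply: (@hardy _ (sin p) (2 * (M + 1)) (fun r => u (ppt x r p)) (fun r => dr u x r p)).
- by rewrite ltW// inB.
- by rewrite mulr_gt0.
- by move=> r; apply: is_derive_dr; exact: Coo_diff Cu I.
- have -> : (fun r => dr u x r p) = derive1 (fun r => u (ppt x r p)).
    apply/funext => r.
    have ? := is_derive_dr (Coo_diff Cu I : differentiable u (ppt x r p)).
    by rewrite derive1E derive_val.
  by apply: Coo1_cont; apply: Coo1_derive; exact: Coo1_ppt_r.
- by move=> r; exact: ppt_far.
Qed.

(** In polar coordinates the two sides of [slice_lower_bound] appear, up to the term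
    [r^2 sin phi S], where the sum [S] of the squared derivatives in the first [n] variables is
    nonnegative. *)
Lemma lower_bound :
  ((lambda R)%:E * integral_rv (half_space R n) (fun y => `|u y| ^+ 2 / radius y)%R <=
   integral_rv (half_space R n) (fun y => xlast y * normsq_grad u y)%R)%E.
Proof.
have cu : continuous u by move=> y; exact: (Coo_continuous Cu).
have cf : cont_half (fun y => `|u y| ^+ 2 / radius y).
  move=> y y0; have cr := radius_continuous (x:=y).
  have rn : radius y != 0 by rewrite lt0r_neq0// radius_gt0.
  have -> : (fun y => `|u y| ^+ 2 / radius y) = (fun y => u y ^+ 2 * (radius y)^-1).
    by apply/funext => z; rewrite real_normK ?num_real.
  exact: (cvgM (continuous_sq (cu y)) (cvgV rn cr)).
have f0 : ge0_half (fun y => `|u y| ^+ 2 / radius y).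
  by move=> y y0; rewrite divr_ge0 ?exprn_ge0// ltW// radius_gt0.
have cg : cont_half (fun y => xlast y * normsq_grad u y).
  move=> y _; apply: (cvgM (xlast_continuous (x:=y))).
  exact: (normsq_grad_continuous openT Cu I).
have g0 : ge0_half (fun y => xlast y * normsq_grad u y).
  by move=> y y0; rewrite mulr_ge0 ?normsq_grad_ge0// ltW.
have l0 := ltW lambda_gt0.
have cf' : cont_half (fun y => lambda R * (`|u y| ^+ 2 / radius y)).
  by move=> y y0; exact: (cvgM (cvg_cst _) (cf y y0)).
have f0' : ge0_half (fun y => lambda R * (`|u y| ^+ 2 / radius y)).
  by move=> y y0; rewrite mulr_ge0// f0.
rewrite integral_rvZ//; apply: le_half => // x.
rewrite !slice_polar//.
apply: le_trans (le_trans (slice_lower_bound x) _).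
  rewrite le_eqVlt; apply/orP; left; apply/eqP; apply: (eq_iint (A := A) (B := B)).
  move=> r p /inA r0 Bp; rewrite -/(ppt x r p) radius_ppt ?ltW//.
  by rewrite real_normK ?num_real//; field; exact: lt0r_neq0.
have ns : continuous (normsq_grad u).
  by move=> y; apply: normsq_grad_continuous Cu _ => //; exact: openT.
have ms : meas2 (fun r p : R => sin p) by apply: meas2_trig; exact: continuous_sin.
have mR2 := meas2X 2 (meas2_dr x Cu); have mP2 := meas2X 2 (meas2_dphi x Cu).
have mr2 := meas2X 2 (@meas2_fst R).
apply: (le_iint_pointwise (A := A) (B := B)) => //.
- by apply: meas2D; apply: meas2M => //; exact: meas2M.
- move=> r p _ /inB/ltW s0; rewrite addr_ge0// mulr_ge0 ?sqr_ge0//.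
  by rewrite mulr_ge0 ?sqr_ge0.
- apply: meas2M; first exact: meas2_fst.
  have cxn : continuous (fun y => xlast y * normsq_grad u y).
    by move=> y; exact: (cvgM (xlast_continuous (x:=y)) (ns y)).
  exact: (measurable_polar_pnt x cxn).
- move=> r p /inA r0 /inB s0; apply: mulr_ge0; first exact: ltW.
  apply: mulr_ge0; last exact: normsq_grad_ge0.
  by rewrite xlast_pnt mulr_ge0// ltW.
- move=> r p /inA r0 /inB s0; rewrite -mulrDr -polar_grad -/(ppt x r p) xlast_ppt.
  rewrite normsq_grad_split; set S := \sum_(i < n) _; set a := ds _ _; set b := dt _ _.
  have S0 : 0 <= S by apply: sumr_ge0 => i _; exact: sqr_ge0.
  rewrite -subr_ge0.
  have -> : r * (r * sin p * (S + a ^+ 2 + b ^+ 2)) - sin p * (r ^+ 2 * (a ^+ 2 + b ^+ 2))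
    = r ^+ 2 * sin p * S by ring.
  by rewrite mulr_ge0// mulr_ge0 ?sqr_ge0// ltW.
Qed.

End lower_bound.

(** * Extending compactly supported functions by zero *)

Section gluing.
Context {R : realType} {n : nat}.
Local Notation rV := 'rV[R]_n.+2.
Local Notation erv := (@erv R n.+2).
Local Notation half := (half_space R n).
Implicit Types (u v f : rV -> R) (K : set rV).

(** Smoothness is local, and the space is covered by two open sets: the half-space, where [pf f] is
    [f], and the complement of [K], where it is zero. *)
Lemma Coo_pf K f : closed K -> K `<=` half -> Coo erv half f ->
  (forall y, half y -> ~ K y -> f y = 0) -> Coo erv setT (pf f).
Proof.
move=> cK KD Cf fK; apply/Coo_smoothP => s y _.
have [y0|y0] := ltP 0 (xlast y).
  have C1 : Coo erv half (pf f).
    apply: Coo_eq Cf; first exact: open_half.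
    by move=> z; rewrite inE => z0; rewrite pf_pos.
  by move/Coo_smoothP : C1; exact.
have C2 : Coo erv (~` K) (pf f).
  apply: (@Coo_eq _ _ _ _ _ (fun=> 0)); first by rewrite openC.
    move=> z; rewrite inE => Kz; rewrite /pf; case: ifPn => // z0.
    by rewrite fK.
  exact: Coo_cst.
move/Coo_smoothP : C2; apply => Ky.
by have := KD _ Ky; rewrite /half_space/= ltNge y0.
Qed.

Lemma rV_hausdorff : hausdorff_space rV.
Proof. exact: norm_hausdorff. Qed.

Lemma glue_C0infty K f : compact K -> K `<=` half -> Coo erv half f ->
  (forall y, half y -> ~ K y -> f y = 0) -> C0infty half (pf f).
Proof.
move=> cptK KD Cf fK.
have cK : closed K by apply: compact_closed => //; exact: rV_hausdorff.
have sK : closure (half `&` [set y | pf f y != 0]) `<=` K.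
  rewrite [X in _ `<=` X](closure_id K).1//; apply: closureS => y [hy].
  rewrite /= pf_pos// => fy; apply: contrapT => Ky.
  by move: fy; rewrite fK// eqxx.
split.
- by apply/smoothP; exact: Coo_pf cK KD Cf fK.
- by apply: (subclosed_compact _ cptK sK); exact: closed_closure.
- exact: subset_trans KD.
Qed.

(** The set [D] is left free in order to cover the test functions on the open half-space as well as
    those on its closure. *)
Lemma C0infty_bound (D : set rV) u : half `<=` D -> C0infty D u ->
  exists2 M : R, 0 <= M &
    forall y, 0 < xlast y -> u y != 0 -> forall i, `|y 0 i| <= M.
Proof.
move=> hD [_ cptu _].
have [M [Mr HM]] := compact_bounded cptu.
exists (`|M| + 1); first by rewrite addr_ge0.
move=> y y0 uy i; apply: (le_trans (le_norm_coord y i)).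
apply: HM; first by rewrite (le_lt_trans (ler_norm M))// ltrDl.
by apply: subset_closure; split => //; exact: hD.
Qed.

Lemma C0infty_half_supp u : C0infty half u -> exists K, [/\ compact K,
  K `<=` half & forall y, half y -> ~ K y -> u y = 0].
Proof.
move=> [_ cptu suppu]; exists (closure (half `&` [set y | u y != 0])); split => //.
move=> y hy Ky; apply/eqP; apply: contrapT => /negP uy; apply: Ky.
exact: subset_closure.
Qed.

End gluing.

(** * The substitution relating the two inequalities *)

Section transfer.
Context {R : realType} {n : nat}.
Notation mu := (@lebesgue_measure R).
Local Notation mR := (measurableTypeR R).
Local Notation rV := 'rV[R]_n.+2.
Local Notation erv := (@erv R n.+2).
Local Notation half := (half_space R n).
Implicit Types (u v f : rV -> R).

(** The square root on the positive axis, in a form whose smoothness there follows from that of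
    [expR] and [ln]. *)
Definition hs (t : R) : R := expR (2^-1 * ln t).

Lemma hs_gt0 t : 0 < hs t.
Proof. exact: expR_gt0. Qed.

Lemma hs_sqr t : 0 < t -> hs t ^+ 2 = t.
Proof.
move=> t0; rewrite /hs -expRM_natl mulrA divff// mul1r lnK//.
Qed.

Lemma Coo1_hs : Coo1 [set t : R | 0 < t] hs.
Proof.
apply: (Coo_comp1 (V := setT) open_gt0 _ Coo1_expR) => //.
by apply: CooZ; [exact: open_gt0|exact: Coo1_ln].
Qed.

Lemma is_derive_hs (t : R) : 0 < t -> is_derive t 1 hs (hs t * (2^-1 * t^-1)).
Proof.
move=> t0.
have d1 : is_derive t 1 (fun t => 2^-1 * ln t) (2^-1 * t^-1).
  apply: (is_derive_eqr (is_derive_mul (is_derive_cstr (2^-1) t) (is_derive1_ln t0))).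
  by rewrite mul0r addr0.
exact: (is_derive1_comp (is_derive_expR _) d1).
Qed.

Lemma pd_comp1 (f : R -> R) (g : rV -> R) i y d :
  differentiable g y -> is_derive (g y) 1 f d ->
  partial i (f \o g) y = partial i g y * d.
Proof.
move=> dg df.
have df' : differentiable f (g y) by apply/derivable1_diffP; have [] := df.
have := @pd_comp _ _ R _ unit erv e1 (fun=> idfun : {linear R -> R^o}) _ _ f g i y dg df'.
rewrite (big_pred1 tt) => [|[]//]; rewrite /pd /partial => -> //.
- by congr (_ * _); rewrite /e1 derive_val.
- by move=> _ x; exact: cvg_id.
- by move=> v; rewrite (big_pred1 tt) => [|[]//]; rewrite /e1 [_%:A]mulr1.
Qed.

Lemma partial_xlast i y : partial i (@xlast R n) y = (i == ord_max)%:R.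
Proof.
rewrite /partial deriveE; last exact: differentiable_coord.
rewrite (@diff_lin _ _ R^o (coordrv ord_max) _ (@coordrv_continuous R n.+2 ord_max)).
by rewrite /= /coordrv mxE eqxx eq_sym.
Qed.

Lemma Coo_hs_xlast : Coo erv half (fun y => hs (xlast y)).
Proof.
apply: (Coo_comp1 open_half _ Coo1_hs) => //.
by apply: Coo_coord; exact: open_half.
Qed.

Lemma partial_hs_mul u v i y : Coo erv half u -> half y ->
  (forall z, half z -> v z = hs (xlast z) * u z) ->
  partial i v y = hs (xlast y) * partial i u y +
    (i == ord_max)%:R * (hs (xlast y) * (2^-1 * (xlast y)^-1)) * u y.
Proof.
move=> Cu hy vE.
have E : {in half, v =1 (fun z => hs (xlast z)) * u}.
  by move=> z; rewrite inE => /vE.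
have := near_pd erv i open_half E; move=> /(_ y); rewrite inE => /(_ hy).
rewrite /pd /partial => ->.
have dh : differentiable (fun z : rV => hs (xlast z)) y := Coo_diff Coo_hs_xlast hy.
have du : differentiable u y := Coo_diff Cu hy.
rewrite deriveM; [|exact: diff_derivable|exact: diff_derivable].
rewrite /GRing.scale/= [u y * _]mulrC; congr (_ + _ * _).
have := @pd_comp1 hs (@xlast R n) i y _ _ (is_derive_hs hy).
rewrite partial_xlast; apply; exact: differentiable_coord.
Qed.

(** Only the last derivative sees the factor [t^(1/2)]: it is [t^(1/2) (u_t + u / (2 t))]. Its
    square produces the Hardy term [v^2 / (4 t^2)] and the cross term [u u_t]. *)
Lemma normsq_hs_mul u v y : Coo erv half u -> half y ->
  (forall z, half z -> v z = hs (xlast z) * u z) ->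
  normsq_grad v y = xlast y * normsq_grad u y + 4^-1 * (v y ^+ 2 / xlast y ^+ 2)
    + u y * dt u y.
Proof.
move=> Cu hy vE; have t0 : xlast y != 0 by rewrite lt0r_neq0.
rewrite !normsq_grad_split (vE y hy) /ds /dt !(partial_hs_mul _ Cu hy vE).
rewrite inord_n_neq_max eqxx.
have -> : \sum_(i < n) partial (inord i) v y ^+ 2 =
    xlast y * \sum_(i < n) partial (inord i) u y ^+ 2.
  rewrite mulr_sumr; apply: eq_bigr => i _; rewrite (partial_hs_mul _ Cu hy vE).
  have -> : (inord i == ord_max :> 'I_n.+2) = false.
    apply/eqP => /(congr1 val); rewrite /= inordK; last by rewrite ltnS ltnW// ltnS ltnW.
    by move=> /eqP; rewrite ltn_eqF// ltnS ltnW.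
  by rewrite !mul0r addr0 exprMn hs_sqr.
rewrite !mul0r addr0 mul1r exprMn hs_sqr//.
set S := \sum_(i < n) _; set a := partial _ _ _; set b := partial _ _ _.
have -> : (hs (xlast y) * b + hs (xlast y) * (2^-1 / xlast y) * u y) ^+ 2 =
   hs (xlast y) ^+ 2 * (b + (2^-1 / xlast y) * u y) ^+ 2 by ring.
rewrite exprMn hs_sqr//; field.
exact: t0.
Qed.

(** On each line in the direction of the last coordinate, [u u_t] is the derivative of [u^2 / 2]; it
    integrates to 0 because [u] vanishes at [t = 0] and beyond [M]. *)
Lemma transfer_identity u v (M : R) : Coo erv setT u -> Coo erv setT v ->
  0 <= M ->
  (forall y, half y -> u y != 0 -> forall i, `|y 0 i| <= M) ->
  (forall y, xlast y <= 0 -> u y = 0) ->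
  (forall y, half y -> v y = hs (xlast y) * u y) ->
  integral_rv half (normsq_grad v) =
  ((4^-1)%:E * integral_rv half (fun y => `|v y| ^+ 2 / xlast y ^+ 2)%R +
   integral_rv half (fun y => xlast y * normsq_grad u y)%R)%E.
Proof.
move=> Cu Cv M0 uM u0 vE.
have cxl := @xlast_continuous R n.
have cf1 : cont_half (fun y => `|v y| ^+ 2 / xlast y ^+ 2).
  move=> y y0.
  have xn : xlast y ^+ 2 != 0 by rewrite expf_neq0// lt0r_neq0.
  have -> : (fun y => `|v y| ^+ 2 / xlast y ^+ 2) = (fun y => v y ^+ 2 * (xlast y ^+ 2)^-1).
    by apply/funext => z; rewrite real_normK ?num_real.
  have cv : {for y, continuous v} by exact: (Coo_continuous Cv).
  exact: (cvgM (continuous_sq cv) (cvgV xn (continuous_sq (cxl y)))).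
have ge1 : ge0_half (fun y => `|v y| ^+ 2 / xlast y ^+ 2).
  by move=> y y0; rewrite divr_ge0 ?exprn_ge0// ltW.
have cu2 : cont_half (fun y => xlast y * normsq_grad u y).
  by move=> y _; exact: (cvgM (cxl y) (normsq_grad_continuous openT Cu I)).
have ge2 : ge0_half (fun y => xlast y * normsq_grad u y).
  by move=> y y0; rewrite mulr_ge0 ?normsq_grad_ge0// ltW.
have cf1' : cont_half (fun y => 4^-1 * (`|v y| ^+ 2 / xlast y ^+ 2)).
  by move=> y y0; exact: (cvgM (cvg_cst _) (cf1 y y0)).
have ge1' : ge0_half (fun y => 4^-1 * (`|v y| ^+ 2 / xlast y ^+ 2)).
  by move=> y y0; rewrite mulr_ge0 ?invr_ge0// ge1.
rewrite integral_rvZ ?invr_ge0// integral_rvD//.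
have cnv : continuous (normsq_grad v).
  by move=> y; exact: (normsq_grad_continuous openT Cv I).
apply: eq_half.
- by move=> y _; exact: cnv.
- by move=> y _; exact: normsq_grad_ge0.
- by move=> y y0; exact: (cvgD (cf1' y y0) (cu2 y y0)).
- by move=> y y0; rewrite addr_ge0 ?ge1' ?ge2.
move=> x; apply: eq_integral => s _.
(* At fixed [x] and [s], [f] and [g] are the two integrands in the last variable, and [w] is their
   difference for positive [t]. *)
pose f t := normsq_grad v (pnt x s t).
pose g t := 4^-1 * (`|v (pnt x s t)| ^+ 2 / xlast (pnt x s t) ^+ 2) +
  xlast (pnt x s t) * normsq_grad u (pnt x s t).
pose w t := u (pnt x s t) * dt u (pnt x s t).
have pos t : 0 < t -> half (pnt x s t) by rewrite /half_space/= xlast_pnt.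
have fgw t : 0 < t -> f t = g t + w t.
  move=> /pos ht; rewrite /f /g /w.
  rewrite (normsq_hs_mul (CooS (@subsetT _ _) Cu) ht vE) real_normK ?num_real//.
  by rewrite [X in X + _ = _]addrC.
have oM : open [set y : rV | M < xlast y].
  rewrite (_ : [set y | _] = (coordrv ord_max : rV -> R) @^-1` [set z : R | M < z])//.
  by apply: open_comp; [move=> z _; exact: coordrv_continuous|exact: open_gt].
have uz : {in [set y : rV | M < xlast y], u =1 fun=> 0}.
  move=> y; rewrite inE/= => My; apply/eqP/negPn/negP => uy.
  have hy : half y by apply: le_lt_trans My.
  have := uM y hy uy ord_max; rewrite leNgt => /negP; apply.
  by apply: (lt_le_trans My); exact: ler_norm.
have vz : {in [set y : rV | M < xlast y], v =1 fun=> 0}.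
  move=> y yM; rewrite vE ?uz ?mulr0//.
  by move: yM; rewrite inE/=; exact: le_lt_trans.
have fz t : M < t -> f t = 0.
  move=> Mt; rewrite /f normsq_gradE big1// => i _.
  by rewrite (partial_eq0 i oM vz) ?mul0r//= xlast_pnt.
have gz t : M < t -> g t = 0.
  move=> Mt; have My : [set y : rV | M < xlast y] (pnt x s t) by rewrite /= xlast_pnt.
  rewrite /g vz ?inE// normr0 expr0n/= mul0r mulr0 add0r normsq_gradE big1 ?mulr0// => i _.
  by rewrite (partial_eq0 i oM uz) ?mul0r.
have toR h (H : rV -> R) : (forall t, 0 < t -> h t = H (pnt x s t)) ->
    (forall t, M < t -> h t = 0) ->
    (\int[mu]_t (pf H (pnt x s t))%:E = \int[mu]_(t in `]0%R, (M + 1)%R[) (h t)%:E)%E.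
  move=> hH hz; rewrite integral_posE; last first.
    by move=> t t0; rewrite /pf xlast_pnt ltNge t0.
  rewrite (@integral_sub0 _ _ (`]0, (M + 1)[%classic : set mR)).
  - apply: eq_integral => t; rewrite inE/= in_itv/= => /andP[t0 _].
    by rewrite pf_pos ?xlast_pnt// hH.
  - by move=> t /=; rewrite !in_itv/= => /andP[->].
  - move=> t /=; rewrite !in_itv/= andbT => t0 /negP; rewrite t0/= -leNgt => tM.
    rewrite pf_pos ?xlast_pnt// -hH// hz//.
    by apply: lt_le_trans tM; rewrite ltrDl.
rewrite (toR f (normsq_grad v))//.
rewrite (toR g (fun y => 4^-1 * (`|v y| ^+ 2 / xlast y ^+ 2) + xlast y * normsq_grad u y))//.
have cp : continuous (fun t => pnt x s t).
  move=> t; apply: (@continuous_comp _ _ _ (fun t => (s, t)) (fun z : R * R => pnt x z.1 z.2)).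
    by apply: (@continuous_at_pair _ _ (fun=> s) id); [exact: cvg_cst|exact: cvg_id].
  exact: continuous_pnt.
have cu : continuous u by move=> y; exact: (Coo_continuous Cu).
have cfs : continuous f.
  by move=> t; apply: (@continuous_comp _ _ _ (fun t => pnt x s t)); [exact: cp|exact: cnv].
have cw : continuous w.
  move=> t; have c1 : {for t, continuous (fun t => u (pnt x s t))}.
    by apply: (@continuous_comp _ _ _ (fun t => pnt x s t)); [exact: cp|exact: cu].
  have c2 : {for t, continuous (fun t => dt u (pnt x s t))}.
    apply: (@continuous_comp _ _ _ (fun t => pnt x s t)); first exact: cp.
    exact: partial_continuous.
  exact: (cvgM c1 c2).
(* Since [g] divides by powers of [t], it is replaced by [f - w], which equals it for [t > 0] and is
   continuous up to [t = 0]. *)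
transitivity (\int[mu]_(t in `]0%R, (M + 1)%R[) (f t - w t)%:E)%E; last first.
  apply: eq_integral => t; rewrite inE/= in_itv/= => /andP[t0 _].
  by rewrite fgw// addrK.
have M1 : 0 < M + 1 by rewrite ltr_wpDl.
have cfw := cont_onB (cont_onT (a := 0) (b := M + 1) cfs) (cont_onT cw).
rewrite !integral_oo_cc//; last exact: cont_onT.
rewrite !integral_cont_on//; last exact: cont_onT.
congr EFin.
pose W t := 2^-1 * (u (pnt x s t) * u (pnt x s t)).
have dW (t : R) : is_derive t 1 W (w t).
  have du : is_derive t 1 (fun t => u (pnt x s t)) (dt u (pnt x s t)).
    have := @is_derive_pnt _ _ u x (fun=> s) (fun t => t) 0 1 t (is_derive_cstr s t)
      (is_derive_idr t) (Coo_diff Cu I).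
    by rewrite mul0r add0r mul1r.
  apply: (is_derive_eqr (is_derive_mul (is_derive_cstr 2^-1 t) (is_derive_mul du du))).
  by rewrite /w; field.
have w0 : \int[mu]_(t in `[0, M + 1]) w t = 0.
  rewrite (FTC_segment M1 (cont_onT cw) (fun t _ => dW t)) /W.
  rewrite uz ?inE/= ?xlast_pnt ?ltrDl// u0 ?xlast_pnt//.
  by rewrite !mul0r mulr0 subrr.
have := RintegralD_cont cfw (cont_onT cw); rewrite w0 addr0 => <-.
by apply: eq_Rintegral => t _; rewrite subrK.
Qed.

End transfer.

(** * Both inequalities hold with constant lambda *)

Section both_lower_bounds.
Context {R : realType} {n : nat}.
Local Notation rV := 'rV[R]_n.+2.
Local Notation erv := (@erv R n.+2).
Local Notation half := (half_space R n).
Implicit Types (u v f g : rV -> R).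

Lemma eq_integral_rv f g : (forall y, half y -> f y = g y) ->
  integral_rv half f = integral_rv half g.
Proof.
move=> fg; rewrite !integral_rv_pf; apply: eq_integral => t _; congr EFin.
by rewrite /pf; case: ifPn => // /fg.
Qed.

Lemma C0infty_Coo (D : set rV) u : C0infty D u -> Coo erv setT u.
Proof. by move=> [/smoothP]. Qed.

Lemma weighted_lower_bound (D : set rV) u : half `<=` D -> C0infty D u ->
  ((lambda R)%:E * integral_rv half (fun y => `|u y| ^+ 2 / radius y)%R <=
   integral_rv half (fun y => xlast y * normsq_grad u y)%R)%E.
Proof.
move=> hD Cu; have [M M0 uM] := C0infty_bound hD Cu.
exact: (lower_bound (C0infty_Coo Cu) M0 uM).
Qed.

Lemma C0infty_mul (k : R -> R) u : Coo1 [set t | 0 < t] k -> C0infty half u ->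
  C0infty half (pf (fun y => k (xlast y) * u y)).
Proof.
move=> Ck Cu; have [K [cptK KD uK]] := C0infty_half_supp Cu.
apply: (glue_C0infty cptK KD); last by move=> y hy Ky; rewrite uK// mulr0.
apply: CooM; first exact: open_half.
  apply: (Coo_comp1 open_half _ Ck) => //.
  by apply: Coo_coord; exact: open_half.
exact: (CooS (@subsetT _ _) (C0infty_Coo Cu)).
Qed.

Lemma transfer u v : C0infty half u -> C0infty half v ->
  (forall y, xlast y <= 0 -> u y = 0) ->
  (forall y, half y -> v y = hs (xlast y) * u y) ->
  integral_rv half (normsq_grad v) =
  ((4^-1)%:E * integral_rv half (fun y => `|v y| ^+ 2 / xlast y ^+ 2)%R +
   integral_rv half (fun y => xlast y * normsq_grad u y)%R)%E.
Proof.
move=> Cu Cv; have [M M0 uM] := C0infty_bound (@subset_refl _ half) Cu.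
exact: (transfer_identity (C0infty_Coo Cu) (C0infty_Coo Cv) M0 uM).
Qed.

Lemma hs_sqr_div u v y : half y -> v y = hs (xlast y) * u y ->
  `|v y| ^+ 2 / (xlast y * radius y) = `|u y| ^+ 2 / radius y.
Proof.
move=> hy ->; rewrite !real_normK ?num_real// exprMn hs_sqr//.
by field; rewrite !lt0r_neq0// radius_gt0.
Qed.

Lemma unweighted_lower_bound v : C0infty half v ->
  ((4^-1)%:E * integral_rv half (fun y => `|v y| ^+ 2 / xlast y ^+ 2)%R +
   (lambda R)%:E * integral_rv half (fun y => `|v y| ^+ 2 / (xlast y * radius y))%R <=
   integral_rv half (normsq_grad v))%E.
Proof.
move=> Cv; pose u := pf (fun y => (hs (xlast y))^-1 * v y).
have Ch : Coo1 [set t : R | 0 < t] (fun t => (hs t)^-1).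
  apply: (Coo_comp1 open_gt0 _ Coo1_inv Coo1_hs) => t _ /=.
  by rewrite lt0r_neq0// hs_gt0.
have Cu : C0infty half u by exact: (C0infty_mul Ch Cv).
have vE y : half y -> v y = hs (xlast y) * u y.
  by move=> hy; rewrite /u pf_pos// mulVKf// lt0r_neq0// hs_gt0.
rewrite (transfer Cu Cv _ vE); last by move=> y y0; rewrite /u /pf ltNge y0.
apply: leeD => //.
rewrite (eq_integral_rv (g := fun y => `|u y| ^+ 2 / radius y)).
  exact: weighted_lower_bound Cu.
by move=> y hy; apply: hs_sqr_div => //; exact: vE.
Qed.

End both_lower_bounds.

(** * A logarithmic cutoff in the angle *)

Section angular_cutoff.
Context {R : realType}.
Notation mu := (@lebesgue_measure R).
Implicit Types (y : R -> R) (p : R).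

Lemma cont_on_sub (a b a' b' : R) (f : R -> R) : a <= a' -> b' <= b ->
  cont_on a b f -> cont_on a' b' f.
Proof.
move=> aa' bb' cf p /andP[h1 h2]; apply: cf.
by rewrite (le_trans aa' h1) (le_trans h2 bb').
Qed.

Lemma Rintegral_split (a b c : R) (f : R -> R) : a <= b -> b <= c ->
  cont_on a c f ->
  \int[mu]_(x in `[a, c]) f x =
  \int[mu]_(x in `[a, b]) f x + \int[mu]_(x in `[b, c]) f x.
Proof.
move=> ab bc cf.
have := @Rintegral_itvB R f (BLeft a) (BRight c) b (cont_on_integrable cf).
rewrite !bnd_simp => /(_ ab bc) H.
rewrite -[LHS](subrK (\int[mu]_(x in `[a, b]) f x)) H addrC; congr (_ + _).
apply: Rintegral_itv_obnd_cbnd.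
apply: (integrableS _ _ _ (cont_on_integrable cf)) => //.
by apply: subset_itvr; rewrite bnd_simp.
Qed.

Lemma Rintegral_sub (a b a' b' : R) (f : R -> R) : a <= a' -> a' <= b' -> b' <= b ->
  cont_on a b f -> (forall x, a <= x <= b -> 0 <= f x) ->
  \int[mu]_(x in `[a', b']) f x <= \int[mu]_(x in `[a, b]) f x.
Proof.
move=> aa ab bb cf f0.
rewrite (Rintegral_split aa (le_trans ab bb) cf).
rewrite (Rintegral_split ab bb); last exact: (cont_on_sub aa (lexx b) cf).
rewrite addrCA lerDl addr_ge0// Rintegral_ge0// => x /=; rewrite in_itv/= => /andP[h1 h2].
  by apply: f0; rewrite h1 (le_trans h2)// (le_trans ab).
by apply: f0; rewrite h2 andbT (le_trans _ h1)// (le_trans aa).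
Qed.

Lemma Rintegral_cst_segment (a b k : R) : a < b ->
  \int[mu]_(x in `[a, b]) k = k * (b - a).
Proof.
move=> ab.
have dk (x : R) : is_derive x 1 (fun x => k * x) k.
  apply: (is_derive_eqr (is_derive_mul (is_derive_cstr k x) (is_derive_idr x))).
  by rewrite mul0r addr0 mulr1.
by rewrite (FTC_segment ab (@cont_on_cst _ a b k) (fun x _ => dk x)) mulrBr.
Qed.

Lemma sin_le (x : R) : 0 <= x -> sin x <= x.
Proof.
move=> x0; rewrite -subr_ge0.
apply: (@ge0_of_derive_ge0 R (fun x => x - sin x) (fun x => 1 - cos x)) => //.
by rewrite sin0 subrr.
Qed.

(** For positive [eta] this is 1 where [sin p >= expR (- 1 / eta)] and 0 where
    [sin p <= expR (- 2 / eta)]. The logarithm makes the energy weighted by [sin] of order [eta]: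
    for this weight the end points have zero capacity. *)
Definition chi (eta p : R) : R := step (2 + eta * ln (sin p)).
Definition dchi (eta p : R) : R :=
  derive1 step (2 + eta * ln (sin p)) * (eta * (cos p / sin p)).

Lemma is_derive_chi eta p : 0 < sin p -> is_derive p 1 (chi eta) (dchi eta p).
Proof.
move=> s0.
have d1 : is_derive p 1 (fun p => ln (sin p)) ((sin p)^-1 * cos p).
  exact: (is_derive1_comp (is_derive1_ln s0) (is_derive_sin p)).
have d2 : is_derive p 1 (fun p => 2 + eta * ln (sin p)) (eta * (cos p / sin p)).
  apply: (is_derive_eqr (is_derive_add (is_derive_cstr 2 p)
    (is_derive_mul (is_derive_cstr eta p) d1))).
  by rewrite mul0r addr0 add0r [cos p / _]mulrC.
exact: (is_derive1_comp (Coo1_is_derive Coo1_step I) d2).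
Qed.

Lemma continuous_dchi eta p : 0 < sin p -> {for p, continuous (dchi eta)}.
Proof.
move=> s0.
have cs := @continuous_sin R p.
have cls : {for p, continuous (fun p => 2 + eta * ln (sin p))}.
  apply: cvgD; first exact: cvg_cst.
  apply: cvgM; first exact: cvg_cst.
  apply: (@continuous_comp _ _ _ (@sin R) (@ln R)); first exact: cs.
  exact: continuous_ln.
have cst' : {for p, continuous (fun p => derive1 step (2 + eta * ln (sin p)))}.
  apply: (@continuous_comp _ _ _ (fun p => 2 + eta * ln (sin p)) (derive1 (@step R))) => //.
  by apply: Coo1_cont; apply: Coo1_derive; exact: Coo1_step.
have sn : sin p != 0 by rewrite lt0r_neq0.
exact: (cvgM cst' (cvgM (cvg_cst eta) (cvgM (@continuous_cos R p) (cvgV sn cs)))).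
Qed.

Lemma chi_ge0 eta p : 0 <= chi eta p. Proof. exact: step_ge0. Qed.
Lemma chi_le1 eta p : chi eta p <= 1. Proof. exact: step_le1. Qed.

Lemma chi_eq0 eta p : 2 + eta * ln (sin p) < 0 -> chi eta p = 0 /\ dchi eta p = 0.
Proof.
move=> h; split; first by rewrite /chi step_le0// ltW.
rewrite /dchi derive1E (near_eq_derive (g := cst (0 : R))).
  by rewrite derive_cst mul0r.
by near=> z; rewrite step_le0// ltW//; near: z; exact: lt_nbhsl.
Unshelve. all: by end_near. Qed.

(** [dchi^2 sin] equals the derivative of [step], which lies in [[0, C]], times [eta cos dchi]. The
    square is thus traded for a first power, whose integral against [cos] is computed by parts. The
    second bound serves the cross term. *)
Lemma dchi_sqr_bound (C eta p : R) : 0 <= eta -> 0 < sin p ->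
  (forall x, derive1 step x <= C) ->
  dchi eta p ^+ 2 * sin p <= C * eta * (cos p * dchi eta p) /\
  `|dchi eta p| * sin p <= C * eta.
Proof.
move=> eta0 s0 HC; rewrite /dchi; set S := derive1 step _.
have S0 : 0 <= S := step_derive_ge0 _.
have SC : S <= C := HC _.
have sn : sin p != 0 by rewrite lt0r_neq0.
split.
  have -> : (S * (eta * (cos p / sin p))) ^+ 2 * sin p =
    S * (eta * (eta * S * cos p ^+ 2 / sin p)) by field.
  have -> : C * eta * (cos p * (S * (eta * (cos p / sin p)))) =
    C * (eta * (eta * S * cos p ^+ 2 / sin p)) by field.
  apply: ler_wpM2r => //; apply: mulr_ge0 => //.
  apply: divr_ge0; last exact: ltW.
  by apply: mulr_ge0; [exact: mulr_ge0|exact: sqr_ge0].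
rewrite !normrM normfV (gtr0_norm s0) (ger0_norm S0) (ger0_norm eta0).
have -> : S * (eta * (`|cos p| / sin p)) * sin p = S * eta * `|cos p| by field.
apply: (@le_trans _ _ (S * eta)); last by rewrite ler_wpM2r.
rewrite ler_piMr ?mulr_ge0// ler_norml cos_geN1 cos_le1//.
Qed.

End angular_cutoff.

(** * Energy of the truncated angular function *)

Section angular_cutoff_estimate.
Context {R : realType}.
Notation mu := (@lebesgue_measure R).
Variable y : R -> R.
Hypothesis Cy : Coo1 setT y.

Definition Ycut (eta p : R) : R := y p * chi eta p.
Definition dYcut (eta p : R) : R := derive1 y p * chi eta p + y p * dchi eta p.

Lemma is_derive_Ycut (eta p : R) : 0 < sin p ->
  is_derive p 1 (Ycut eta) (dYcut eta p).
Proof.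
move=> s0; have dy := Coo1_is_derive Cy (I : setT p).
apply: (is_derive_eqr (is_derive_mul dy (@is_derive_chi _ eta p s0))).
by rewrite /dYcut addrC.
Qed.

Lemma continuous_chi (eta p : R) : 0 < sin p -> {for p, continuous (chi eta)}.
Proof.
move=> s0; have /derivable1_diffP : derivable (chi eta) p 1.
  by have [] := @is_derive_chi _ eta p s0.
exact: differentiable_continuous.
Qed.

Lemma continuous_Ycut (eta p : R) : 0 < sin p -> {for p, continuous (Ycut eta)}.
Proof.
move=> s0; have cy : {for p, continuous y} by exact: (Coo1_cont Cy).
have h : {for p, continuous (fun q => y q * chi eta q)}.
  exact: (cvgM cy (@continuous_chi eta p s0)).
exact: h.
Qed.

Lemma continuous_dYcut (eta p : R) : 0 < sin p -> {for p, continuous (dYcut eta)}.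
Proof.
move=> s0.
have cy' : {for p, continuous (derive1 y)} by exact: (Coo1_cont (Coo1_derive Cy)).
have cy : {for p, continuous y} by exact: (Coo1_cont Cy).
have h : {for p, continuous (fun q => derive1 y q * chi eta q + y q * dchi eta q)}.
  exact: (cvgD (cvgM cy' (@continuous_chi eta p s0)) (cvgM cy (@continuous_dchi _ eta p s0))).
exact: h.
Qed.

Lemma bound_segment (f : R -> R) : continuous f ->
  exists2 C : R, 0 <= C & forall p, 0 <= p <= pi -> `|f p| <= C.
Proof.
move=> cf; have cnf : {within `[0, pi], continuous (fun p => `|f p|)}.
  apply: continuous_subspaceT => p; apply: continuous_comp; first exact: cf.
  exact: norm_continuous.
have [c _ Hc] := EVT_max (pi_ge0 R) cnf.
by exists `|f c| => // p pI; apply: Hc; rewrite in_itv.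
Qed.

Definition cut_num (eta p : R) : R := (dYcut eta p ^+ 2 + 4^-1 * Ycut eta p ^+ 2) * sin p.

(** The letters are values at one angle: [Y], [Y'] those of [y] and its derivative, [X], [X'] those
    of the cutoff, [S] the sine and [G] the product of the cosine with [X']. The square is expanded
    and its terms are bounded one by one. *)
Lemma cut_pointwise (Y Y' X X' S C0 C1 C eta G : R) :
  0 <= C0 -> 0 <= C1 -> 0 <= C -> 0 <= eta -> 0 <= S -> 0 <= X -> X <= 1 ->
  X' ^+ 2 * S <= C * eta * G -> `|X'| * S <= C * eta ->
  `|Y'| <= C1 -> `|Y| <= C0 ->
  ((Y' * X + Y * X') ^+ 2 + 4^-1 * (Y * X) ^+ 2) * S <=
  (Y' ^+ 2 + 4^-1 * Y ^+ 2) * S + 2 * C0 * C1 * C * eta + C0 ^+ 2 * C * eta * G.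
Proof.
move=> C00 C10 Cg e0 s1 x0 x1 T1 T2 hY' hY.
have Y2 : Y ^+ 2 <= C0 ^+ 2.
  by rewrite -[Y ^+ 2]real_normK ?num_real// lerXn2r// nnegrE.
have X2 : X ^+ 2 <= 1 by rewrite expr_le1.
have A1 : Y' ^+ 2 * X ^+ 2 * S <= Y' ^+ 2 * S.
  by apply: ler_wpM2r => //; apply: ler_piMr => //; exact: sqr_ge0.
have A2 : 4^-1 * (Y * X) ^+ 2 * S <= 4^-1 * Y ^+ 2 * S.
  apply: ler_wpM2r => //.
  rewrite exprMn; apply: ler_wpM2l; first by rewrite invr_ge0.
  by apply: ler_piMr => //; exact: sqr_ge0.
have A3 : Y ^+ 2 * X' ^+ 2 * S <= C0 ^+ 2 * C * eta * G.
  have -> : C0 ^+ 2 * C * eta * G = C0 ^+ 2 * (C * eta * G) by ring.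
  rewrite -mulrA; apply: ler_pM => //; first exact: sqr_ge0.
  by apply: mulr_ge0 => //; exact: sqr_ge0.
have A4 : 2 * (Y' * X) * (Y * X') * S <= 2 * C0 * C1 * C * eta.
  have -> : 2 * C0 * C1 * C * eta = 2 * (C1 * 1 * C0 * (C * eta)) by ring.
  have -> : 2 * (Y' * X) * (Y * X') * S = 2 * (Y' * X * Y * (X' * S)) by ring.
  rewrite ler_wpM2l//; apply: (le_trans (ler_norm _)).
  rewrite !normrM (ger0_norm x0) (ger0_norm s1).
  apply: ler_pM => //.
  - by rewrite !mulr_ge0.
  - by rewrite mulr_ge0.
  - by apply: ler_pM => //; [rewrite mulr_ge0|apply: ler_pM].
have -> : ((Y' * X + Y * X') ^+ 2 + 4^-1 * (Y * X) ^+ 2) * S =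
  Y' ^+ 2 * X ^+ 2 * S + 4^-1 * (Y * X) ^+ 2 * S + 2 * (Y' * X) * (Y * X') * S +
  Y ^+ 2 * X' ^+ 2 * S by ring.
have -> : (Y' ^+ 2 + 4^-1 * Y ^+ 2) * S = Y' ^+ 2 * S + 4^-1 * Y ^+ 2 * S by ring.
apply: lerD A3; apply: lerD A4; exact: lerD.
Qed.

(** The slack [s] in the strict inequality pays for two losses, each at most [s / 3]: the mass of
    [y] within [m1] of the end points, and the energy added by the cutoff. *)
Lemma angular_cutoff (c : R) : 0 < c -> rayleigh_num y < c * rayleigh_den y ->
  exists eta m : R, [/\ 0 < eta, 0 < m, m < pi - m,
    forall p, 0 < p < pi -> p <= m \/ pi - m <= p -> 2 + eta * ln (sin p) < 0 &
    \int[mu]_(p in `[m, pi - m]) cut_num eta p <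
    c * \int[mu]_(p in `[m, pi - m]) (Ycut eta p ^+ 2)].
Proof.
move=> c0 Hc.
have cy := Coo1_cont Cy; have cy' := Coo1_cont (Coo1_derive Cy).
have [C0 C00 HC0] := bound_segment cy.
have [C1 C10 HC1] := bound_segment cy'.
have [C Cgt0 HC] := @step_derive_bound R.
have pi2 := @pi_ge2 R.
set s := c * rayleigh_den y - rayleigh_num y.
have s0 : 0 < s by rewrite subr_gt0.
(* The cutoff will be 1 on [[m1, pi - m1]], so the mass lost is at most [2 * m1 * C0 ^+ 2]; [c]
   times this is to be at most [s / 3]. *)
pose m1 := Num.min (2^-1) (s / (6 * c * (C0 ^+ 2 + 1))).
have den0 : 0 < 6 * c * (C0 ^+ 2 + 1).
  by rewrite mulr_gt0 ?mulr_gt0// ltr_wpDl// sqr_ge0.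
have m10 : 0 < m1 by rewrite lt_min invr_gt0 ltr0n divr_gt0.
have m1half : m1 <= 2^-1 by rewrite ge_min lexx.
have m1s : c * (2 * m1 * C0 ^+ 2) <= s / 3.
  have : m1 <= s / (6 * c * (C0 ^+ 2 + 1)) by rewrite ge_min lexx orbT.
  rewrite ler_pdivlMr// => h.
  have : c * (6 * m1 * C0 ^+ 2) <= s.
    apply: le_trans h.
    have -> : m1 * (6 * c * (C0 ^+ 2 + 1)) = c * (6 * m1 * C0 ^+ 2) + 6 * m1 * c by ring.
    by rewrite lerDl mulr_ge0 ?mulr_ge0 ?ltW.
  have -> : c * (6 * m1 * C0 ^+ 2) = 3 * (c * (2 * m1 * C0 ^+ 2)) by ring.
  by rewrite ler_pdivlMr// mulrC.
have m1I : 0 < m1 < pi by rewrite m10/=; lra.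
have sm1 : 0 < sin m1 by exact: sin_gt0_pi.
have lm1 : ln (sin m1) <= 0 by rewrite ln_le0// sin_le1.
(* The energy added by the cutoff will be at most [k * eta]. *)
pose k := pi * (C * (2 * C0 * C1 + C0 ^+ 2)).
have k0 : 0 <= k.
  apply: mulr_ge0; first exact: pi_ge0.
  apply: mulr_ge0; first exact: ltW.
  by apply: addr_ge0; [apply: mulr_ge0 => //; exact: mulr_ge0|exact: sqr_ge0].
(* The first bound gives [k * eta <= s / 3]; the second gives [eta * ln (sin m1) >= -1], so that the
   cutoff equals 1 from [m1] on. *)
pose eta := Num.min (s / (3 * (k + 1))) ((1 - ln (sin m1))^-1).
have l1 : 0 < 1 - ln (sin m1) by rewrite subr_gt0 (le_lt_trans lm1).
have k1 : 0 < 3 * (k + 1) by rewrite mulr_gt0// ltr_wpDl.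
have eta0 : 0 < eta by rewrite lt_min divr_gt0//= invr_gt0.
have etak : k * eta <= s / 3.
  have : eta <= s / (3 * (k + 1)) by rewrite ge_min lexx.
  rewrite ler_pdivlMr// => h; rewrite ler_pdivlMr//; apply: le_trans h.
  have -> : eta * (3 * (k + 1)) = k * eta * 3 + 3 * eta by ring.
  by rewrite lerDl mulr_ge0// ltW.
have etal : -1 <= eta * ln (sin m1).
  have : eta <= (1 - ln (sin m1))^-1 by rewrite ge_min lexx orbT.
  rewrite -[_^-1]mul1r ler_pdivlMr// mulrBr mulr1 => h.
  by move: (eta * ln (sin m1)) h => z h; lra.
(* As [sin p <= p], the argument of [step] is negative for [p <= m]. The factor [1 / 2] makes the
   inequality strict, so that the cutoff also vanishes near [m]. *)
pose m := Num.min m1 (expR (- (2 / eta)) / 2).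
have m0 : 0 < m by rewrite lt_min m10/= divr_gt0// expR_gt0.
have mm1 : m <= m1 by rewrite ge_min lexx.
have mexp : m < expR (- (2 / eta)).
  apply: (@le_lt_trans _ _ (expR (- (2 / eta)) / 2)); first by rewrite ge_min lexx orbT.
  by rewrite ltr_pdivrMr// ltr_pMr ?expR_gt0// ltr1n.
have mpi : m < pi - m by lra.
have near0 p : 0 < p < pi -> p <= m -> 2 + eta * ln (sin p) < 0.
  move=> pI pm; have sp : 0 < sin p by exact: sin_gt0_pi.
  have sl : sin p < expR (- (2 / eta)).
    by apply: le_lt_trans (le_lt_trans pm mexp); apply: sin_le; case/andP: pI => /ltW.
  have : ln (sin p) < - (2 / eta).
    by rewrite -[X in _ < X]expRK ltr_ln// posrE expR_gt0.
  rewrite -(ltr_pM2l eta0); have -> : eta * - (2 / eta) = - 2.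
    by field; exact: lt0r_neq0.
  by move: (eta * _) => z; lra.
have out p : 0 < p < pi -> p <= m \/ pi - m <= p -> 2 + eta * ln (sin p) < 0.
  move=> pI [pm|pm]; first exact: near0.
  have -> : sin p = sin (pi - p).
    by rewrite sinB sinpi cospi mul0r mulN1r sub0r opprK.
  by apply: near0; [case/andP: pI => *; apply/andP; split; lra|lra].
have cut0 p : 0 < p < pi -> p <= m \/ pi - m <= p -> chi eta p = 0.
  by move=> pI pm; have [] := chi_eq0 (out p pI pm).
exists eta, m; split => //.
have sI p : m <= p <= pi - m -> 0 < sin p.
  by move=> /andP[h1 h2]; apply: sin_gt0_pi; apply/andP; split; lra.
have pI p : m <= p <= pi - m -> 0 <= p <= pi.
  by move=> /andP[h1 h2]; apply/andP; split; lra.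
have cY2 : cont_on m (pi - m) (fun p => Ycut eta p ^+ 2).
  by move=> p /sI s1; apply: continuous_sq; exact: continuous_Ycut.
have ccut : cont_on m (pi - m) (cut_num eta).
  move=> p /sI s1.
  have cY := continuous_sq (@continuous_Ycut eta p s1).
  have cdY := continuous_sq (@continuous_dYcut eta p s1).
  have h : {for p, continuous
      (fun q => (dYcut eta q ^+ 2 + 4^-1 * Ycut eta q ^+ 2) * sin q)}.
    exact: (cvgM (cvgD cdY (cvgM (cvg_cst _) cY)) (@continuous_sin R p)).
  exact: h.
have cn := cont_num_density Cy.
pose G p := cos p * dchi eta p.
have cG : cont_on m (pi - m) G.
  by move=> p /sI s1; exact: (cvgM (@continuous_cos R p) (@continuous_dchi _ eta p s1)).
have csc : cont_on m (pi - m) (fun p => sin p * chi eta p).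
  by move=> p /sI s1; exact: (cvgM (@continuous_sin R p) (@continuous_chi eta p s1)).
(* Integration by parts: [chi] vanishes at both ends. *)
have IG : \int[mu]_(p in `[m, pi - m]) G p <= pi.
  have dF p : m <= p <= pi - m -> is_derive p 1 (fun p => cos p * chi eta p)
      (G p + -1 * (sin p * chi eta p)).
    move=> /sI s1.
    apply: (is_derive_eqr (is_derive_mul (is_derive_cos p) (@is_derive_chi _ eta p s1))).
    by rewrite /G; ring.
  have cF : cont_on m (pi - m) (fun p => G p + -1 * (sin p * chi eta p)).
    by apply: cont_onD => //; apply: cont_onM => //; exact: cont_on_cst.
  have := FTC_segment mpi cF dF.
  have e1 : chi eta m = 0 by apply: cut0; [lra|left].
  have e2 : chi eta (pi - m) = 0 by apply: cut0; [lra|right].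
  rewrite e1 e2 !mulr0 subrr RintegralD_cont//; last first.
    by apply: cont_onM => //; exact: cont_on_cst.
  rewrite RintegralZ_cont// mulN1r => /eqP; rewrite subr_eq0 => /eqP ->.
  apply: (@le_trans _ _ (\int[mu]_(p in `[m, pi - m]) 1)).
    apply: le_Rintegral_cont => //; first exact: cont_on_cst.
    move=> p /sI s1; apply: mulr_ile1.
    - exact: ltW.
    - exact: chi_ge0.
    - exact: sin_le1.
    - exact: chi_le1.
  by rewrite Rintegral_cst_segment//; lra.
(* [cut_pointwise] is integrated: [K] is the constant excess over a segment of length at most [pi],
   and [L] multiplies the integral of [G], itself at most [pi] by [IG]. *)
have upper : \int[mu]_(p in `[m, pi - m]) cut_num eta p <= rayleigh_num y + k * eta.
  pose K := 2 * C0 * C1 * C * eta; pose L := C0 ^+ 2 * C * eta.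
  have K0 : 0 <= K.
    have := ltW Cgt0; have := ltW eta0; rewrite /K => e0 c1; do 4?apply: mulr_ge0 => //.
  have L0 : 0 <= L.
    have := ltW Cgt0; have := ltW eta0; rewrite /L => e0 c1; do 2?apply: mulr_ge0 => //; exact: sqr_ge0.
  have cn' : cont_on m (pi - m) (num_density y) by exact: cont_onT.
  have cLG : cont_on m (pi - m) (fun p => L * G p).
    by apply: cont_onM => //; exact: cont_on_cst.
  have cK : cont_on m (pi - m) (fun=> K) by exact: cont_on_cst.
  have cnK : cont_on m (pi - m) (fun p => num_density y p + K) by exact: cont_onD.
  have cnKL : cont_on m (pi - m) (fun p => num_density y p + K + L * G p).
    exact: cont_onD.
  apply: (le_trans (le_Rintegral_cont ccut cnKL _)).
    move=> p pm; have s1 := sI p pm.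
    have [T1 T2] := dchi_sqr_bound (ltW eta0) s1 HC.
    rewrite /cut_num /num_density /dYcut /Ycut !real_normK ?num_real//.
    have := HC0 p (pI p pm); have := HC1 p (pI p pm).
    have x0 := chi_ge0 eta p; have x1 := chi_le1 eta p.
    move=> hY' hY; exact: (cut_pointwise C00 C10 (ltW Cgt0) (ltW eta0) (ltW s1) x0 x1 T1 T2 hY' hY).
  rewrite !RintegralD_cont// RintegralZ_cont// Rintegral_cst_segment//.
  have n1 : \int[mu]_(p in `[m, pi - m]) num_density y p <= rayleigh_num y.
    apply: Rintegral_sub => //; [exact: ltW|exact: ltW|lra|exact: cont_onT|].
    move=> p /sin_ge0_pi sp; rewrite /num_density; apply: mulr_ge0 => //.
  have n2 : K * (pi - m - m) <= K * pi by rewrite ler_wpM2l//; lra.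
  have n3 : L * \int[mu]_(p in `[m, pi - m]) G p <= L * pi by rewrite ler_wpM2l.
  have -> : k * eta = K * pi + L * pi by rewrite /k /K /L; ring.
  by rewrite addrA lerD// lerD.
(* On [[m1, pi - m1]] the truncated function is [y]; each of the two remaining pieces of the
   denominator is at most [C0 ^+ 2 * m1]. *)
have lower : rayleigh_den y - 2 * m1 * C0 ^+ 2 <=
    \int[mu]_(p in `[m, pi - m]) (Ycut eta p ^+ 2).
  have mm1' : m1 <= pi - m1 by lra.
  apply: le_trans (Rintegral_sub mm1 mm1' _ cY2 _); last 2 first.
  - lra.
  - by move=> p _; exact: sqr_ge0.
  have chi1 p : m1 <= p <= pi - m1 -> chi eta p = 1.
    move=> /andP[p1 p2]; rewrite /chi step_ge1//.
    have sm : sin m1 <= sin p.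
      have mono a : m1 <= a -> a <= pi / 2 -> sin m1 <= sin a.
        move=> h1 h2; rewrite le_eqVlt; have [->|am] := eqVneq m1 a; first by rewrite eqxx.
        apply/orP; right; rewrite ltr_sin; first by rewrite lt_neqAle am.
          by rewrite in_itv/=; apply/andP; split; lra.
        by rewrite in_itv/=; apply/andP; split; lra.
      have [ph|ph] := leP p (pi / 2); first exact: mono.
      have -> : sin p = sin (pi - p) by rewrite sinB sinpi cospi mul0r mulN1r sub0r opprK.
      by apply: mono; lra.
    have : ln (sin m1) <= ln (sin p).
      by rewrite ler_ln// posrE// (lt_le_trans sm1).
    move=> h; have := le_trans etal (ler_wpM2l (ltW eta0) h); lra.
  have cd := cont_sqr cy.
  have cd' a b : cont_on a b (fun p => `|y p| ^+ 2) by exact: cont_onT.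
  rewrite /rayleigh_den (Rintegral_split (ltW m10) _ (cd' 0 pi)); last by lra.
  rewrite (Rintegral_split mm1' _ (cd' m1 pi)); last by lra.
  have b1 a b : 0 <= a -> a < b -> b <= pi ->
      \int[mu]_(p in `[a, b]) (`|y p| ^+ 2) <= C0 ^+ 2 * (b - a).
    move=> a0 ab bpi; rewrite -Rintegral_cst_segment//; apply: le_Rintegral_cont => //.
      exact: cont_on_cst.
    move=> p /andP[h1 h2]; rewrite lerXn2r ?nnegrE//; apply: HC0.
    by rewrite (le_trans a0 h1) (le_trans h2).
  have -> : \int[mu]_(p in `[m1, pi - m1]) (Ycut eta p ^+ 2) =
      \int[mu]_(p in `[m1, pi - m1]) (`|y p| ^+ 2).
    apply: eq_Rintegral => p; rewrite inE/= in_itv/= => pm.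
    by rewrite /Ycut chi1// mulr1 real_normK ?num_real.
  have := b1 0 m1 (lexx _) m10; have := b1 (pi - m1) pi; rewrite subr0.
  have -> : pi - (pi - m1) = m1 by rewrite opprB addrC subrK.
  move=> h2 h1.
  have {}h1 : \int[mu]_(p in `[0, m1]) (`|y p| ^+ 2) <= C0 ^+ 2 * m1 by apply: h1; lra.
  have {}h2 : \int[mu]_(p in `[(pi - m1), pi]) (`|y p| ^+ 2) <= C0 ^+ 2 * m1.
    by apply: h2; lra.
  lra.
apply: (le_lt_trans upper).
apply: (@lt_le_trans _ _ (c * (rayleigh_den y - 2 * m1 * C0 ^+ 2))); last first.
  by rewrite ler_wpM2l// ltW.
rewrite mulrBr; have -> : c * rayleigh_den y = s + rayleigh_num y by rewrite /s subrK.
lra.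
Qed.

End angular_cutoff_estimate.

(** * Radial integrals in the logarithmic variable *)

Section one_dimensional_integrals.
Context {R : realType}.
Notation mu := (@lebesgue_measure R).
Local Notation mR := (measurableTypeR R).

Lemma integral_supported (A : set mR) (a b : R) (h : R -> R) :
  `[a, b]%classic `<=` A -> (forall x, A x -> ~ (a <= x <= b) -> h x = 0) ->
  cont_on a b h ->
  (\int[mu]_(x in A) (h x)%:E = (\int[mu]_(x in `[a, b]) h x)%R%:E)%E.
Proof.
move=> abA h0 ch; rewrite (integral_sub0 abA) ?integral_cont_on// => x Ax.
by rewrite /= in_itv/= => /(h0 x Ax) ->.
Qed.

(** The variable [x = d * ln r + k] turns [dr / r] into [dx / d]. *)
Lemma radial_integral (d k : R) (h : R -> R) : 0 < d -> continuous h ->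
  (forall x, 0 <= h x) -> (forall x, ~ (0 <= x <= 3) -> h x = 0) ->
  (\int[mu]_(r in `]0%R, +oo[) (r^-1 * h (d * ln r + k))%:E =
   (d^-1 * \int[mu]_(x in `[0, 3]) h x)%R%:E)%E.
Proof.
move=> d0 ch h0 h3; have dn0 : d != 0 by exact: lt0r_neq0.
have I (x : R) : (`]0, +oo[%classic : set R) x <-> 0 < x by rewrite /= in_itv/= andbT.
pose F x : R := expR ((x - k) / d).
have F_le x y : (F x <= F y) = (x <= y).
  by rewrite ler_expR ler_pM2r ?invr_gt0// lerD2r.
have FK (y : R) : 0 < y -> F (d * ln y + k) = y.
  by move=> y0; rewrite /F addrK mulrAC mulfV// mul1r lnK.
have KF x : d * ln (F x) + k = x by rewrite /F expRK mulrC divfK// subrK.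
have cover (x : R) : exists n : nat, - n%:R <= x <= n%:R.
  have nP : `|x| < (Num.truncn `|x|).+1%:R :> R.
    by apply: truncnS_gt.
  by exists (Num.truncn `|x|).+1; rewrite -ler_norml ltW.
have dF (x : R) : is_derive x 1 F (F x * d^-1).
  have dx : is_derive x 1 (fun z : R => (z - k) * d^-1) d^-1.
    have dz : is_derive x 1 (fun z : R => z + (- k)) (1 + 0).
      exact: (is_derive_add (is_derive_idr x) (is_derive_cstr (- k) x)).
    apply: (is_derive_eqr (is_derive_mul dz (is_derive_cstr d^-1 x))).
    by rewrite mulr0 add0r addr0 mul1r.
  exact: (is_derive1_comp (is_derive_expR _) dx).
have cF : continuous F.
  move=> x; have /derivable1_diffP : derivable F x 1 by have [] := dF x.
  exact: differentiable_continuous.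
rewrite (@ge0_substitution R setT `]0, +oo[%classic F (fun x => F x * d^-1)
  (fun r => r^-1 * h (d * ln r + k)) (fun n => - n%:R) (fun n => n%:R)).
- have -> : (fun x => ((F x)^-1 * h (d * ln (F x) + k) * (F x * d^-1))%:E) =
      (fun x => (d^-1 * h x)%:E).
    apply/funext => x; rewrite KF; congr EFin.
    by have := expR_gt0 ((x - k) / d); rewrite -/(F x) => Fx; field; rewrite dn0 lt0r_neq0.
  rewrite (@integral_supported setT 0 3) => //.
  + by rewrite RintegralZ_cont//; exact: cont_onT.
  + by move=> x _ /h3 ->; rewrite mulr0.
  + by apply: cont_onM; [exact: cont_on_cst|exact: cont_onT].
- exact: openT.
- by move=> n; rewrite (@le_trans _ _ 0)// oppr_le0.
- by move=> n m nm; rewrite lerN2 !ler_nat.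
- apply/seteqP; split=> x // _; have [n xn] := cover x.
  by exists n; rewrite //= in_itv.
- apply/seteqP; split=> y.
    move=> /I y0; have [n /andP[xn nx]] := cover (d * ln y + k).
    by exists n => //=; rewrite in_itv/= -(FK y y0) !F_le xn nx.
  move=> [n _]; rewrite /= !in_itv/= andbT => /andP[+ _].
  by apply: lt_le_trans; exact: expR_gt0.
- by move=> x y _ _ xy; rewrite ltr_expR ltr_pM2r ?invr_gt0// ltrD2r.
- by move=> x _; exact: (cvgM (cF x) (cvg_cst _)).
- by move=> x _; rewrite mulr_ge0 ?expR_ge0// invr_ge0 ltW.
- move=> y /I y0; have cl : {for y, continuous (fun r => d * ln r + k)}.
    exact: (cvgD (cvgM (cvg_cst _) (continuous_ln y0)) (cvg_cst _)).
  have yn : y != 0 by exact: lt0r_neq0.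
  have ci := inv_continuous yn.
  have chl : {for y, continuous (fun r => h (d * ln r + k))}.
    exact: (continuous_comp cl (ch _)).
  exact: (cvgM ci chl).
- by move=> y /I y0; rewrite mulr_ge0// invr_ge0 ltW.
Qed.

Local Notation A := (`]0, +oo[%classic : set mR).
Local Notation B := (`]0, pi[%classic : set mR).

Lemma iint_product (F K : R -> R) (a b : R) :
  measurable_fun A F -> measurable_fun B K ->
  (forall r, A r -> 0 <= F r) -> (forall p, B p -> 0 <= K p) ->
  (\int[mu]_(r in A) (F r)%:E = a%:E)%E -> (\int[mu]_(p in B) (K p)%:E = b%:E)%E ->
  iint A B (fun r p => F r * K p) = (a * b)%:E.
Proof.
move=> mF mK F0 K0 Fa Kb; have b0 : 0 <= b.
  by rewrite -lee_fin -Kb integral_ge0.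
rewrite /iint; transitivity (\int[mu]_(r in A) ((F r)%:E * b%:E))%E.
  apply: eq_integral => r /set_mem rA; rewrite -Kb.
  under eq_integral do rewrite EFinM.
  rewrite ge0_integralZl//.
  - exact/measurable_EFinP.
  - by rewrite lee_fin; exact: F0.
rewrite ge0_integralZr//; first by rewrite Fa EFinM.
- exact/measurable_EFinP.
Qed.

End one_dimensional_integrals.

(** * Integrals of products over the half-space *)

Section tensor_integrals.
Context {R : realType} {n : nat}.
Notation mu := (@lebesgue_measure R).
Local Notation mR := (measurableTypeR R).
Local Notation rV := 'rV[R]_n.+2.
Local Notation half := (half_space R n).
Local Notation A := (`]0, +oo[%classic : set mR).
Local Notation B := (`]0, pi[%classic : set mR).

Definition tensor (h : nat -> R -> R) (y : rV) : R := \prod_(i < n) h i (y 0 (inord i)).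
Definition planar (phi : R -> R -> R) (y : rV) : R := phi (xpenult y) (xlast y).

Lemma integral_tensor_half (h : nat -> R -> R) (G : nat -> R) (phi : R -> R -> R) :
  (forall i, continuous (h i)) -> (forall i x, 0 <= h i x) ->
  (forall i, \int[mu]_x (h i x)%:E = (G i)%:E)%E ->
  cont_half (planar phi) -> ge0_half (planar phi) ->
  integral_rv half (fun y => tensor h y * planar phi y) =
  ((\prod_(i < n) G i)%:E *
   iint A B (fun r p => r * phi (- (r * cos p)) (r * sin p))%R)%E.
Proof.
move=> ch h0 hG cp p0; rewrite integral_rv_pf.
(* The planar factor depends on the last two coordinates only, so any values may be given to the
   others in order to view it as a function of two variables. *)
pose x0 : n.-tuple mR := [tuple of nseq n 0].
pose H (z : mR * mR) : \bar R := (pf (planar phi) (pnt x0 z.1 z.2))%:E.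
transitivity (\int[lebesgue_tuple R n.+2]_t
    ((\prod_(i < n) h i (nth 0%R t i))%:E * H (nth 0%R t n, nth 0%R t n.+1)))%E.
  apply: eq_integral => t _; rewrite /H -EFinM /pf xlast_pnt /planar xlast_pnt xpenult_pnt.
  have tE (i : nat) : (i < n.+2)%N -> rv_of_tuple t 0 (inord i) = nth 0 t i.
    by move=> ilt; rewrite rv_of_tuple_inE (tnth_nth 0) inordK.
  have -> : xlast (rv_of_tuple t) = nth 0 t n.+1.
    by rewrite /xlast rv_of_tuple_inE (tnth_nth 0).
  have -> : xpenult (rv_of_tuple t) = nth 0 t n by exact: tE.
  have -> : tensor h (rv_of_tuple t) = \prod_(i < n) h i (nth 0 t i).
    by apply: eq_bigr => i _; rewrite tE// (leq_trans (ltn_ord i))// leqW.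
  by case: ifP => _ //; rewrite mulr0.
rewrite (@integral_tensor R n h G H) //.
- congr (_ * _)%E; rewrite /H /= slice_polar//; apply: eq_integral => r _.
  by apply: eq_integral => p _; rewrite /planar xpenult_pnt xlast_pnt.
- by move=> i; exact: continuous_measurable_fun.
- apply/measurable_EFinP.
  exact: (measurableT_comp (measurable_pf cp) (measurable_tcat2 x0)).
- by move=> z; rewrite lee_fin; exact: pf_ge0.
Qed.

(** When [phi] times the polar Jacobian separates into a radial part, written in the variable
    [d * ln r + k], and an angular part, the whole integral is a product of one-dimensional ones.
    All the integrals of the test function are obtained in this way. *)
Lemma integral_tensor_polar (h : nat -> R -> R) (G : nat -> R) (phi : R -> R -> R)
    (d k m : R) (g K : R -> R) :
  (forall i, continuous (h i)) -> (forall i x, 0 <= h i x) ->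
  (forall i, \int[mu]_x (h i x)%:E = (G i)%:E)%E ->
  cont_half (planar phi) -> ge0_half (planar phi) ->
  0 < d -> continuous g -> (forall x, 0 <= g x) ->
  (forall x, ~ (0 <= x <= 3) -> g x = 0) ->
  0 < m -> (forall p, 0 < p < pi -> {for p, continuous K}) ->
  (forall p, 0 < p < pi -> 0 <= K p) ->
  (forall p, 0 < p < pi -> ~ (m <= p <= pi - m) -> K p = 0) ->
  (forall r p, 0 < r -> 0 < p < pi ->
    r * phi (- (r * cos p)) (r * sin p) = r^-1 * g (d * ln r + k) * K p) ->
  integral_rv half (fun y => tensor h y * planar phi y) =
  (\prod_(i < n) G i * (d^-1 * \int[mu]_(x in `[0, 3]) g x *
     \int[mu]_(p in `[m, pi - m]) K p))%R%:E.
Proof.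
move=> ch h0 hG cp p0 d0 cg g0 g3 m0 cK K0 Km E.
rewrite (integral_tensor_half ch h0 hG cp p0) EFinM; congr (_ * _)%E.
have IA r : A r -> 0 < r by rewrite /= in_itv/= andbT.
have IB p : B p -> 0 < p < pi by rewrite /= in_itv.
rewrite (@eq_iint _ A B _ (fun r p => r^-1 * g (d * ln r + k) * K p)); last first.
  by move=> r p /IA r0 /IB pI; exact: E.
have cF (r : R) : 0 < r -> {for r, continuous (fun z : R => z^-1 * g (d * ln z + k))}.
  move=> r0; have cl : {for r, continuous (fun z : R => d * ln z + k)}.
    exact: (cvgD (cvgM (cvg_cst _) (continuous_ln r0)) (cvg_cst _)).
  have chl : {for r, continuous (fun z : R => g (d * ln z + k))}.
    exact: (continuous_comp cl (cg _)).
  exact: (cvgM (inv_continuous (lt0r_neq0 r0)) chl).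
apply: iint_product.
- apply: open_continuous_measurable_fun; first exact: interval_open.
  by move=> r /set_mem /IA; exact: cF.
- apply: open_continuous_measurable_fun; first exact: interval_open.
  by move=> p /set_mem /IB; exact: cK.
- by move=> r /IA r0; rewrite mulr_ge0// invr_ge0 ltW.
- by move=> p /IB; exact: K0.
- exact: radial_integral.
- apply: integral_supported => [p|p|p].
  + by rewrite /= !in_itv/= => /andP[h1 h2]; apply/andP; split; lra.
  + by move=> /IB; exact: Km.
  + by move=> /andP[h1 h2]; apply: cK; apply/andP; split; lra.
Qed.

Lemma cont_half_sum (J : Type) (r : seq J) (f : J -> rV -> R) :
  (forall j, cont_half (f j)) -> cont_half (fun y => \sum_(j <- r) f j y).
Proof.
move=> cf; elim: r => [|j r IH] y y0.
  have -> : (fun y => \sum_(j <- [::]) f j y) = cst 0.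
    by apply/funext => z; rewrite big_nil.
  exact: cst_continuous.
have -> : (fun y => \sum_(i <- j :: r) f i y) =
    (fun y => f j y + \sum_(i <- r) f i y).
  by apply/funext => z; rewrite big_cons.
exact: (cvgD (cf j y y0) (IH y y0)).
Qed.

Lemma integral_rv_sum (J : Type) (r : seq J) (f : J -> rV -> R) (c : J -> R) :
  (forall j, cont_half (f j)) -> (forall j, ge0_half (f j)) ->
  (forall j, integral_rv half (f j) = (c j)%:E) ->
  integral_rv half (fun y => \sum_(j <- r) f j y) = (\sum_(j <- r) c j)%:E.
Proof.
move=> cf f0 fE; elim: r => [|j r IH].
  rewrite big_nil /integral_rv; apply: integral0_eq => t _.
  by rewrite big_nil.
have -> : (fun y => \sum_(i <- j :: r) f i y) =
    (fun y => f j y + \sum_(i <- r) f i y).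
  by apply/funext => y; rewrite big_cons.
rewrite big_cons EFinD -IH -(fE j) integral_rvD//; first exact: cont_half_sum.
by move=> y y0; apply: sumr_ge0 => i _; exact: f0.
Qed.

Lemma tensor_continuous (h : nat -> R -> R) : (forall i, continuous (h i)) ->
  continuous (tensor h).
Proof.
move=> ch.
suff H (r : seq 'I_n) : continuous (fun y : rV => \prod_(i <- r) h i (y 0 (inord i))).
  exact: H.
elim: r => [|j r IH].
  have -> : (fun y : rV => \prod_(i <- [::] : seq 'I_n) h i (y 0 (inord i))) = cst 1.
    by apply/funext => z; rewrite big_nil.
  by move=> y; exact: cst_continuous.
have -> : (fun y : rV => \prod_(i <- j :: r) h i (y 0 (inord i))) =
    (fun y => h j (y 0 (inord j)) * \prod_(i <- r) h i (y 0 (inord i))).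
  by apply/funext => z; rewrite big_cons.
move=> y; have cj : {for y, continuous (fun z : rV => h j (z 0 (inord j)))}.
  exact: (continuous_comp (@coordrv_continuous R n.+2 (inord j) y) (ch _ _)).
exact: (cvgM cj (IH y)).
Qed.

Lemma tensor_ge0 (h : nat -> R -> R) (y : rV) : (forall i x, 0 <= h i x) ->
  0 <= tensor h y.
Proof. by move=> h0; apply: prodr_ge0. Qed.

End tensor_integrals.

(** * Logarithmic radius and angle as smooth functions *)

Section test_functions.
Context {R : realType} {n : nat}.
Notation mu := (@lebesgue_measure R).
Local Notation rV := 'rV[R]_n.+2.
Local Notation erv := (@erv R n.+2).
Local Notation half := (half_space R n).

(** The partial derivative only sees the line through [y] in direction [i]; [F] is the restriction
    of [f] to it, as a function of the moving coordinate. *)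
Lemma partial_line (i : 'I_n.+2) (f : rV -> R) (y : rV) (F : R -> R) (l : R) :
  (forall h : R, f (h *: delta_mx 0 i + y) = F (h + y 0 i)) ->
  is_derive (y 0 i) 1 F l -> partial i f y = l.
Proof.
move=> fF dF; have <- : 'D_1 F (y 0 i) = l by rewrite derive_val.
have f0 : f y = F (y 0 i) by have := fF 0; rewrite scale0r !add0r.
rewrite /partial /derive; set g1 := fun h => _; set g2 := fun h => _.
suff -> : g1 = g2 by [].
apply/funext => h; rewrite /g1 /g2 /= fF f0; congr (_ *: (F (_ + _) - _)).
by rewrite [RHS]mulr1.
Qed.

Lemma line_coord (i j : 'I_n.+2) (y : rV) (h : R) :
  (h *: delta_mx 0 i + y) 0 j = (if j == i then h else 0) + y 0 j.
Proof. by rewrite !mxE eqxx/= [j == i]eq_sym; case: eqP => _; rewrite ?mulr1 ?mulr0. Qed.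

(** [log_radius] and [angle] invert the polar coordinates of [polar] for [t > 0], the angle being
    measured from the negative half-axis. *)
Definition log_radius (s t : R) : R := 2^-1 * ln (s ^+ 2 + t ^+ 2).
Definition angle (s t : R) : R := pi / 2 + atan (s / t).

Lemma normsq_gt0 (s t : R) : 0 < t -> 0 < s ^+ 2 + t ^+ 2.
Proof. by move=> t0; rewrite ltr_wpDl ?sqr_ge0// exprn_gt0. Qed.

Lemma log_radius_polar (r p : R) : 0 < r ->
  log_radius (- (r * cos p)) (r * sin p) = ln r.
Proof.
move=> r0; rewrite /log_radius sqrrN !exprMn -mulrDr cos2Dsin2 mulr1 lnXn//.
by rewrite -[ln r *+ 2]mulr_natl mulrA mulVf ?mul1r// pnatr_eq0.
Qed.

Lemma angle_polar (r p : R) : 0 < r -> 0 < p < pi ->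
  angle (- (r * cos p)) (r * sin p) = p.
Proof.
move=> r0 /andP[p0 p1]; have s0 : 0 < sin p by rewrite sin_gt0_pi// p0.
rewrite /angle; have -> : - (r * cos p) / (r * sin p) = tan (p - pi / 2).
  rewrite /tan sinB cosB sin_pihalf cos_pihalf !mulr0 !mulr1 sub0r add0r.
  by field; rewrite (lt0r_neq0 r0) (lt0r_neq0 s0).
rewrite tanK; first by rewrite addrC subrK.
by rewrite in_itv/=; apply/andP; split; lra.
Qed.

Lemma angle_in (s t : R) : 0 < angle s t < pi.
Proof.
have := atan_gtNpi2 (s / t); have := atan_ltpi2 (s / t); rewrite /angle => h1 h2.
by apply/andP; split; lra.
Qed.

Lemma is_derive_log_radius_l (s t : R) : 0 < t ->
  is_derive s 1 (fun z => log_radius z t) (s / (s ^+ 2 + t ^+ 2)).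
Proof.
move=> t0; have r0 := normsq_gt0 s t0.
have dq : is_derive s 1 (fun z => z ^+ 2 + t ^+ 2) (2 * s).
  apply: (is_derive_eqr (is_derive_add (is_derive_exprn 2 s) (is_derive_cstr _ s))).
  by rewrite addr0/= expr1.
have dl := @is_derive1_comp _ (@ln R) (fun z => z ^+ 2 + t ^+ 2) _ _ _ (is_derive1_ln r0) dq.
apply: (is_derive_eqr (is_derive_mul (is_derive_cstr 2^-1 s) dl)).
by field; exact: lt0r_neq0.
Qed.

Lemma is_derive_log_radius_r (s t : R) : 0 < t ->
  is_derive t 1 (fun z => log_radius s z) (t / (s ^+ 2 + t ^+ 2)).
Proof.
move=> t0; have r0 := normsq_gt0 s t0.
have dq : is_derive t 1 (fun z => s ^+ 2 + z ^+ 2) (2 * t).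
  apply: (is_derive_eqr (is_derive_add (is_derive_cstr _ t) (is_derive_exprn 2 t))).
  by rewrite add0r/= expr1.
have dl := @is_derive1_comp _ (@ln R) (fun z => s ^+ 2 + z ^+ 2) _ _ _ (is_derive1_ln r0) dq.
apply: (is_derive_eqr (is_derive_mul (is_derive_cstr 2^-1 t) dl)).
by field; exact: lt0r_neq0.
Qed.

Lemma is_derive_angle_l (s t : R) : 0 < t ->
  is_derive s 1 (fun z => angle z t) (t / (s ^+ 2 + t ^+ 2)).
Proof.
move=> t0; have r0 := normsq_gt0 s t0.
have dq : is_derive s 1 (fun z => z * t^-1) t^-1.
  apply: (is_derive_eqr (is_derive_mul (is_derive_idr s) (is_derive_cstr t^-1 s))).
  by rewrite mulr0 add0r mul1r.
have dl := @is_derive1_comp _ (@atan R) (fun z => z * t^-1) _ _ _ (is_derive1_atan (s * t^-1)) dq.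
apply: (is_derive_eqr (is_derive_add (is_derive_cstr (pi / 2) s) dl)).
have tn := lt0r_neq0 t0.
have e : 1 + (s / t) ^+ 2 = (s ^+ 2 + t ^+ 2) / t ^+ 2 by field.
by rewrite add0r e; field; rewrite tn lt0r_neq0.
Qed.

Lemma is_derive_angle_r (s t : R) : 0 < t ->
  is_derive t 1 (fun z => angle s z) (- (s / (s ^+ 2 + t ^+ 2))).
Proof.
move=> t0; have r0 := normsq_gt0 s t0; have tn := lt0r_neq0 t0.
have di : is_derive t 1 (fun z => z^-1) (- t ^- 2).
  have h := @is_deriveV _ (fun z : R => z) t 1 1 tn (is_derive_idr t).
  by apply: (is_derive_eqr h); rewrite [_ *: 1]mulr1.
have dq : is_derive t 1 (fun z => s * z^-1) (- (s / t ^+ 2)).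
  apply: (is_derive_eqr (is_derive_mul (is_derive_cstr s t) di)).
  by rewrite mul0r addr0 mulrN.
have dl := @is_derive1_comp _ (@atan R) (fun z => s * z^-1) _ _ _ (is_derive1_atan (s * t^-1)) dq.
apply: (is_derive_eqr (is_derive_add (is_derive_cstr (pi / 2) t) dl)).
have e : 1 + (s / t) ^+ 2 = (s ^+ 2 + t ^+ 2) / t ^+ 2 by field.
by rewrite add0r e; field; rewrite tn lt0r_neq0.
Qed.

Lemma Coo_normsq : Coo erv half (fun y => xpenult y ^+ 2 + xlast y ^+ 2).
Proof.
have Cs : Coo erv half (@xpenult R n) := Coo_coord (inord n) open_half.
have Ct : Coo erv half (@xlast R n) := Coo_coord ord_max open_half.
apply: CooD; first exact: open_half.
  by have := CooM open_half Cs Cs; apply: Coo_eq open_half _.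
by have := CooM open_half Ct Ct; apply: Coo_eq open_half _.
Qed.

Lemma Coo_log_radius : Coo erv half (planar log_radius).
Proof.
apply: CooZ; first exact: open_half.
apply: (Coo_comp1 open_half _ Coo1_ln Coo_normsq) => y hy.
exact: normsq_gt0.
Qed.

Lemma Coo_angle : Coo erv half (planar angle).
Proof.
have Cs : Coo erv half (@xpenult R n) := Coo_coord (inord n) open_half.
have Ct : Coo erv half (@xlast R n) := Coo_coord ord_max open_half.
apply: CooD; [exact: open_half|exact: Coo_cst|].
apply: (Coo_comp1 open_half _ Coo1_atan) => //.
apply: CooM; [exact: open_half|exact: Cs|].
by apply: (Coo_comp1 open_half _ Coo1_inv Ct) => y hy; exact: lt0r_neq0.
Qed.

End test_functions.

(** * The test function and its support *)

Section test_function.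
Context {R : realType} {n : nat}.
Notation mu := (@lebesgue_measure R).
Local Notation rV := 'rV[R]_n.+2.
Local Notation erv := (@erv R n.+2).
Local Notation half := (half_space R n).
Variable y : R -> R.
Hypothesis Cy : Coo1 setT y.
Variables (eta d k : R).
Hypothesis d0 : 0 < d.
Hypothesis eta0 : 0 < eta.

(** At [l = ln r] this is [r^(-1/2)], for which Hardy's inequality is an equality of densities, cut
    off by a bump spread over a logarithmic length [3 / d]; increasing [k] moves it towards
    [r = 0]. *)
Definition gam (l : R) : R := expR (- (2^-1 * l)) * bump (d * l + k).
Definition dgam (l : R) : R :=
  expR (- (2^-1 * l)) * (d * derive1 bump (d * l + k) - 2^-1 * bump (d * l + k)).

Lemma is_derive_gam (l : R) : is_derive l 1 gam (dgam l).
Proof.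
have da : is_derive l 1 (fun z => d * z + k) d.
  apply: (is_derive_eqr (is_derive_add (is_derive_mul (is_derive_cstr d l)
    (is_derive_idr l)) (is_derive_cstr k l))).
  by rewrite mul0r mulr1 !addr0.
have dh : is_derive l 1 (fun z => - (2^-1 * z)) (- 2^-1).
  have e : (fun z : R => - (2^-1 * z)) = (fun z => - 2^-1 * z).
    by apply/funext => z; rewrite mulNr.
  rewrite e; apply: (is_derive_eqr (is_derive_mul (is_derive_cstr (- 2^-1) l) (is_derive_idr l))).
  by rewrite mul0r mulr1 addr0.
have de := @is_derive1_comp _ expR (fun z => - (2^-1 * z)) _ _ _ (is_derive_expR _) dh.
have db := @is_derive1_comp _ bump (fun z => d * z + k) _ _ _
  (Coo1_is_derive Coo1_bump (I : setT (d * l + k))) da.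
apply: (is_derive_eqr (is_derive_mul de db)).
by rewrite /dgam /=; ring.
Qed.

Lemma Coo1_affine (a b : R) : Coo1 setT (fun z : R => a * z + b).
Proof.
by apply: CooD openT _ (Coo_cst _ _ _); apply: CooZ openT _; exact: Coo1_id openT.
Qed.

Lemma Coo1_gam : Coo1 setT gam.
Proof.
apply: CooM; first exact: openT.
- apply: (@Coo_comp1 R R unit e1 setT setT expR (fun l => - (2^-1 * l))) => //.
  + exact: openT.
  + exact: Coo1_expR.
  + have e : (fun l : R => - (2^-1 * l)) = (fun l => - 2^-1 * l + 0).
      by apply/funext => l; rewrite mulNr addr0.
    by rewrite e; exact: Coo1_affine.
- apply: (@Coo_comp1 R R unit e1 setT setT bump (fun l => d * l + k)) => //.
  + exact: openT.
  + exact: Coo1_bump.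
  + exact: Coo1_affine.
Qed.

Lemma Coo1_Ycut : Coo1 [set p | 0 < p < pi] (Ycut y eta).
Proof.
set U : set R := [set p | 0 < p < pi].
have oU : open U.
  have -> : U = `]0, pi[%classic by apply/seteqP; split => x; rewrite /U/= in_itv.
  exact: interval_open.
apply: CooM => //; first exact: CooS Cy.
apply: (@Coo_comp1 R R unit e1 U setT step (fun p => 2 + eta * ln (sin p))) => //.
  exact: Coo1_step.
apply: CooD => //; first exact: Coo_cst.
apply: CooZ => //.
apply: (@Coo_comp1 R R unit e1 U [set x | 0 < x] (@ln R) (@sin R)) => //.
- by move=> p; exact: sin_gt0_pi.
- exact: Coo1_ln.
- by apply: CooS (@Coo1_sin_cos R).1.
Qed.

Definition wave : R -> R -> R :=
  fun s t => gam (log_radius s t) * Ycut y eta (angle s t).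

Lemma Coo_wave : Coo erv half (planar wave).
Proof.
apply: CooM; first exact: open_half.
- by apply: (Coo_comp1 open_half _ Coo1_gam Coo_log_radius).
- by apply: (Coo_comp1 open_half _ Coo1_Ycut Coo_angle) => z _; exact: angle_in.
Qed.

Definition test (z : rV) : R := tensor (fun=> bump) z * planar wave z.

Lemma Coo_test : Coo erv half test.
Proof.
apply: (CooM open_half _ Coo_wave).
apply: Coo_prod; first exact: open_half.
move=> i; apply: (Coo_comp1 open_half _ Coo1_bump) => //.
exact: (Coo_coord _ open_half).
Qed.

Lemma sin_angle (s t : R) : 0 < t -> sin (angle s t) ^+ 2 * (s ^+ 2 + t ^+ 2) = t ^+ 2.
Proof.
move=> t0; rewrite /angle addrC sinDpihalf.
have c0 : 0 < cos (atan (s / t)).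
  by apply: cos_gt0_pihalf; rewrite atan_gtNpi2 atan_ltpi2.
have e := atanK (s / t); rewrite /tan in e.
have h := cos2Dsin2 (atan (s / t)).
set C := cos _ in c0 e h *; set S := sin _ in e h.
have sE : s = S / C * t by rewrite e divfK// lt0r_neq0.
rewrite sE; have -> : C ^+ 2 * ((S / C * t) ^+ 2 + t ^+ 2) = (C ^+ 2 + S ^+ 2) * t ^+ 2.
  by field; exact: lt0r_neq0.
by rewrite h mul1r.
Qed.

Lemma gam_eq0 (l : R) : ~ (0 <= d * l + k <= 3) -> gam l = 0.
Proof.
move=> h; rewrite /gam; have [->|/bump_neq0/andP[h1 h2]] := eqVneq (bump (d * l + k)) 0.
  by rewrite mulr0.
by exfalso; apply: h; rewrite !ltW.
Qed.

(** Where [test] is nonzero, the radius lies between [r0] and [r1] and the sine of the angle exceeds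
    [expR (- (2 / eta))]. So the last coordinate is at least [m0 > 0], and the point lies in a
    compact box inside the open half-space. *)
Lemma C0infty_test : C0infty half (pf test).
Proof.
pose r0 := expR (- k / d); pose r1 := expR ((3 - k) / d).
pose m0 := r0 * expR (- (2 / eta)).
have m00 : 0 < m0 by rewrite mulr_gt0// expR_gt0.
(* [r1] bounds the last two coordinates, and 3 the others, which lie in the support of [bump]. *)
pose M := r1 + 3.
pose box (i : 'I_n.+2) : set R := if i == ord_max then `[m0, M]%classic else `[- M, M]%classic.
pose K : set rV := [set z | forall i, box i (z ord0 i)].
apply: (@glue_C0infty _ _ K) => //.
- by apply: rV_compact => i; rewrite /box; case: ifP => _; exact: segment_compact.
- move=> z /(_ ord_max); rewrite /box eqxx /= in_itv/= => /andP[h _].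
  exact: lt_le_trans h.
- exact: Coo_test.
move=> z hz; apply: contra_notP => /eqP.
rewrite /test mulf_eq0 negb_or /planar /wave mulf_eq0 negb_or => /andP[Hn /andP[gn Yn]].
set s := xpenult z in gn Yn; set t := xlast z in gn Yn.
have t0 : 0 < t by [].
have q0 := normsq_gt0 s t0.
have {gn} /andP[l1 l2] : 0 <= d * log_radius s t + k <= 3.
  by apply/negP => /negP h; move/eqP: gn; apply; apply: gam_eq0; exact/negP.
have lr : r0 ^+ 2 <= s ^+ 2 + t ^+ 2 <= r1 ^+ 2.
  have e : s ^+ 2 + t ^+ 2 = expR (log_radius s t) ^+ 2.
    by rewrite -expRM_natl /log_radius mulrA mulfV ?pnatr_eq0// mul1r lnK.
  have h1 : - k / d <= log_radius s t by rewrite ler_pdivrMr// mulrC; lra.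
  have h2 : log_radius s t <= (3 - k) / d by rewrite ler_pdivlMr// mulrC; lra.
  by rewrite e !lerXn2r ?nnegrE ?expR_ge0 ?ler_expR.
have r10 : 0 < r1 := expR_gt0 _.
have sM : `|s| <= r1.
  rewrite -(@ler_pXn2r _ 2) ?nnegrE ?(ltW r10)// real_normK ?num_real//.
  by case/andP: lr => _; apply: le_trans; rewrite lerDl sqr_ge0.
have tM : `|t| <= r1.
  rewrite -(@ler_pXn2r _ 2) ?nnegrE ?(ltW r10)// real_normK ?num_real//.
  by case/andP: lr => _; apply: le_trans; rewrite lerDr sqr_ge0.
have s1 : expR (- (2 / eta)) < sin (angle s t).
  have sa : 0 < sin (angle s t) by apply: sin_gt0_pi; exact: angle_in.
  rewrite -[X in _ < X]lnK ?posrE// ltr_expR.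
  rewrite -(ltr_pM2l eta0).
  have -> : eta * - (2 / eta) = - 2 by field; exact: lt0r_neq0.
  rewrite ltNge; apply/negP => h.
  move/negP: Yn; apply; rewrite /Ycut /chi step_le0 ?mulr0//; lra.
have tm : m0 <= t.
  rewrite -(@ler_pXn2r _ 2) ?nnegrE ?(ltW t0) ?(ltW m00)//.
  rewrite -(sin_angle s t0) exprMn mulrC; case/andP: lr => lr _.
  apply: ler_pM; rewrite ?exprn_ge0 ?expR_ge0//.
  by apply: lerXn2r; rewrite ?nnegrE ?expR_ge0 ?(le_trans (expR_ge0 _) (ltW s1)) ?(ltW s1).
move=> i; rewrite /box; have [->|im] := eqVneq i ord_max.
  rewrite /= in_itv/= -/(xlast z) -/t tm/=.
  by move: tM; rewrite ler_norml => /andP[_]; rewrite /M; lra.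
rewrite /= in_itv/= -ler_norml.
have [->|ip] := eqVneq i (inord n).
  by rewrite -/(xpenult z) -/s /M; lra.
have iln : (i < n)%N.
  have : (i < n.+2)%N by [].
  rewrite ltnS leq_eqVlt => /orP[/eqP e|]; first by case/eqP: im; apply: val_inj.
  rewrite ltnS leq_eqVlt => /orP[/eqP e|//]; case/eqP: ip; apply: val_inj.
  by rewrite /= inordK.
have : bump (z 0 i) != 0.
  move: Hn; rewrite /tensor => /prodf_neq0 /(_ (Ordinal iln) isT) /=.
  have -> // : inord i = i by exact: inord_val.
by move=> /bump_neq0 /andP[h1 h2]; rewrite gtr0_norm// /M; lra.
Qed.

End test_function.

(** * The gradient of the test function *)

Section test_gradient.
Context {R : realType} {n : nat}.
Notation mu := (@lebesgue_measure R).
Local Notation rV := 'rV[R]_n.+2.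
Local Notation erv := (@erv R n.+2).
Local Notation half := (half_space R n).
Variable y : R -> R.
Hypothesis Cy : Coo1 setT y.
Variables (eta d k : R).

Local Notation gam := (@gam R d k).
Local Notation dgam := (@dgam R d k).
Local Notation wave := (@wave R y eta d k).
Local Notation test := (@test R n y eta d k).

Definition density (c : R -> R -> R) (F K : R -> R) : R -> R -> R :=
  fun s t => c s t * (F (log_radius s t) * K (angle s t)).

(** The index [j] makes this a family of functions, as [tensor] expects. *)
Definition sqr_bump (j : nat) (x : R) : R := bump x ^+ 2.
Definition sqr_dbump (i j : nat) (x : R) : R :=
  if j == i then derive1 bump x ^+ 2 else bump x ^+ 2.

Lemma inord_neq (i j : nat) : (i < n.+2)%N -> (j < n.+2)%N -> i != j ->
  (inord i == inord j :> 'I_n.+2) = false.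
Proof.
move=> il jl; apply: contra_neqF => /eqP /(congr1 val).
by rewrite /= !inordK.
Qed.

Lemma inord_max : ord_max = inord n.+1 :> 'I_n.+2.
Proof. by apply: val_inj; rewrite /= inordK. Qed.

Lemma partial_test_lt (i : 'I_n) (z : rV) :
  partial (inord i) test z =
  derive1 bump (z 0 (inord i)) * (\prod_(j < n | j != i) bump (z 0 (inord j))) *
  planar wave z.
Proof.
have il : (i < n)%N by [].
have in2 j : (j < n)%N -> (j < n.+2)%N by move=> jn; rewrite (leq_trans jn)// leqW.
apply: (@partial_line _ _ _ _ _ (fun x =>
  bump x * (\prod_(j < n | j != i) bump (z 0 (inord j)) * planar wave z))).
  move=> h; rewrite /test /tensor (bigD1 i)//= line_coord eqxx -mulrA; congr (_ * (_ * _)).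
    apply: eq_bigr => j ji; by rewrite line_coord inord_neq ?add0r ?in2//.
  rewrite /planar /xpenult /xlast inord_max !line_coord.
  rewrite !(inord_neq _ (in2 _ il)) ?ltnSn ?ltnS// ?add0r// eq_sym neq_ltn ?il//.
  by rewrite ltnS ltnW.
have db := Coo1_is_derive Coo1_bump (I : setT (z 0 (inord i))).
apply: (is_derive_eqr (is_derive_mul db (is_derive_cstr _ _))).
by rewrite mulr0 add0r mulrA.
Qed.

Lemma tensor_line (f : nat -> R -> R) (i : nat) (z : rV) (h : R) : (n <= i < n.+2)%N ->
  tensor f (h *: delta_mx 0 (inord i) + z) = tensor f z.
Proof.
move=> /andP[ni i2]; apply: eq_bigr => j _; have jn := ltn_ord j.
rewrite line_coord inord_neq ?add0r//; first by rewrite (leq_trans jn)// leqW.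
by rewrite neq_ltn (leq_trans jn).
Qed.

Lemma ds_test (z : rV) : half z ->
  ds test z = tensor (fun=> bump) z *
    ((dgam (log_radius (xpenult z) (xlast z)) * Ycut y eta (angle (xpenult z) (xlast z)) *
        xpenult z +
      gam (log_radius (xpenult z) (xlast z)) * dYcut y eta (angle (xpenult z) (xlast z)) *
        xlast z) / (xpenult z ^+ 2 + xlast z ^+ 2)).
Proof.
move=> t0; set s := xpenult z; set t := xlast z in t0 *.
apply: (@partial_line _ _ _ _ _ (fun x => tensor (fun=> bump) z *
  (gam (log_radius x t) * Ycut y eta (angle x t)))).
  move=> h; rewrite /test tensor_line ?leqnn ?ltnS ?leqnSn//.
  rewrite /planar /wave /t /xpenult /xlast inord_max !line_coord eqxx.
  by rewrite inord_neq ?add0r// gtn_eqF.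
have dg := @is_derive1_comp _ gam (fun x => log_radius x t) _ _ _
  (is_derive_gam d k _) (is_derive_log_radius_l s t0).
have dY := @is_derive1_comp _ (Ycut y eta) (fun x => angle x t) _ _ _
  (is_derive_Ycut Cy eta (sin_gt0_pi (angle_in s t))) (is_derive_angle_l s t0).
apply: (is_derive_eqr (is_derive_mul (is_derive_cstr _ _) (is_derive_mul dg dY))).
by rewrite mul0r addr0 /= -/s -/t; field; exact: lt0r_neq0 (normsq_gt0 s t0).
Qed.

Lemma dt_test (z : rV) : half z ->
  dt test z = tensor (fun=> bump) z *
    ((dgam (log_radius (xpenult z) (xlast z)) * Ycut y eta (angle (xpenult z) (xlast z)) *
        xlast z -
      gam (log_radius (xpenult z) (xlast z)) * dYcut y eta (angle (xpenult z) (xlast z)) *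
        xpenult z) / (xpenult z ^+ 2 + xlast z ^+ 2)).
Proof.
move=> t0; set s := xpenult z; set t := xlast z in t0 *.
rewrite /dt inord_max.
apply: (@partial_line _ _ _ _ _ (fun x => tensor (fun=> bump) z *
  (gam (log_radius s x) * Ycut y eta (angle s x)))).
  move=> h; rewrite /test tensor_line ?leqnSn ?ltnSn//.
  rewrite /planar /wave /s /xpenult /xlast inord_max !line_coord eqxx.
  by rewrite inord_neq ?add0r// ltn_eqF.
rewrite -inord_max -/(xlast z) -/t.
have dg := @is_derive1_comp _ gam (fun x => log_radius s x) _ _ _
  (is_derive_gam d k _) (is_derive_log_radius_r s t0).
have dY := @is_derive1_comp _ (Ycut y eta) (fun x => angle s x) _ _ _
  (is_derive_Ycut Cy eta (sin_gt0_pi (angle_in s t))) (is_derive_angle_r s t0).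
apply: (is_derive_eqr (is_derive_mul (is_derive_cstr _ _) (is_derive_mul dg dY))).
by rewrite mul0r addr0 /= -/s -/t; field; exact: lt0r_neq0 (normsq_gt0 s t0).
Qed.

Definition sqf (f : R -> R) (x : R) : R := f x ^+ 2.
Definition wt_last : R -> R -> R := fun _ t => t.
Definition wt_grad : R -> R -> R := fun s t => t / (s ^+ 2 + t ^+ 2).

Lemma tensor_sqr (z : rV) : tensor sqr_bump z = tensor (fun=> bump) z ^+ 2.
Proof. by rewrite /tensor -prodrXl; apply: eq_bigr. Qed.

Lemma tensor_sqr_dbump (i : 'I_n) (z : rV) : tensor (sqr_dbump i) z =
  (derive1 bump (z 0 (inord i)) * \prod_(j < n | j != i) bump (z 0 (inord j))) ^+ 2.
Proof.
rewrite /tensor (bigD1 i)//= /sqr_dbump eqxx exprMn; congr (_ * _).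
rewrite -prodrXl; apply: eq_bigr => j ji; rewrite ifF//.
by apply/negbTE; apply: contra ji => /eqP /val_inj ->.
Qed.

(** The gradients of [log_radius] and [angle] are orthogonal and both of length [1 / r], so the
    cross terms between radial and angular derivatives cancel. What remains is a sum of products to
    which the integral formulas apply. *)
Lemma normsq_grad_test (z : rV) : half z ->
  xlast z * normsq_grad (pf test) z =
  \sum_(i < n) tensor (sqr_dbump i) z *
    planar (density wt_last (sqf gam) (sqf (Ycut y eta))) z +
  (tensor sqr_bump z * planar (density wt_grad (sqf dgam) (sqf (Ycut y eta))) z +
   tensor sqr_bump z * planar (density wt_grad (sqf gam) (sqf (dYcut y eta))) z).
Proof.
move=> hz; have t0 : 0 < xlast z by [].
have e i : partial i (pf test) z = partial i test z.
  have E : {in half, pf test =1 test} by move=> x; rewrite inE => /pf_pos.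
  by have := near_pd erv i open_half E; move=> /(_ z); rewrite inE => /(_ hz).
rewrite normsq_grad_split /ds /dt !e -/(ds test z) -/(dt test z) ds_test// dt_test//.
rewrite -addrA mulrDr; congr (_ + _).
  rewrite mulr_sumr; apply: eq_bigr => i _.
  rewrite e partial_test_lt tensor_sqr_dbump /planar /density /wt_last /sqf /wave.
  by ring.
rewrite tensor_sqr /planar /density /wt_grad /sqf.
by field; exact: lt0r_neq0 (normsq_gt0 (xpenult z) t0).
Qed.

End test_gradient.

(** * Energy of the test function *)

Section test_energy.
Context {R : realType} {n : nat}.
Notation mu := (@lebesgue_measure R).
Local Notation rV := 'rV[R]_n.+2.
Local Notation erv := (@erv R n.+2).
Local Notation half := (half_space R n).

Lemma bump_out (x : R) : ~ (0 <= x <= 3) -> bump x = 0.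
Proof.
move=> h; have [//|/bump_neq0/andP[h1 h2]] := eqVneq (bump x) 0.
by exfalso; apply: h; rewrite !ltW.
Qed.

Lemma dbump_out (x : R) : ~ (0 <= x <= 3) -> derive1 bump x = 0.
Proof.
move=> h; pose U : set R := [set x | ~ (0 <= x <= 3)].
have oU : open U.
  have -> : U = ~` `[0, 3]%classic by apply/seteqP; split=> z; rewrite /U/= in_itv.
  by rewrite openC; exact: itv_closed.
rewrite derive1E.
have := @near_pd R R unit e1 U bump (fun=> 0) tt oU _ x; rewrite /pd /e1 => ->.
- exact: derive_cst.
- by move=> z; rewrite inE => /bump_out.
- by rewrite inE.
Qed.

Lemma cont_bump : continuous (@bump R). Proof. exact: Coo1_cont Coo1_bump. Qed.
Lemma cont_dbump : continuous (derive1 (@bump R)).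
Proof. exact: Coo1_cont (Coo1_derive Coo1_bump). Qed.

Lemma continuous_sqrf (f : R -> R) : continuous f -> continuous (fun x => f x ^+ 2).
Proof. by move=> cf x; exact: (continuous_sq (cf x)). Qed.

Definition bump_mass : R := \int[mu]_(x in `[0, 3]) (bump x ^+ 2).
Definition bump_energy : R := \int[mu]_(x in `[0, 3]) (derive1 bump x ^+ 2).

Lemma bump_mass_gt0 : 0 < bump_mass.
Proof.
apply: (@lt_le_trans _ _ (\int[mu]_(x in `[1, 2]) (bump x ^+ 2))); last first.
  apply: Rintegral_sub; [lra|lra|lra| |].
    by apply: cont_onT; apply: continuous_sqrf; exact: cont_bump.
  by move=> x _; exact: sqr_ge0.
rewrite (@eq_Rintegral _ _ _ mu _ (fun=> 1)).
  by rewrite Rintegral_cst_segment; lra.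
by move=> x; rewrite inE/= in_itv/= => x12; rewrite bump_eq1// expr1n.
Qed.

Lemma bump_energy_ge0 : 0 <= bump_energy.
Proof. by apply: Rintegral_ge0 => x _; exact: sqr_ge0. Qed.

Lemma integral_sqr_bump (j : nat) : (\int[mu]_x (sqr_bump j x)%:E = bump_mass%:E)%E.
Proof.
rewrite (@integral_supported R setT 0 3)//.
- by move=> x _ /bump_out; rewrite /sqr_bump => ->; rewrite expr0n.
- by apply: cont_onT; apply: continuous_sqrf; exact: cont_bump.
Qed.

Lemma integral_sqr_dbump (i j : nat) : (\int[mu]_x (sqr_dbump i j x)%:E =
  (if j == i then bump_energy else bump_mass)%:E)%E.
Proof.
rewrite /sqr_dbump; case: ifP => _; last exact: (integral_sqr_bump 0).
rewrite (@integral_supported R setT 0 3)//.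
- by move=> x _ /dbump_out ->; rewrite expr0n.
- by apply: cont_onT; apply: continuous_sqrf; exact: cont_dbump.
Qed.

(** The cross term is a multiple of the derivative of [bump ^+ 2], which integrates to 0. The
    coefficient [1 / 4] is Hardy's constant, and the excess is of order [d ^+ 2]. *)
Lemma cross_term (d : R) :
  \int[mu]_(x in `[0, 3]) ((d * derive1 bump x - 2^-1 * bump x) ^+ 2) =
  d ^+ 2 * bump_energy + 4^-1 * bump_mass.
Proof.
have cb := cont_bump; have cb' := cont_dbump.
have c1 := cont_onT (a := 0) (b := 3) (continuous_sqrf cb).
have c2 := cont_onT (a := 0) (b := 3) (continuous_sqrf cb').
have c3 : cont_on 0 3 (fun x : R => 2 * (bump x * derive1 bump x)).
  exact: (cont_onM (@cont_on_cst _ 0 3 2) (cont_onM (cont_onT cb) (cont_onT cb'))).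
have I0 : \int[mu]_(x in `[0, 3]) (2 * (bump x * derive1 bump x)) = 0.
  have dF (x : R) : is_derive x 1 (fun x => bump x * bump x) (2 * (bump x * derive1 bump x)).
    have db := Coo1_is_derive Coo1_bump (I : setT x).
    by apply: (is_derive_eqr (is_derive_mul db db)); ring.
  have lt03 : (0 : R) < 3 by [].
  rewrite (FTC_segment lt03 c3 (fun x _ => dF x)) /bump.
  by rewrite (@step_le0 _ 0)// (@step_le0 _ (3 - 3)) ?subrr// !(mul0r, mulr0) subrr.
have -> : (fun x : R => (d * derive1 bump x - 2^-1 * bump x) ^+ 2) =
    (fun x : R => d ^+ 2 * derive1 bump x ^+ 2 + 4^-1 * bump x ^+ 2 +
       - (2^-1 * d) * (2 * (bump x * derive1 bump x))).
  by apply/funext => x; field.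
have z1 : cont_on 0 3 (fun x : R => d ^+ 2 * derive1 bump x ^+ 2).
  by apply: cont_onM => //; exact: cont_on_cst.
have z2 : cont_on 0 3 (fun x : R => 4^-1 * bump x ^+ 2).
  by apply: cont_onM => //; exact: cont_on_cst.
have z3 : cont_on 0 3 (fun x : R => - (2^-1 * d) * (2 * (bump x * derive1 bump x))).
  by apply: cont_onM => //; exact: cont_on_cst.
rewrite (RintegralD_cont (cont_onD z1 z2) z3) (RintegralD_cont z1 z2).
by rewrite (RintegralZ_cont _ c3) I0 (RintegralZ_cont _ c2) (RintegralZ_cont _ c1) mulr0 addr0.
Qed.

Variable y : R -> R.
Hypothesis Cy : Coo1 setT y.
Variables (eta d k m : R).
Hypothesis d0 : 0 < d.
Hypothesis eta0 : 0 < eta.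
Hypothesis m0 : 0 < m.
Hypothesis mpi : m < pi - m.
Hypothesis Hout : forall p, 0 < p < pi -> p <= m \/ pi - m <= p ->
  2 + eta * ln (sin p) < 0.

Local Notation gam := (@gam R d k).
Local Notation dgam := (@dgam R d k).
Local Notation test := (@test R n y eta d k).
Local Notation Y := (Ycut y eta).
Local Notation dY := (dYcut y eta).

Lemma Ycut_out p : 0 < p < pi -> ~ (m <= p <= pi - m) -> Y p = 0 /\ dY p = 0.
Proof.
move=> pI h; have pm : p <= m \/ pi - m <= p.
  have [pm|mp] := leP p m; [by left|right].
  by rewrite leNgt; apply/negP => pm; apply: h; rewrite !ltW.
by have [c1 c2] := chi_eq0 (Hout pI pm); rewrite /Ycut /dYcut c1 c2 !mulr0 addr0.
Qed.

Lemma gam_ln (r : R) : 0 < r -> gam (ln r) ^+ 2 = r^-1 * bump (d * ln r + k) ^+ 2 /\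
  dgam (ln r) ^+ 2 =
    r^-1 * (d * derive1 bump (d * ln r + k) - 2^-1 * bump (d * ln r + k)) ^+ 2.
Proof.
move=> r0; have e : expR (- (2^-1 * ln r)) ^+ 2 = r^-1.
  rewrite -expRM_natl mulrN mulrA mulfV ?pnatr_eq0// mul1r expRN lnK//.
by rewrite /gam /dgam !exprMn e.
Qed.

Lemma cont_gam : continuous gam.
Proof. exact: Coo1_cont (Coo1_gam d k). Qed.

Lemma cont_dgam : continuous dgam.
Proof.
have -> : dgam = derive1 gam; last exact: Coo1_cont (Coo1_derive (Coo1_gam d k)).
apply/funext => l; rewrite derive1E.
by have := is_derive_gam d k l => h; rewrite derive_val.
Qed.

Lemma density_cont (c : R -> R -> R) (F K : R -> R) : cont_half (@planar _ n c) ->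
  continuous F -> (forall p, 0 < p < pi -> {for p, continuous K}) ->
  cont_half (@planar _ n (density c F K)).
Proof.
move=> cc cF cK z z0.
have c1 : {for z, continuous (fun x => F (planar log_radius x))}.
  have cl := Coo_continuous (@Coo_log_radius R n) z0.
  exact: (continuous_comp cl (cF _)).
have c2 : {for z, continuous (fun x => K (planar angle x))}.
  have ca := Coo_continuous (@Coo_angle R n) z0.
  exact: (continuous_comp ca (cK _ (angle_in _ _))).
exact: (cvgM (cc z z0) (cvgM c1 c2)).
Qed.

Lemma density_ge0 (c : R -> R -> R) (F K : R -> R) : ge0_half (@planar _ n c) ->
  ge0_half (@planar _ n (density c (sqf F) (sqf K))).
Proof. by move=> c0 z z0; rewrite mulr_ge0 ?c0// mulr_ge0// sqr_ge0. Qed.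

Lemma polar_normsq (r p : R) : (- (r * cos p)) ^+ 2 + (r * sin p) ^+ 2 = r ^+ 2.
Proof. by rewrite sqrrN !exprMn -mulrDr cos2Dsin2 mulr1. Qed.

(** The last hypothesis absorbs the Jacobian, the weight [c] and the radial factor into a radial
    density [g] and an angular weight [w]; each integral below amounts to a choice of these two. *)
Lemma integral_density (h : nat -> R -> R) (G : nat -> R) (c : R -> R -> R)
    (F K g w : R -> R) :
  (forall i, continuous (h i)) -> (forall i x, 0 <= h i x) ->
  (forall i, \int[mu]_x (h i x)%:E = (G i)%:E)%E ->
  cont_half (@planar _ n c) -> ge0_half (@planar _ n c) ->
  continuous F -> (forall p, 0 < p < pi -> {for p, continuous K}) ->
  (forall p, 0 < p < pi -> ~ (m <= p <= pi - m) -> K p = 0) ->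
  continuous g -> (forall x, 0 <= g x) -> (forall x, ~ (0 <= x <= 3) -> g x = 0) ->
  (forall p, 0 < p < pi -> 0 <= w p) ->
  (forall p, 0 < p < pi -> {for p, continuous w}) ->
  (forall r p, 0 < r -> 0 < p < pi ->
    r * c (- (r * cos p)) (r * sin p) * F (ln r) ^+ 2 = r^-1 * g (d * ln r + k) * w p) ->
  integral_rv half (fun z => tensor h z * planar (density c (sqf F) (sqf K)) z) =
  (\prod_(i < n) G i * (d^-1 * \int[mu]_(x in `[0, 3]) g x *
     \int[mu]_(p in `[m, pi - m]) (w p * K p ^+ 2)))%R%:E.
Proof.
move=> ch h0 hG cc c0 cF cK K0 cg g0 g3 w0 cw E.
apply: (@integral_tensor_polar _ _ h G _ d k m g (fun p => w p * K p ^+ 2)) => //.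
- apply: density_cont => //; first exact: continuous_sqrf.
  by move=> p pI; exact: (continuous_sq (cK p pI)).
- exact: density_ge0.
- by move=> p pI; exact: (cvgM (cw p pI) (continuous_sq (cK p pI))).
- by move=> p pI; rewrite mulr_ge0 ?w0 ?sqr_ge0.
- by move=> p pI pm; rewrite K0// expr0n mulr0.
- move=> r p r0 pI; rewrite /density log_radius_polar// angle_polar// /sqf.
  by rewrite [RHS]mulrA -E// !mulrA.
Qed.

Lemma continuous_Ycut_in (p : R) : 0 < p < pi -> {for p, continuous Y}.
Proof. by move=> pI; apply: continuous_Ycut => //; exact: sin_gt0_pi. Qed.

Lemma continuous_dYcut_in (p : R) : 0 < p < pi -> {for p, continuous dY}.
Proof. by move=> pI; apply: continuous_dYcut => //; exact: sin_gt0_pi. Qed.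

Lemma Ycut_out0 (p : R) : 0 < p < pi -> ~ (m <= p <= pi - m) -> Y p = 0.
Proof. by move=> pI pm; have [] := Ycut_out pI pm. Qed.

Lemma dYcut_out0 (p : R) : 0 < p < pi -> ~ (m <= p <= pi - m) -> dY p = 0.
Proof. by move=> pI pm; have [] := Ycut_out pI pm. Qed.

Lemma cont_half_wt_last : cont_half (@planar R n (@wt_last R)).
Proof. by move=> z _; exact: xlast_continuous. Qed.

Lemma ge0_half_wt_last : ge0_half (@planar R n (@wt_last R)).
Proof. by move=> z z0; exact: ltW. Qed.

Lemma cont_half_wt_grad : cont_half (@planar R n wt_grad).
Proof.
move=> z z0; have c1 := Coo_continuous (@Coo_normsq R n) z0.
have q0 := lt0r_neq0 (normsq_gt0 (xpenult z) z0).
have c2 : {for z, continuous (fun z : rV => (xpenult z ^+ 2 + xlast z ^+ 2)^-1)}.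
  exact: (continuous_comp c1 (inv_continuous q0)).
exact: (cvgM (@xlast_continuous R n z) c2).
Qed.

Lemma ge0_half_wt_grad : ge0_half (@planar R n wt_grad).
Proof. by move=> z z0; rewrite divr_ge0 ?(ltW z0)// ltW// normsq_gt0. Qed.

Definition wt_radius : R -> R -> R := fun s t => (Num.sqrt (s ^+ 2 + t ^+ 2))^-1.
Definition wt_inv : R -> R -> R := fun _ t => t^-1.

Lemma cont_half_wt_radius : cont_half (@planar R n wt_radius).
Proof.
move=> z z0; have r0 := lt0r_neq0 (radius_gt0 z0).
exact: (continuous_comp (@radius_continuous R n z) (inv_continuous r0)).
Qed.

Lemma ge0_half_wt_radius : ge0_half (@planar R n wt_radius).
Proof. by move=> z z0; rewrite invr_ge0 sqrtr_ge0. Qed.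

Lemma cont_half_wt_inv : cont_half (@planar R n wt_inv).
Proof.
move=> z z0; have r0 := lt0r_neq0 z0.
exact: (continuous_comp (@xlast_continuous R n z) (inv_continuous r0)).
Qed.

Lemma ge0_half_wt_inv : ge0_half (@planar R n wt_inv).
Proof. by move=> z z0; rewrite invr_ge0 ltW. Qed.

Lemma sqr_bump_cont (j : nat) : continuous (@sqr_bump R j).
Proof. by apply: continuous_sqrf; exact: cont_bump. Qed.

Lemma sqr_dbump_cont (i j : nat) : continuous (@sqr_dbump R i j).
Proof.
rewrite /sqr_dbump; case: (j == i); apply: continuous_sqrf; [exact: cont_dbump|exact: cont_bump].
Qed.

Lemma sqr_bump_ge0 (j : nat) (x : R) : 0 <= sqr_bump j x.
Proof. exact: sqr_ge0. Qed.

Lemma sqr_dbump_ge0 (i j : nat) (x : R) : 0 <= sqr_dbump i j x.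
Proof. by rewrite /sqr_dbump; case: ifP => _; exact: sqr_ge0. Qed.

(** The exponential factor is [r ^+ 2] in the variable [x = d * ln r + k]: [wt_last] carries two
    more powers of [r] than [wt_grad]. This is why the terms with derivatives in the first [n]
    variables become negligible as [k] grows. *)
Definition radial_bump (x : R) : R := expR ((x - k) / d) ^+ 2 * bump x ^+ 2.
Definition radial_grad (x : R) : R := (d * derive1 bump x - 2^-1 * bump x) ^+ 2.

Lemma radial_bump_cont : continuous radial_bump.
Proof.
move=> x; have ca : {for x, continuous (fun z : R => (z - k) / d)}.
  have ci : {for x, continuous (fun z : R => z)} by exact: cvg_id.
  exact: (cvgM (cvgB ci (cvg_cst k)) (cvg_cst d^-1)).
have ce : {for x, continuous (fun z : R => expR ((z - k) / d))}.
  exact: (@continuous_comp _ _ _ (fun z : R => (z - k) / d) expR x ca (@continuous_expR R _)).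
have h : {for x, continuous (fun z : R => expR ((z - k) / d) ^+ 2 * bump z ^+ 2)}.
  exact: (cvgM (continuous_sq ce) (continuous_sq (@cont_bump x))).
exact: h.
Qed.

Lemma radial_grad_cont : continuous radial_grad.
Proof.
apply: (@continuous_sqrf (fun x => d * derive1 bump x - 2^-1 * bump x)) => x.
have c1 : {for x, continuous (fun z : R => d * derive1 bump z)}.
  exact: (cvgM (cvg_cst d) (@cont_dbump x)).
have c2 : {for x, continuous (fun z : R => 2^-1 * bump z)}.
  exact: (cvgM (cvg_cst (2^-1 : R)) (@cont_bump x)).
exact: (cvgB c1 c2).
Qed.

Lemma radial_grad_out (x : R) : ~ (0 <= x <= 3) -> radial_grad x = 0.
Proof. by move=> h; rewrite /radial_grad bump_out// dbump_out// !mulr0 subrr expr0n. Qed.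

Lemma sqr_bump_out j (x : R) : ~ (0 <= x <= 3) -> sqr_bump j x = 0.
Proof. by move=> h; rewrite /sqr_bump bump_out// expr0n. Qed.

Lemma radial_bump_out (x : R) : ~ (0 <= x <= 3) -> radial_bump x = 0.
Proof. by move=> h; rewrite /radial_bump bump_out// expr0n mulr0. Qed.

Definition den_Y := \int[mu]_(p in `[m, pi - m]) (Y p ^+ 2).
Definition sin_Y := \int[mu]_(p in `[m, pi - m]) (sin p * Y p ^+ 2).
Definition sin_dY := \int[mu]_(p in `[m, pi - m]) (sin p * dY p ^+ 2).
Definition inv_sin_Y := \int[mu]_(p in `[m, pi - m]) ((sin p)^-1 * Y p ^+ 2).
Definition radial_mass := \int[mu]_(x in `[0, 3]) radial_bump x.

Lemma sin_ge0_in (p : R) : 0 < p < pi -> 0 <= sin p.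
Proof. by move=> /sin_gt0_pi /ltW. Qed.

Lemma integral_last (i : 'I_n) :
  integral_rv half (fun z => tensor (sqr_dbump i) z *
    planar (density wt_last (sqf gam) (sqf Y)) z) =
  (\prod_(j < n) (if j == i :> nat then bump_energy else bump_mass) *
    (d^-1 * radial_mass * sin_Y))%:E.
Proof.
apply: (@integral_density _ (fun j => if j == i :> nat then bump_energy else bump_mass)) => //.
- exact: sqr_dbump_cont.
- exact: sqr_dbump_ge0.
- exact: integral_sqr_dbump.
- exact: cont_half_wt_last.
- exact: ge0_half_wt_last.
- exact: cont_gam.
- exact: continuous_Ycut_in.
- exact: Ycut_out0.
- exact: radial_bump_cont.
- by move=> x; rewrite mulr_ge0// sqr_ge0.
- exact: radial_bump_out.
- exact: sin_ge0_in.
- by move=> p _; exact: continuous_sin.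
- move=> r p r0 pI; rewrite /wt_last (gam_ln r0).1 /radial_bump addrK.
  have -> : d * ln r / d = ln r by rewrite mulrAC mulfV ?mul1r// lt0r_neq0.
  by rewrite lnK//; ring.
Qed.

Lemma integral_grad_r :
  integral_rv half (fun z => tensor sqr_bump z *
    planar (density wt_grad (sqf dgam) (sqf Y)) z) =
  (\prod_(j < n) bump_mass *
    (d^-1 * (\int[mu]_(x in `[0, 3]) radial_grad x) * sin_Y))%:E.
Proof.
apply: (@integral_density _ (fun=> bump_mass)) => //.
- exact: sqr_bump_cont.
- exact: sqr_bump_ge0.
- exact: integral_sqr_bump.
- exact: cont_half_wt_grad.
- exact: ge0_half_wt_grad.
- exact: cont_dgam.
- exact: continuous_Ycut_in.
- exact: Ycut_out0.
- exact: radial_grad_cont.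
- by move=> x; exact: sqr_ge0.
- exact: radial_grad_out.
- exact: sin_ge0_in.
- by move=> p _; exact: continuous_sin.
- move=> r p r0 pI; rewrite /wt_grad polar_normsq (gam_ln r0).2 /radial_grad.
  by field; exact: lt0r_neq0.
Qed.

Lemma integral_grad_phi :
  integral_rv half (fun z => tensor sqr_bump z *
    planar (density wt_grad (sqf gam) (sqf dY)) z) =
  (\prod_(j < n) bump_mass * (d^-1 * bump_mass * sin_dY))%:E.
Proof.
apply: (@integral_density _ (fun=> bump_mass) _ _ _ (sqr_bump 0)) => //.
- exact: sqr_bump_cont.
- exact: sqr_bump_ge0.
- exact: integral_sqr_bump.
- exact: cont_half_wt_grad.
- exact: ge0_half_wt_grad.
- exact: cont_gam.
- exact: continuous_dYcut_in.
- exact: dYcut_out0.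
- exact: sqr_bump_cont.
- exact: sqr_bump_ge0.
- exact: sqr_bump_out.
- exact: sin_ge0_in.
- by move=> p _; exact: continuous_sin.
- move=> r p r0 pI; rewrite /wt_grad polar_normsq (gam_ln r0).1 /sqr_bump.
  by field; exact: lt0r_neq0.
Qed.

Lemma integral_test_radius :
  integral_rv half (fun z => `|pf test z| ^+ 2 / radius z) =
  (\prod_(j < n) bump_mass * (d^-1 * bump_mass * den_Y))%:E.
Proof.
transitivity (integral_rv half (fun z => tensor sqr_bump z *
    planar (density wt_radius (sqf gam) (sqf Y)) z)).
  apply: eq_integral_rv => z hz; rewrite pf_pos// real_normK ?num_real//.
  rewrite tensor_sqr /test /planar /density /wave /sqf /wt_radius /radius.
  by ring.
have -> : den_Y = \int[mu]_(p in `[m, pi - m]) (1 * Y p ^+ 2).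
  by apply: eq_Rintegral => p _; rewrite mul1r.
apply: (@integral_density _ (fun=> bump_mass) _ _ _ (sqr_bump 0) (fun=> 1)) => //.
- exact: sqr_bump_cont.
- exact: sqr_bump_ge0.
- exact: integral_sqr_bump.
- exact: cont_half_wt_radius.
- exact: ge0_half_wt_radius.
- exact: cont_gam.
- exact: continuous_Ycut_in.
- exact: Ycut_out0.
- exact: sqr_bump_cont.
- exact: sqr_bump_ge0.
- exact: sqr_bump_out.
- by move=> p _; exact: cst_continuous.
- move=> r p r0 pI; rewrite /wt_radius polar_normsq (gam_ln r0).1 /sqr_bump.
  by rewrite sqrtr_sqr gtr0_norm//; field; exact: lt0r_neq0.
Qed.

(** After the substitution [v = x_n^(1/2) u] this is the Hardy integral of [v]; its finiteness
    allows it to be cancelled in [unweighted_sharp]. *)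
Lemma integral_test_last :
  integral_rv half (fun z => `|pf test z| ^+ 2 / xlast z) =
  (\prod_(j < n) bump_mass * (d^-1 * bump_mass * inv_sin_Y))%:E.
Proof.
transitivity (integral_rv half (fun z => tensor sqr_bump z *
    planar (density wt_inv (sqf gam) (sqf Y)) z)).
  apply: eq_integral_rv => z hz; rewrite pf_pos// real_normK ?num_real//.
  rewrite tensor_sqr /test /planar /density /wave /sqf /wt_inv.
  by ring.
apply: (@integral_density _ (fun=> bump_mass) _ _ _ (sqr_bump 0) (fun p => (sin p)^-1)) => //.
- exact: sqr_bump_cont.
- exact: sqr_bump_ge0.
- exact: integral_sqr_bump.
- exact: cont_half_wt_inv.
- exact: ge0_half_wt_inv.
- exact: cont_gam.
- exact: continuous_Ycut_in.
- exact: Ycut_out0.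
- exact: sqr_bump_cont.
- exact: sqr_bump_ge0.
- exact: sqr_bump_out.
- by move=> p pI; rewrite invr_ge0 sin_ge0_in.
- move=> p pI; have s0 := lt0r_neq0 (sin_gt0_pi pI).
  exact: (continuous_comp (@continuous_sin R p) (inv_continuous s0)).
- move=> r p r0 pI; rewrite /wt_inv (gam_ln r0).1 /sqr_bump.
  by field; rewrite (lt0r_neq0 r0) (lt0r_neq0 (sin_gt0_pi pI)).
Qed.

Lemma integral_test_grad :
  integral_rv half (fun z => xlast z * normsq_grad (pf test) z) =
  (\sum_(i < n) \prod_(j < n) (if j == i :> nat then bump_energy else bump_mass) *
      (d^-1 * radial_mass * sin_Y) +
   (\prod_(j < n) bump_mass * (d^-1 * (\int[mu]_(x in `[0, 3]) radial_grad x) * sin_Y) +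
    \prod_(j < n) bump_mass * (d^-1 * bump_mass * sin_dY)))%:E.
Proof.
rewrite (eq_integral_rv (@normsq_grad_test R n y Cy eta d k)).
have cY p (pI : 0 < p < pi) : {for p, continuous (sqf Y)}.
  by apply: continuous_sq; exact: continuous_Ycut_in.
have cdY p (pI : 0 < p < pi) : {for p, continuous (sqf dY)}.
  by apply: continuous_sq; exact: continuous_dYcut_in.
have cg := continuous_sqrf cont_gam; have cdg := continuous_sqrf cont_dgam.
have D1 := density_cont cont_half_wt_last cg cY.
have D2 := density_cont cont_half_wt_grad cdg cY.
have D3 := density_cont cont_half_wt_grad cg cdY.
have P1 := @density_ge0 _ gam Y ge0_half_wt_last.
have P2 := @density_ge0 _ dgam Y ge0_half_wt_grad.
have P3 := @density_ge0 _ gam dY ge0_half_wt_grad.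
have T1 (h : nat -> R -> R) f : (forall i, continuous (h i)) ->
    cont_half (@planar R n f) -> cont_half (fun z : rV => tensor h z * planar f z).
  move=> ch cf z z0; have ct : {for z, continuous (@tensor R n h)}.
    exact: (tensor_continuous ch).
  have cz := cf z z0.
  exact: (cvgM ct cz).
have T2 (h : nat -> R -> R) f : (forall i x, 0 <= h i x) ->
    ge0_half (@planar R n f) -> ge0_half (fun z : rV => tensor h z * planar f z).
  by move=> h0 f0 z z0; rewrite mulr_ge0 ?tensor_ge0 ?f0.
have S1 (i : 'I_n) := T1 _ _ (@sqr_dbump_cont i) D1.
have S2 := T1 _ _ (@sqr_bump_cont) D2; have S3 := T1 _ _ (@sqr_bump_cont) D3.
have Q1 (i : 'I_n) := T2 _ _ (sqr_dbump_ge0 i) P1.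
have Q2 := T2 _ _ sqr_bump_ge0 P2; have Q3 := T2 _ _ sqr_bump_ge0 P3.
rewrite -integral_rvD.
- rewrite -integral_rvD// (integral_rv_sum _ S1 Q1 integral_last) integral_grad_r.
  by rewrite integral_grad_phi -!EFinD.
- exact: cont_half_sum.
- by move=> z z0; apply: sumr_ge0 => i _; exact: Q1.
- by move=> z z0; exact: (cvgD (S2 z z0) (S3 z z0)).
- by move=> z z0; rewrite addr_ge0 ?Q2 ?Q3.
Qed.

Variable c : R.
Hypothesis Hc : \int[mu]_(p in `[m, pi - m]) cut_num y eta p <
  c * \int[mu]_(p in `[m, pi - m]) (Y p ^+ 2).

Lemma in_segment (p : R) : m <= p <= pi - m -> 0 < p < pi.
Proof.
move=> /andP[h1 h2]; rewrite (lt_le_trans m0 h1)/=.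
by rewrite (le_lt_trans h2)// ltrBlDr ltrDl.
Qed.

Lemma cont_on_sqr_Y : cont_on m (pi - m) (fun p => Y p ^+ 2).
Proof. by move=> p /in_segment pI; exact: (continuous_sq (continuous_Ycut_in pI)). Qed.

Lemma cont_on_sin_Y : cont_on m (pi - m) (fun p => sin p * Y p ^+ 2).
Proof. by move=> p /cont_on_sqr_Y h; exact: (cvgM (@continuous_sin R p) h). Qed.

Lemma cont_on_sin_dY : cont_on m (pi - m) (fun p => sin p * dY p ^+ 2).
Proof.
move=> p /in_segment pI; have h := continuous_sq (continuous_dYcut_in pI).
exact: (cvgM (@continuous_sin R p) h).
Qed.

Lemma sin_Y_le : sin_Y <= den_Y.
Proof.
apply: le_Rintegral_cont; [exact: cont_on_sin_Y|exact: cont_on_sqr_Y|].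
by move=> p _; apply: ler_piMl; [exact: sqr_ge0|exact: sin_le1].
Qed.

Lemma sin_Y_ge0 : 0 <= sin_Y.
Proof.
apply: Rintegral_ge0 => p /=; rewrite in_itv/= => /in_segment pI.
by rewrite mulr_ge0 ?sin_ge0_in ?sqr_ge0.
Qed.

Lemma sin_dY_ge0 : 0 <= sin_dY.
Proof.
apply: Rintegral_ge0 => p /=; rewrite in_itv/= => /in_segment pI.
by rewrite mulr_ge0 ?sin_ge0_in ?sqr_ge0.
Qed.

Lemma cut_num_split : sin_dY + 4^-1 * sin_Y < c * den_Y.
Proof.
have c2 : cont_on m (pi - m) (fun p => 4^-1 * (sin p * Y p ^+ 2)).
  exact: (cont_onM (@cont_on_cst _ _ _ _) cont_on_sin_Y).
have -> // : sin_dY + 4^-1 * sin_Y = \int[mu]_(p in `[m, pi - m]) cut_num y eta p.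
rewrite -(RintegralZ_cont _ cont_on_sin_Y) -(RintegralD_cont cont_on_sin_dY c2).
by apply: eq_Rintegral => p _; rewrite /cut_num; ring.
Qed.

Lemma radial_mass_ge0 : 0 <= radial_mass.
Proof. by apply: Rintegral_ge0 => x _; rewrite mulr_ge0 ?sqr_ge0. Qed.

Lemma radial_mass_le : radial_mass <= expR ((3 - k) / d) ^+ 2 * bump_mass.
Proof.
have cb := cont_onT (a := 0) (b := 3) (@sqr_bump_cont 0).
rewrite /bump_mass -(RintegralZ_cont _ cb); apply: le_Rintegral_cont.
- by apply: cont_onT; exact: radial_bump_cont.
- exact: (cont_onM (@cont_on_cst _ _ _ _) cb).
- move=> x /andP[_ x3]; rewrite /radial_bump ler_wpM2r ?sqr_ge0// lerXn2r ?nnegrE ?expR_ge0//.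
  by rewrite ler_expR ler_pM2r ?invr_gt0// lerD2r.
Qed.

Lemma prod_energy (i : 'I_n) :
  \prod_(j < n) (if j == i :> nat then bump_energy else bump_mass) =
  bump_energy / bump_mass * bump_mass ^+ n.
Proof.
have -> : bump_mass ^+ n = \prod_(j < n) bump_mass by rewrite prodr_const card_ord.
rewrite (bigD1 i)//= [in RHS](bigD1 i)//= eqxx mulrA divfK ?lt0r_neq0 ?bump_mass_gt0//.
congr (_ * _); apply: eq_bigr => j ji; rewrite ifF//.
by apply/negbTE; apply: contra ji => /eqP /val_inj ->.
Qed.

(** [P0], [P1], [Pr] stand for [bump_mass], [bump_energy], [radial_mass] and [S0], [S1], [S2] for
    [den_Y], [sin_Y], [sin_dY]. The strict angular inequality forces [S0 > 0]; after factoring out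
    [P0 ^+ n / d] the estimate holds term by term. *)
Lemma energy_arithmetic (P0 P1 Pr S0 S1 S2 X : R) :
  0 < P0 -> 0 <= P1 -> 0 <= Pr -> Pr <= X * P0 -> 0 <= X -> 0 <= S1 -> 0 <= S2 ->
  S1 <= S0 -> S2 + 4^-1 * S1 < c * S0 ->
  0 < P0 ^+ n * (d^-1 * P0 * S0) /\
  n%:R * (P1 / P0 * P0 ^+ n * (d^-1 * Pr * S1)) +
    (P0 ^+ n * (d^-1 * (d ^+ 2 * P1 + 4^-1 * P0) * S1) + P0 ^+ n * (d^-1 * P0 * S2)) <=
  (c + P1 / P0 * (n%:R * X + d ^+ 2)) * (P0 ^+ n * (d^-1 * P0 * S0)).
Proof.
move=> P00 P10 Pr0 PrX X0 S10 S20 S1S0 Sc.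
have S00 : 0 < S0.
  rewrite lt_neqAle eq_sym (le_trans S10 S1S0) andbT.
  apply/eqP => S; move: Sc; rewrite S mulr0 ltNge => /negP; apply.
  by rewrite addr_ge0// mulr_ge0// invr_ge0.
have W0 : 0 < P0 ^+ n * d^-1 by rewrite mulr_gt0 ?exprn_gt0 ?invr_gt0.
split; first by apply: mulr_gt0; [exact: exprn_gt0|rewrite !mulr_gt0 ?invr_gt0].
set q := P1 / P0; have q0 : 0 <= q by rewrite divr_ge0// ltW.
have -> : P1 = q * P0 by rewrite divfK ?lt0r_neq0.
set W := P0 ^+ n * d^-1 in W0.
have -> : n%:R * (q * P0 ^+ n * (d^-1 * Pr * S1)) +
    (P0 ^+ n * (d^-1 * (d ^+ 2 * (q * P0) + 4^-1 * P0) * S1) +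
     P0 ^+ n * (d^-1 * P0 * S2)) =
    W * (n%:R * q * (Pr * S1) + P0 * (d ^+ 2 * q * S1) + P0 * (S2 + 4^-1 * S1)).
  by rewrite /W; ring.
have -> : (c + q * (n%:R * X + d ^+ 2)) * (P0 ^+ n * (d^-1 * P0 * S0)) =
    W * (n%:R * q * ((X * P0) * S0) + P0 * (d ^+ 2 * q * S0) + P0 * (c * S0)).
  by rewrite /W; ring.
rewrite ler_pM2l//; apply: lerD; first apply: lerD.
- by apply: ler_wpM2l; [rewrite mulr_ge0|apply: ler_pM].
- apply: ler_wpM2l; first exact: ltW.
  by apply: ler_wpM2l => //; rewrite mulr_ge0// sqr_ge0.
- by apply: ler_wpM2l; exact: ltW.
Qed.

(** The quotient of the test function exceeds [c] by at most two errors: the derivatives in the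
    first [n] variables, damped by [expR ((3 - k) / d) ^+ 2], and the radial truncation, of order
    [d ^+ 2]. *)
Lemma test_bound : exists B C : R, [/\ 0 < B,
  integral_rv half (fun z => `|pf test z| ^+ 2 / radius z) = B%:E,
  integral_rv half (fun z => `|pf test z| ^+ 2 / xlast z) = C%:E &
  (integral_rv half (fun z => xlast z * normsq_grad (pf test) z)%R <=
    ((c + bump_energy / bump_mass * (n%:R * expR ((3 - k) / d) ^+ 2 + d ^+ 2)) * B)%:E)%E].
Proof.
have Pn : \prod_(j < n) bump_mass = bump_mass ^+ n by rewrite prodr_const card_ord.
have [B0 AB] := energy_arithmetic bump_mass_gt0 bump_energy_ge0 radial_mass_ge0
  radial_mass_le (sqr_ge0 _) sin_Y_ge0 sin_dY_ge0 sin_Y_le cut_num_split.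
exists (bump_mass ^+ n * (d^-1 * bump_mass * den_Y)).
exists (bump_mass ^+ n * (d^-1 * bump_mass * inv_sin_Y)).
split; first exact: B0.
- by rewrite integral_test_radius Pn.
- by rewrite integral_test_last Pn.
rewrite integral_test_grad Pn lee_fin; apply: le_trans AB.
rewrite le_eqVlt; apply/orP; left; apply/eqP; congr (_ + (_ * (_ * _ * _) + _)).
  under eq_bigr do rewrite prod_energy.
  by rewrite sumr_const card_ord mulr_natl.
exact: cross_term.
Qed.

End test_energy.

(** * Optimality of lambda *)

Section sharpness.
Context {R : realType} {n : nat}.
Local Notation rV := 'rV[R]_n.+2.
Local Notation half := (half_space R n).

(** A third of [e] goes to the choice of [y], a third to the radial truncation (small [d]), a third
    to the derivatives in the first [n] variables (large [k]). *)
Lemma near_optimal (e : R) : 0 < e -> exists (u : rV -> R) (B C : R),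
  [/\ C0infty half u, (forall z, xlast z <= 0 -> u z = 0), 0 < B,
    integral_rv half (fun z => `|u z| ^+ 2 / radius z) = B%:E &
    integral_rv half (fun z => `|u z| ^+ 2 / xlast z) = C%:E /\
    (integral_rv half (fun z => xlast z * normsq_grad u z)%R <=
      ((lambda R + e) * B)%:E)%E].
Proof.
move=> e0; pose e' := e / 3; have e'0 : 0 < e' by rewrite divr_gt0.
have [y [Cy _ Hy]] := lambda_approx e'0.
have c0 : 0 < lambda R + e' by rewrite addr_gt0// lambda_gt0.
have [eta [m [eta0 m0 mpi Hout Hc]]] := angular_cutoff Cy c0 Hy.
pose q : R := bump_energy / bump_mass.
have q0 : 0 <= q by rewrite divr_ge0 ?bump_energy_ge0// ltW// bump_mass_gt0.
have q1 : 0 < q + 1 by rewrite ltr_wpDl.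
pose d := Num.min 1 (e' / (q + 1)).
have d0 : 0 < d by rewrite lt_min ltr01 divr_gt0.
(* With this [z], and [k] chosen so that [(3 - k) / d = - z], the third error is
   [e' * z * expR (- z) ^+ 2], at most [e'] because [z <= expR z]. *)
pose z := n%:R * q / e'; have z0 : 0 <= z by rewrite divr_ge0 ?(ltW e'0)// mulr_ge0.
pose k := 3 + d * z.
have qd : q * d ^+ 2 <= e'.
  have h1 : d <= 1 by rewrite ge_min lexx.
  have h2 : d * (q + 1) <= e' by rewrite -ler_pdivlMr// ge_min lexx orbT.
  apply: (@le_trans _ _ (q * d)).
    by rewrite ler_wpM2l// expr2 ler_piMr// ltW.
  by apply: le_trans h2; rewrite mulrC ler_wpM2l ?lerDl// ltW.
have ez : expR ((3 - k) / d) = (expR z)^-1.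
  rewrite -expRN; congr expR; rewrite /k opprD addrA subrr add0r.
  by rewrite mulNr mulrAC mulfV ?mul1r// lt0r_neq0.
have qz : q * (n%:R * expR ((3 - k) / d) ^+ 2) <= e'.
  rewrite ez; have E1 : 1 + z <= expR z by exact: expR_ge1Dx.
  have E0 : 0 < expR z by exact: expR_gt0.
  have i1 : (expR z)^-1 <= 1 by rewrite invf_le1// (le_trans _ E1)// lerDl.
  have nq : n%:R * q = e' * z by rewrite /z; field; exact: lt0r_neq0.
  rewrite mulrA [q * _]mulrC nq -mulrA ler_piMr ?(ltW e'0)//.
  apply: (@le_trans _ _ (z * (expR z)^-1)).
    by rewrite ler_wpM2l// expr2 ler_piMr// invr_ge0 ltW.
  by rewrite ler_pdivrMr// mul1r (le_trans _ E1)// lerDr.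
have [B [C [B0 HB HC HA]]] := @test_bound R n y Cy eta d k m d0 m0 Hout _ Hc.
exists (pf (test y eta d k)), B, C; split => //; last split => //.
- exact: C0infty_test.
- by move=> x x0; rewrite /pf ltNge x0.
apply: le_trans HA _; rewrite lee_fin ler_wpM2r ?(ltW B0)// -addrA lerD2l.
have -> : e = e' + (e' + e') by rewrite /e'; field.
by rewrite lerD2l mulrDr lerD.
Qed.

(** As [u] vanishes off the open half-space, its supports relative to the half-space and to the
    closure coincide; so the same test functions are admissible in the weighted inequality. *)
Lemma C0infty_closure (u : rV -> R) : C0infty half u ->
  (forall z, xlast z <= 0 -> u z = 0) -> C0infty (closure half) u.
Proof.
move=> [su cu subu] u0; rewrite /C0infty.
have -> : closure half `&` [set x | u x != 0] = half `&` [set x | u x != 0].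
  apply/seteqP; split=> z [hz uz]; split=> //; last exact: subset_closure.
  by rewrite /half_space /= ltNge; apply: contra uz => /u0 ->.
by split=> //; apply: subset_trans subu _; exact: subset_closure.
Qed.

Lemma sharp_of_approx (L : R) : (forall e : R, 0 < e -> exists2 B : R, 0 < B &
  L * B <= (lambda R + e) * B) -> L <= lambda R.
Proof.
move=> h; apply/ler_addgt0Pr => e /h [B B0].
by rewrite ler_pM2r.
Qed.

Lemma weighted_sharp (L : R) :
  (forall u : rV -> R, C0infty (closure half) u ->
    (L%:E * integral_rv half (fun z => `|u z| ^+ 2 / radius z)%R <=
     integral_rv half (fun z => xlast z * normsq_grad u z)%R)%E) -> L <= lambda R.
Proof.
move=> H; apply: sharp_of_approx => e e0.
have [u [B [C [Cu u0 B0 HB [_ HA]]]]] := near_optimal e0; exists B => //.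
have := H u (C0infty_closure Cu u0); rewrite HB -EFinM => h.
by rewrite -lee_fin; apply: le_trans h HA.
Qed.

Lemma unweighted_sharp (L : R) :
  (forall v : rV -> R, C0infty half v ->
    ((4^-1)%:E * integral_rv half (fun z => `|v z| ^+ 2 / xlast z ^+ 2)%R +
     L%:E * integral_rv half (fun z => `|v z| ^+ 2 / (xlast z * radius z))%R <=
     integral_rv half (normsq_grad v))%E) -> L <= lambda R.
Proof.
move=> H; apply: sharp_of_approx => e e0.
have [u [B [C [Cu u0 B0 HB [HC HA]]]]] := near_optimal e0; exists B => //.
pose v := pf (fun z => hs (xlast z) * u z).
have Cv : C0infty half v := C0infty_mul Coo1_hs Cu.
have vE z : half z -> v z = hs (xlast z) * u z by exact: pf_pos.
have := H v Cv; rewrite (transfer Cu Cv u0 vE).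
have -> : integral_rv half (fun z => `|v z| ^+ 2 / (xlast z * radius z)) = B%:E.
  by rewrite -HB; apply: eq_integral_rv => z hz; exact: (hs_sqr_div hz (vE z hz)).
have -> : integral_rv half (fun z => `|v z| ^+ 2 / xlast z ^+ 2) = C%:E.
  rewrite -HC; apply: eq_integral_rv => z hz.
  rewrite vE// !real_normK ?num_real// exprMn hs_sqr//.
  by field; exact: lt0r_neq0.
(* The Hardy term is the finite number [4^-1 * C], so it cancels from both sides. *)
rewrite -!EFinM leeD2lE// => h.
by rewrite -lee_fin; apply: le_trans h HA.
Qed.

End sharpness.

Theorem corollary2 (R : realType) (n : nat) :
  [/\ sharp_value
        (fun L : R => forall u : 'rV[R]_n.+2 -> R,
           C0infty (closure (half_space R n)) u ->
           (L%:E * integral_rv (half_space R n)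
                     (fun x => `|u x| ^+ 2
                        / Num.sqrt (xpenult x ^+ 2 + xlast x ^+ 2))%R
            <= integral_rv (half_space R n)
                 (fun x => xlast x * normsq_grad u x)%R)%E)
        (lambda R),
      sharp_value
        (fun L : R => forall v : 'rV[R]_n.+2 -> R,
           C0infty (half_space R n) v ->
           ((4^-1)%:E * integral_rv (half_space R n)
                          (fun x => `|v x| ^+ 2 / xlast x ^+ 2)%R
            + L%:E * integral_rv (half_space R n)
                       (fun x => `|v x| ^+ 2
                          / (xlast x
                             * Num.sqrt (xpenult x ^+ 2 + xlast x ^+ 2)))%R
            <= integral_rv (half_space R n) (normsq_grad v))%E)
        (lambda R)
    & 1564 / 10000 <= lambda R < 1565 / 10000].
Proof.
split.
- split=> [u Cu|L HL]; first exact: weighted_lower_bound (@subset_closure _ _) Cu.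
  exact: (@weighted_sharp R n).
- split=> [v Cv|L HL]; first exact: unweighted_lower_bound.
  exact: (@unweighted_sharp R n).
- exact: lambda_bounds.
Qed.
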